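(* Let $f\in L^2(\mathbb{R}^2)$ be real-valued with compactly supported Fourier transform $\hat f$. There are sequences $(U_n,K_n)_{n\in\mathbb{N}_0}$ of real-valued functions with $$(U_0,K_0)\in\operatorname*{arg\,min}_{u,k\in L^2(\mathbb{R}^2)}\left\{\|f-k*u\|_{L^2}^2+\lambda_0\|u\|_{H^r}^2+\mu_0\|k\|_{H^s}^2\right\}$$ and, for all $n\in\mathbb{N}_0$, $$(U_{n+1}-U_n,K_{n+1}-K_n)\in\operatorname*{arg\,min}_{u,k\in L^2(\mathbb{R}^2)}\left\{\|f-(k+K_n)*(u+U_n)\|_{L^2}^2+\lambda_{n+1}\|u\|_{H^r}^2+\mu_{n+1}\|k\|_{H^s}^2\right\},$$ such that $\hat K_n$ is real-valued and non-negative. Moreover, $(U_n,K_n)$ can iteratively be computed as follows: (i) $U_0$ and $K_0$ are the inverse Fourier transforms of $$\hat U_0=\operatorname{sgn}(\hat f)\sqrt{\left[\sqrt{\tfrac{\mu_0}{\lambda_0}\Delta^{s-r}}\,|\hat f|-\mu_0\Delta^s\right]_+},\qquad \hat K_0=\sqrt{\left[\sqrt{\tfrac{\lambda_0}{\mu_0}\Delta^{r-s}}\,|\hat f|-\lambda_0\Delta^r\right]_+}.$$ (ii) For $n\in\mathbb{N}_0$, $U_{n+1}$ and $K_{n+1}$ are the inverse Fourier transforms of $\hat U_{n+1}=\hat U_n+\hat u_{n+1}$ and $\hat K_{n+1}=\hat K_n+\hat k_{n+1}$, where $\hat u_{n+1},\hat k_{n+1}$ solve $$(\hat u_{n+1},\hat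 k_{n+1})\in\operatorname*{arg\,min}_{\hat u,\hat k\in L^2(\mathbb{R}^2,\mathbb{C})}\left\{\|\hat f-(\hat u+\hat U_n)(\hat k+\hat K_n)\|_{L^2}^2+\lambda_{n+1}\|\Delta^{r/2}\hat u\|_{L^2}^2+\mu_{n+1}\|\Delta^{s/2}\hat k\|_{L^2}^2\right\}$$ and satisfy $\hat k_{n+1}(x)\in[0,\infty)$, $\hat k_{n+1}(x)=\hat k_{n+1}(-x)$, $\hat u_{n+1}(x)=\overline{\hat u_{n+1}(-x)}$ for all $x\in\mathbb{R}^2$, as well as $\operatorname{sgn}(\hat u_{n+1})=\operatorname{sgn}(\hat f)$.
   Context: $L^2(\mathbb{R}^2)$ denotes real-valued and $L^2(\mathbb{R}^2,\mathbb{C})$ complex-valued square-integrable functions on $\mathbb{R}^2$. The hat denotes the Fourier transform, normalized so that it is an $L^2$-isometry and turns convolution into multiplication ($\widehat{k*u}=\hat k\hat u$), e.g. $\hat u(x)=\int u(y)e^{-2\pi i x\cdot y}\,dy$. Since $f$ is real-valued, $\hat f(x)=\overline{\hat f(-x)}$ for all $x$. $\Delta(x)=1+|x|^2$, and for $t\ge0$, $\|u\|_{H^t}^2=\int_{\mathbb{R}^2}\Delta(x)^t|\hat u(x)|^2\,dx$ (equal to $\infty$ if the integral diverges); likewise $\|w\|_{L^2}=\infty$ if $w\notin L^2$. $r,s\ge0$; $(\lambda_n)_{n\in\mathbb{N}_0}$, $(\mu_n)_{n\in\mathbb{N}_0}$ are decreasing sequences of positive reals. $[w]_+=\max\{w,0\}$,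 and for $z\in\mathbb{C}$, $\operatorname{sgn}(z)=z/|z|$ if $z\neq0$, $\operatorname{sgn}(0)=0$.
   Formalization: The condition sgn(û_{n+1}) = sgn(f̂) is required only where û_{n+1} ≠ 0, since the literal equality fails where f̂ is nonzero but small compared with the penalties and the minimizer vanishes; pointwise conditions are read almost everywhere. *)

(* Defs.v *)
From HB Require Import structures.
From mathcomp Require Import all_boot all_order all_algebra.
From mathcomp Require Import complex.
From mathcomp Require Import all_classical all_reals all_analysis.

Set Implicit Arguments.
Unset Strict Implicit.
Unset Printing Implicit Defensive.
Import Order.TTheory GRing.Theory Num.Theory.
Import numFieldNormedType.Exports.

Local Open Scope classical_set_scope.
Local Open Scope ring_scope.
Local Open Scope complex_scope.

(* Elements of the Lebesgue spaces are represented by functions, so pointwise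
   properties of them are stated almost everywhere. *)

Definition lebesgue2 (R : realType) := (@lebesgue_measure R \x @lebesgue_measure R)%E.

Definition inL2 (R : realType) (u : R * R -> R) : Prop :=
  u \in Lfun (@lebesgue2 R) 2%:E.

Definition inL2C (R : realType) (g : R * R -> R[i]) : Prop :=
  inL2 (fun x => complex.Re (g x)) /\ inL2 (fun x => complex.Im (g x)).

Definition L2norm (R : realType) (u : R * R -> R) : \bar R :=
  Lnorm (@lebesgue2 R) 2%:E (EFin \o u).

Definition L2normC (R : realType) (g : R * R -> R[i]) : \bar R :=
  L2norm (fun x => Normc.normc (g x)).

(* e^{- i t} *)
Definition expNi (R : realType) (t : R) : R[i] := cos t -i* sin t.

Definition dot2 (R : realType) (x y : R * R) : R := x.1 * y.1 + x.2 * y.2.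

Definition integralC (R : realType) (D : set (R * R)) (g : R * R -> R[i]) : R[i] :=
  Rintegral (@lebesgue2 R) D (fun x => complex.Re (g x))
  +i* Rintegral (@lebesgue2 R) D (fun x => complex.Im (g x)).

Definition square (R : realType) (n : nat) : set (R * R) :=
  `[- n%:R, n%:R] `*` `[- n%:R, n%:R].

(* For g in L2, the integral of g(y) e^{- 2 pi i x.y} need not converge, but
   it does once restricted to a bounded square. *)
Definition truncated_fourier (R : realType) (n : nat) (g : R * R -> R[i]) :
    R * R -> R[i] :=
  fun x => integralC (@square R n) (fun y => g y * expNi (2 * pi * dot2 x y)).

(* The Fourier transform on L2: h is the limit in the mean of the truncated
   Fourier integrals of g. *)
Definition is_fourier (R : realType) (g h : R * R -> R[i]) : Prop :=
  inL2C h /\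
  (fun n => L2normC (fun x => h x - truncated_fourier n g x)) @ \oo --> 0%E.

(* By Plancherel's theorem, every g in L2 has a transform, and this
   transform is unique almost everywhere; fourier g is one of its
   representatives. *)
Definition fourier (R : realType) (g : R * R -> R[i]) : R * R -> R[i] :=
  xget (fun=> 0) [set h | is_fourier g h].

Definition hat (R : realType) (u : R * R -> R) : R * R -> R[i] :=
  fourier (fun x => (u x)%:C).

Definition Delta (R : realType) (x : R * R) : R := 1 + (x.1 ^+ 2 + x.2 ^+ 2).

Definition sobolev_sqnorm (R : realType) (t : R) (u : R * R -> R) : \bar R :=
  (\int[@lebesgue2 R]_x (Delta x `^ t * Normc.normc (hat u x) ^+ 2)%:E)%E.

Definition convolution (R : realType) (k u : R * R -> R) : R * R -> R :=
  fun x => Rintegral (@lebesgue2 R) setT (fun y => k y * u (x - y)).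

Definition sgnC (R : realType) (z : R[i]) : R[i] :=
  if z == 0 then 0 else z / `|z|.

Definition argmin (R : realType) (T : Type) (A : set T) (J : T -> \bar R) : set T :=
  [set p | A p /\ forall q, A q -> (J p <= J q)%E].

Definition L2pairs (R : realType) : set ((R * R -> R) * (R * R -> R)) :=
  [set p | inL2 p.1 /\ inL2 p.2].

Definition L2pairsC (R : realType) :
    set ((R * R -> R[i]) * (R * R -> R[i])) :=
  [set p | inL2C p.1 /\ inL2C p.2].

Definition energy (R : realType) (r s l m : R) (f U K : R * R -> R)
    (p : (R * R -> R) * (R * R -> R)) : \bar R :=
  (L2norm (f \- convolution (p.2 \+ K) (p.1 \+ U))%R ^+ 2
   + l%:E * sobolev_sqnorm r p.1 + m%:E * sobolev_sqnorm s p.2)%E.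

Definition fourier_energy (R : realType) (r s l m : R) (hf hU hK : R * R -> R[i])
    (p : (R * R -> R[i]) * (R * R -> R[i])) : \bar R :=
  (L2normC (hf \- (p.1 \+ hU) \* (p.2 \+ hK))%R ^+ 2
   + l%:E * L2normC (fun x => (Delta x `^ (r / 2))%:C * p.1 x)%R ^+ 2
   + m%:E * L2normC (fun x => (Delta x `^ (s / 2))%:C * p.2 x)%R ^+ 2)%E.

Definition compact_fourier_support (R : realType) (f : R * R -> R) : Prop :=
  exists2 C : set (R * R), compact C &
    \forall x \ae @lebesgue2 R, ~ C x -> hat f x = 0.

Definition multiscale_minimizers (R : realType) (r s : R) (lam mu : nat -> R)
    (f : R * R -> R) (U K : nat -> R * R -> R) : Prop :=
  argmin (@L2pairs R) (energy r s (lam 0%N) (mu 0%N) f (fun=> 0) (fun=> 0))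
    (U 0%N, K 0%N) /\
  forall n,
    argmin (@L2pairs R) (energy r s (lam n.+1) (mu n.+1) f (U n) (K n))
      (U n.+1 \- U n, K n.+1 \- K n).

(* The order of R[i] satisfies 0 <= z iff z is real and non-negative. *)
Definition nonneg_transforms (R : realType) (K : nat -> R * R -> R) : Prop :=
  forall n, \forall x \ae @lebesgue2 R, 0 <= hat (K n) x.

Definition hatU0 (R : realType) (r s l m : R) (f : R * R -> R) (x : R * R) : R[i] :=
  sgnC (hat f x) *
  (Num.sqrt (Num.max (Num.sqrt (m / l * Delta x `^ (s - r)) * Normc.normc (hat f x)
                      - m * Delta x `^ s) 0))%:C.

Definition hatK0 (R : realType) (r s l m : R) (f : R * R -> R) (x : R * R) : R[i] :=
  (Num.sqrt (Num.max (Num.sqrt (l / m * Delta x `^ (r - s)) * Normc.normc (hat f x)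
                      - l * Delta x `^ r) 0))%:C.

(* The sign of hu is that of hf wherever hu does not vanish; hu does vanish at
   points where hf is different from 0 but small compared with the penalties. *)
Definition admissible_increment (R : realType) (hf hu hk : R * R -> R[i]) : Prop :=
  \forall x \ae @lebesgue2 R,
    [/\ 0 <= hk x, hk x = hk (- x), hu x = (hu (- x))^* &
        hu x != 0 -> sgnC (hu x) = sgnC (hf x)].

Definition computed_iteratively (R : realType) (r s : R) (lam mu : nat -> R)
    (f : R * R -> R) (U K : nat -> R * R -> R) : Prop :=
  [/\ forall n, inL2 (U n) /\ inL2 (K n),
      (hat (U 0%N) = hatU0 r s (lam 0%N) (mu 0%N) f %[ae @lebesgue2 R]) /\
      (hat (K 0%N) = hatK0 r s (lam 0%N) (mu 0%N) f %[ae @lebesgue2 R]) &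
      forall n, exists hu hk : R * R -> R[i],
        [/\ argmin (@L2pairsC R)
              (fourier_energy r s (lam n.+1) (mu n.+1)
                 (hat f) (hat (U n)) (hat (K n))) (hu, hk),
            admissible_increment (hat f) hu hk,
            hat (U n.+1) = hat (U n) \+ hu %[ae @lebesgue2 R] &
            hat (K n.+1) = hat (K n) \+ hk %[ae @lebesgue2 R]]].

(* Main.v *)
(* On each frequency the objective depends only on the values z, U, K of the transforms of f and
   of the current iterate there. If U has the phase of z, 0 <= K and |U| K <= |z|, then the complex
   problem reduces to minimising (|z| - P Q)^2 + l (P - |U|)^2 + m (Q - K)^2 over reals P, Q >= 0.
   Eliminating P leaves a function of Q whose minimisers over Q >= 0 may be sought in a compact
   interval starting at K; they satisfy |U| <= P and P Q <= |z|, so the three conditions on (z, U, K)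
   persist, and the smallest minimiser is a measurable function of the frequency.

   That this computes minimisers among real functions needs Plancherel's theorem and the
   convolution theorem on L2(R^2). Both are proved for the Hartley transform, the integral of
   g(x) (cos + sin)(2 pi x.y), which keeps real functions real and whose even part minus i times
   its odd part is the Fourier transform. Inserting the weights exp(-c (|y_1| + |y_2|)) produces
   Poisson means; they show that the Hartley transform is an involutive contraction, hence an
   isometry. For k, u in L2 the value (k * u)(x) is an inner product, so k * u is pointwise the
   Hartley transform of an integrable product. *)

(* Two difficulties shape the proof. The convolution of two L2 functions need not lie in L2, so the
   residual may have infinite norm and an isometry of L2 says nothing about it. What is needed is an
   identity between extended-real integrals, for an integrable product V that may or may not be
   square-integrable. It rests on inversion for V in L1 with transform in L2, obtained by testing
   against bounded continuous integrable functions. The same duality, with the symmetry of the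
   kernel, extends the involution to all of L2 without a density argument. The weights exp(-|t|) are
   convenient because both their transform and the integral of that transform have elementary
   primitives, the latter an arctangent. The other difficulty is that increments are chosen
   frequency by frequency and yet must be transforms of real L2 functions. Comparison with the zero
   increment bounds them by the data, which gives square-integrability. Hermitian symmetry holds
   because the choice depends only on moduli and on the phase of the data, so a fixed rule of
   selection commutes with conjugation. *)
From HB Require Import structures.
From mathcomp Require Import all_boot all_order all_algebra.
From mathcomp Require Import complex.
From mathcomp Require Import all_classical all_reals all_analysis.
From mathcomp Require Import measurable_realfun ring lra.
Require Import Defs.

Set Implicit Arguments.
Unset Strict Implicit.
Unset Printing Implicit Defensive.
Import Order.TTheory GRing.Theory Num.Theory.
Import numFieldNormedType.Exports.

Local Open Scope classical_set_scope.
Local Open Scope ring_scope.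

(* Locked: unfolding integrals makes failing unifications very slow. *)
HB.lock Definition integ d (T : measurableType d) (R : realType)
  (mu : {measure set T -> \bar R}) (f : T -> R) : R := Rintegral mu setT f.

(** * Integrable and square-integrable real functions *)

Section L2_toolkit.
Context d (T : measurableType d) (R : realType) (mu : {measure set T -> \bar R}).
Implicit Types (f g h : T -> R) (c : R).

Definition intg f := mu.-integrable setT (EFin \o f).
Local Notation integ := (integ mu).
Definition L2f f := measurable_fun setT f /\ intg (fun x => f x ^+ 2).
(** The squared L2 norm as a real number. It is 0 when the integral is infinite, so its use is tied
    to [L2f]; extended integrals are kept wherever infinity can occur. *)
Definition sq f : R := integ (fun x => f x ^+ 2).

(** The notation [%[ae mu]] unfolds to an implication from membership in [setT]; this removes that
    guard. *)
Lemma ae_eqE (V : Type) (f g : T -> V) :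
  f = g %[ae mu] <-> \forall x \ae mu, f x = g x.
Proof. by split; apply: filterS => x h; [exact: h|move=> _]. Qed.

Lemma intg_meas f : intg f -> measurable_fun setT f.
Proof. by move=> /integrableP[/measurable_EFinP]. Qed.

Lemma L2f_meas f : L2f f -> measurable_fun setT f.
Proof. by case. Qed.

Lemma eq_intg f g : f =1 g -> intg f -> intg g.
Proof. by move=> /funext ->. Qed.

Lemma eq_integ f g : f =1 g -> integ f = integ g.
Proof. by move=> /funext ->. Qed.

Lemma eq_L2f f g : f =1 g -> L2f f -> L2f g.
Proof. by move=> /funext ->. Qed.

Lemma intgD f g : intg f -> intg g -> intg (fun x => f x + g x).
Proof. by move=> hf hg; have := integrableD measurableT hf hg; apply: eq_integrable. Qed.

Lemma intgZ c f : intg f -> intg (fun x => c * f x).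
Proof. by move=> hf; have := integrableZl measurableT c hf; apply: eq_integrable. Qed.

Lemma intgN f : intg f -> intg (fun x => - f x).
Proof. by move=> /(intgZ (-1)); apply: eq_intg => x; rewrite mulN1r. Qed.

Lemma intgB f g : intg f -> intg g -> intg (fun x => f x - g x).
Proof. by move=> hf /intgN; apply: intgD. Qed.

Lemma intg_le f g : measurable_fun setT f -> (forall x, `|f x| <= g x) ->
  intg g -> intg f.
Proof.
move=> mf fg; apply: le_integrable => //; first exact/measurable_EFinP.
by move=> x _ /=; rewrite lee_fin (le_trans (fg x))// ler_norm.
Qed.

Lemma intg_norm f : intg f -> intg (fun x => `|f x|).
Proof. by move=> hf; have := integrable_norm hf; apply: eq_integrable. Qed.

Lemma integD f g : intg f -> intg g -> integ (fun x => f x + g x) = integ f + integ g.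
Proof. by move=> hf hg; rewrite !integ.unlock RintegralD. Qed.

Lemma integB f g : intg f -> intg g -> integ (fun x => f x - g x) = integ f - integ g.
Proof. by move=> hf hg; rewrite !integ.unlock RintegralB. Qed.

Lemma integZ c f : intg f -> integ (fun x => c * f x) = c * integ f.
Proof. by move=> hf; rewrite !integ.unlock RintegralZl. Qed.

Lemma integZr c f : intg f -> integ (fun x => f x * c) = integ f * c.
Proof. by move=> hf; rewrite mulrC -integZ//; apply: eq_integ => x; rewrite mulrC. Qed.

Lemma integN f : intg f -> integ (fun x => - f x) = - integ f.
Proof.
by move=> hf; rewrite -mulN1r -integZ//; apply: eq_integ => x; rewrite mulN1r.
Qed.

Lemma le_integ f g : intg f -> intg g -> (forall x, f x <= g x) -> integ f <= integ g.
Proof. by move=> hf hg fg; rewrite !integ.unlock; apply: le_Rintegral. Qed.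

Lemma integ_ge0 f : (forall x, 0 <= f x) -> 0 <= integ f.
Proof. by move=> f0; rewrite integ.unlock; apply: Rintegral_ge0. Qed.

Lemma norm_integ_le f : intg f -> `|integ f| <= integ (fun x => `|f x|).
Proof. by move=> hf; rewrite !integ.unlock; apply: le_normr_Rintegral. Qed.

Lemma integE f : intg f -> (integ f)%:E = (\int[mu]_x (f x)%:E)%E.
Proof. by move=> hf; rewrite !integ.unlock /Rintegral fineK// integrable_fin_num. Qed.

Lemma RintegralE f : Rintegral mu setT f = integ f.
Proof. by rewrite integ.unlock. Qed.

Lemma integ0 : integ (fun=> 0) = 0.
Proof. by rewrite !integ.unlock /Rintegral integral0. Qed.

Lemma ge0_intgP f : measurable_fun setT f -> (forall x, 0 <= f x) ->
  intg f <-> (\int[mu]_x (f x)%:E < +oo)%E.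
Proof.
move=> mf f0; have e : (\int[mu]_x `|(f x)%:E| = \int[mu]_x (f x)%:E)%E.
  by apply: eq_integral => x _; rewrite gee0_abs// lee_fin.
split=> [/integrableP[_]|fo]; first by rewrite e.
by apply/integrableP; split; [exact/measurable_EFinP|rewrite e].
Qed.

Lemma ae_intg f g : measurable_fun setT g -> f = g %[ae mu] -> intg f -> intg g.
Proof.
move=> mg fg /[dup] /intg_meas mf /integrableP[_ fo].
apply/integrableP; split; first exact/measurable_EFinP.
rewrite (le_lt_trans _ fo)// le_eqVlt; apply/orP; left; apply/eqP.
apply: ae_eq_integral => //.
- by apply/measurable_EFinP; exact: measurableT_comp.
- by apply/measurable_EFinP; exact: measurableT_comp.
by apply: filterS fg => x /= fg _; rewrite fg.
Qed.

Lemma ae_integ f g : measurable_fun setT f -> measurable_fun setT g ->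
  f = g %[ae mu] -> integ f = integ g.
Proof.
move=> mf mg fg; rewrite !integ.unlock /Rintegral; congr fine.
apply: ae_eq_integral => //; [exact/measurable_EFinP..|].
by apply: filterS fg => x /= fg _; rewrite fg.
Qed.

Lemma ae_L2f f g : measurable_fun setT g -> f = g %[ae mu] -> L2f f -> L2f g.
Proof.
move=> mg fg [mf f2]; split=> //.
apply: (@ae_intg (fun x => f x ^+ 2)) => //; first exact: measurable_funX.
by apply: filterS fg => x /= fg /fg ->.
Qed.

Lemma ae_sq f g : measurable_fun setT f -> measurable_fun setT g ->
  f = g %[ae mu] -> sq f = sq g.
Proof.
move=> mf mg fg; apply: ae_integ; [exact: measurable_funX..|].
by apply: filterS fg => x /= fg /fg ->.
Qed.

Lemma sq_ge0 f : 0 <= sq f.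
Proof. by apply: integ_ge0 => x; exact: sqr_ge0. Qed.

Lemma integ_eq0 f : intg f -> (forall x, 0 <= f x) -> integ f = 0 ->
  f = (fun=> 0) %[ae mu].
Proof.
move=> hf f0 f00; have mf := intg_meas hf.
have : (\int[mu]_x `|(f x)%:E| = 0)%E.
  rewrite (eq_integral (EFin \o f)); first by rewrite -(integE hf) f00.
  by move=> x _ /=; rewrite ger0_norm.
have me : measurable_fun setT (EFin \o f) by exact/measurable_EFinP.
by move=> /(ae_eq_integral_abs mu measurableT me); apply: filterS => x /= e _;
  have := e I; case.
Qed.

Lemma sq_eq0 f : L2f f -> sq f = 0 -> f = (fun=> 0) %[ae mu].
Proof.
move=> [mf f2] f0.
have := integ_eq0 f2 (fun x => sqr_ge0 _) f0.
apply: filterS => x /= h /h; move/eqP; rewrite expf_eq0/= => /eqP; exact.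
Qed.

Lemma L2fZ c f : L2f f -> L2f (fun x => c * f x).
Proof.
move=> [mf f2]; split; first exact: measurable_funM.
by have := intgZ (c ^+ 2) f2; apply: eq_intg => x; rewrite exprMn.
Qed.

Lemma intg_mul f g : L2f f -> L2f g -> intg (fun x => f x * g x).
Proof.
move=> [mf f2] [mg g2]; apply: (@intg_le _ (fun x => f x ^+ 2 + g x ^+ 2)).
- exact: measurable_funM.
- move=> x; rewrite normrM -(real_normK (num_real (f x))) -(real_normK (num_real (g x))).
  have := sqr_ge0 (`|f x| - `|g x|).
  have := normr_ge0 (f x); have := normr_ge0 (g x); nra.
- exact: intgD.
Qed.

Lemma L2fD f g : L2f f -> L2f g -> L2f (fun x => f x + g x).
Proof.
move=> hf hg; split; first by apply: measurable_funD; [case: hf|case: hg].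
have := intgD (intgD (proj2 hf) (proj2 hg)) (intgZ 2 (intg_mul hf hg)).
by apply: eq_intg => x; ring.
Qed.

Lemma L2fN f : L2f f -> L2f (fun x => - f x).
Proof. by move=> /(L2fZ (-1)); apply: eq_L2f => x; rewrite mulN1r. Qed.

Lemma L2fB f g : L2f f -> L2f g -> L2f (fun x => f x - g x).
Proof. by move=> hf /L2fN; apply: L2fD. Qed.

Lemma L2f_le f g : measurable_fun setT f -> (forall x, `|f x| <= `|g x|) ->
  L2f g -> L2f f.
Proof.
move=> mf fg [mg g2]; split=> //; apply: (@intg_le _ (fun x => g x ^+ 2)) => //.
  exact: measurable_funX.
move=> x; rewrite normrX -(real_normK (num_real (g x))).
by rewrite lerXn2r ?nnegrE.
Qed.

Lemma L2f_mulb f g c : measurable_fun setT f -> (forall x, `|f x| <= c) -> L2f g ->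
  L2f (fun x => f x * g x).
Proof.
move=> mf fc hg; apply: (@L2f_le _ (fun x => c * g x)); last exact: L2fZ.
  by apply: measurable_funM => //; case: hg.
move=> x; rewrite !normrM ler_wpM2r//.
by rewrite (le_trans (fc x))// ler_norm.
Qed.

Lemma intg_mulb f g c : measurable_fun setT f -> (forall x, `|f x| <= c) -> intg g ->
  intg (fun x => f x * g x).
Proof.
move=> mf fc hg; apply: (@intg_le _ (fun x => c * `|g x|)).
- by apply: measurable_funM => //; exact: intg_meas.
- by move=> x; rewrite normrM ler_wpM2r.
- by apply: intgZ; exact: intg_norm.
Qed.

Lemma L2f_bounded f c : (forall x, `|f x| <= c) -> intg f -> L2f f.
Proof.
move=> fc hf; have mf := intg_meas hf; split=> //.
by have := intg_mulb mf fc hf; apply: eq_intg => x.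
Qed.

Lemma L2f0 : L2f (fun=> 0).
Proof.
split; first exact: measurable_cst.
by have := integrable0 mu setT; apply: eq_integrable => // x _ /=; rewrite expr0n.
Qed.

Lemma sqZ c f : L2f f -> sq (fun x => c * f x) = c ^+ 2 * sq f.
Proof.
by move=> [_ f2]; rewrite /sq -integZ//; apply: eq_integ => x; rewrite exprMn.
Qed.

Lemma sqD f g : L2f f -> L2f g ->
  sq (fun x => f x + g x) = sq f + sq g + 2 * integ (fun x => f x * g x).
Proof.
move=> hf hg; have fg := intg_mul hf hg; case: hf => mf f2; case: hg => mg g2.
rewrite /sq -integZ// -!integD//; [|exact: intgD|exact: intgZ].
by apply: eq_integ => x; ring.
Qed.

Lemma sqB f g : L2f f -> L2f g ->
  sq (fun x => f x - g x) = sq f + sq g - 2 * integ (fun x => f x * g x).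
Proof.
move=> hf hg; have fg := intg_mul hf hg; case: hf => mf f2; case: hg => mg g2.
rewrite /sq -integZ// -integD// -integB//; [|exact: intgD|exact: intgZ].
by apply: eq_integ => x; ring.
Qed.

Lemma sqBC f g : sq (fun x => f x - g x) = sq (fun x => g x - f x).
Proof. by apply: eq_integ => x; rewrite -sqrrN opprB. Qed.

Lemma sq_sub_eq0 f g : L2f f -> L2f g -> sq (fun x => f x - g x) = 0 -> f = g %[ae mu].
Proof.
move=> hf hg /(sq_eq0 (L2fB hf hg)); apply: filterS => x /= h xT.
by apply/eqP; rewrite -subr_eq0 h.
Qed.

Lemma sq_triangle f g h : L2f f -> L2f g -> L2f h ->
  sq (fun x => f x - h x) <= 2 * sq (fun x => f x - g x) + 2 * sq (fun x => g x - h x).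
Proof.
move=> hf hg hh; have hfg := L2fB hf hg; have hgh := L2fB hg hh.
have [_ i1] := hfg; have [_ i2] := hgh; have [_ i3] := L2fB hf hh.
have j1 := intgZ 2 i1; have j2 := intgZ 2 i2.
rewrite /sq -(integZ 2 i1) -(integZ 2 i2) -integD//.
apply: le_integ => //; first exact: intgD.
by move=> x; have := sqr_ge0 ((f x - g x) - (g x - h x)); nra.
Qed.

(** The quadratic polynomial t -> [sq] (f + t g) is nonnegative; its value at the minimiser gives
    the inequality. *)
Lemma cauchy_schwarz f g : L2f f -> L2f g ->
  integ (fun x => f x * g x) ^+ 2 <= sq f * sq g.
Proof.
move=> hf hg; set b := integ _.
have key t : 0 <= sq f + t ^+ 2 * sq g + 2 * t * b.
  have := sq_ge0 (fun x => f x + t * g x).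
  rewrite sqD//; last exact: L2fZ.
  have -> : integ (fun x => f x * (t * g x)) = t * b.
    by rewrite -integZ; [apply: eq_integ => x; ring|exact: intg_mul].
  by rewrite sqZ// mulrA.
have := sq_ge0 g; rewrite le_eqVlt => /orP[/eqP g0|g0].
  rewrite -g0 mulr0 in key *.
  have [->|b0] := eqVneq b 0; first by rewrite expr0n.
  (* With [sq g] zero the polynomial is affine in t; were [b] nonzero, its value at this point would
     be -1. *)
  have := key (- (sq f + 1) / (2 * b)).
  have e : 2 * (- (sq f + 1) / (2 * b)) * b = - (sq f + 1) by field.
  by rewrite e ?mulr0; lra.
(* The minimiser of the quadratic polynomial in [key]. *)
have := key (- b / sq g); have g0' : sq g != 0 by rewrite gt_eqF.
have -> : sq f + (- b / sq g) ^+ 2 * sq g + 2 * (- b / sq g) * b =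
  (sq f * sq g - b ^+ 2) / sq g by field.
by rewrite pmulr_lge0 ?invr_gt0// subr_ge0.
Qed.

End L2_toolkit.

(** * Dominated convergence, Fatou's lemma and completeness of L2 *)

Section L2_convergence.
Context d (T : measurableType d) (R : realType) (mu : {measure set T -> \bar R}).
Implicit Types (f g h : T -> R) (fn : nat -> T -> R) (c : R).

Lemma dct fn f g : (forall n, measurable_fun setT (fn n)) ->
  (forall n x, `|fn n x| <= g x) -> intg mu g ->
  (forall x, fn n x @[n --> \oo] --> f x) ->
  intg mu f /\ integ mu (fn n) @[n --> \oo] --> integ mu f.
Proof.
move=> mfn fng hg fnf.
have mf : measurable_fun setT f by exact: (measurable_fun_cvg mfn).
have ifn n : intg mu (fn n) by exact: intg_le (mfn n) (fng n) hg.
have [] := @dominated_convergence _ _ _ mu setT measurableT (fun n x => (fn n x)%:E)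
  (EFin \o f) (EFin \o g).
- by move=> n; exact/measurable_EFinP.
- exact/measurable_EFinP.
- by apply: aeW => x _; apply: cvg_EFin; [exact: nearW|exact: fnf].
- exact: hg.
- by apply: aeW => x n _ /=; rewrite lee_fin.
move=> hf _; split => //.
have -> : (fun n => integ mu (fn n)) = (fun n => fine (\int[mu]_x (fn n x)%:E)%E).
  by apply/funext => n; rewrite -RintegralE.
by apply: fine_cvg; rewrite (integE hf).
Qed.

Definition cvg2 fn f := sq mu (fun x => fn n x - f x) @[n --> \oo] --> (0 : R).

(** Fatou's lemma asks for no majorant, so the uniform bound alone puts the pointwise limit in L2.
    It serves both for completeness and for Hartley transforms, as limits of damped ones. *)
Lemma fatou_sq fn f c : (forall n, L2f mu (fn n)) -> (forall n, sq mu (fn n) <= c) ->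
  (forall x, fn n x @[n --> \oo] --> f x) -> L2f mu f /\ sq mu f <= c.
Proof.
move=> hfn fnc fnf.
have mf : measurable_fun setT f by apply: (measurable_fun_cvg _ (fun x _ => fnf x)) => n; case: (hfn n).
have le : (\int[mu]_x (f x ^+ 2)%:E <= c%:E)%E.
  have := @fatou _ _ _ mu setT measurableT (fun n x => (fn n x ^+ 2)%:E).
  have -> : (\int[mu]_x limn_einf (fun n => (fn n x ^+ 2)%:E) = \int[mu]_x (f x ^+ 2)%:E)%E.
    apply: eq_integral => x _.
    have h : (fn n x ^+ 2)%:E @[n --> \oo] --> (f x ^+ 2)%:E.
      apply: cvg_EFin; first exact: nearW.
      by apply: cvgM; exact: fnf.
    by rewrite is_cvg_limn_einfE; [exact/cvg_lim|exact: (cvgP _ h)].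
  move=> H; apply: (le_trans (H _ _)) => [n|n x _|].
  - by apply/measurable_EFinP; apply: measurable_funX; case: (hfn n).
  - by rewrite lee_fin sqr_ge0.
  rewrite limn_einf_lim; apply: lime_le; first exact: is_cvg_einfs.
  apply: nearW => n; apply: ereal_inf_le.
  exists (\int[mu]_x (fn n x ^+ 2)%:E)%E.
    by exists n => //=.
  by rewrite -integE ?lee_fin; [exact: fnc|case: (hfn n)].
have hf : L2f mu f.
  split=> //; apply/ge0_intgP; [exact: measurable_funX|by move=> x; exact: sqr_ge0|].
  exact: le_lt_trans le (ltry _).
by split=> //; rewrite -lee_fin integE//; case: hf.
Qed.

Lemma cvg2_integ fn f g : (forall n, L2f mu (fn n)) -> L2f mu f -> L2f mu g ->
  cvg2 fn f -> integ mu (fun x => fn n x * g x) @[n --> \oo] --> integ mu (fun x => f x * g x).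
Proof.
move=> hfn hf hg fnf.
apply/cvgrPdist_le => e e0.
have : \forall n \near \oo, sq mu (fun x => fn n x - f x) * sq mu g <= e ^+ 2.
  have : sq mu (fun x => fn n x - f x) * sq mu g @[n --> \oo] --> 0 * sq mu g.
    by apply: cvgM => //; exact: cvg_cst.
  rewrite mul0r => /cvgrPdist_le /(_ (e ^+ 2)); rewrite exprn_gt0// => /(_ isT).
  apply: filterS => n; rewrite sub0r normrN; apply: le_trans; exact: ler_norm.
apply: filterS => n h.
rewrite -integB; [|exact: intg_mul..].
rewrite -(@ler_pXn2r _ 2) ?nnegrE ?(ltW e0)// real_normK ?num_real//.
apply: le_trans h; have := cauchy_schwarz (L2fB (hfn n) hf) hg.
rewrite -sqrrN -integN; last by apply: intg_mul => //; exact: L2fB.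
by under eq_integ do rewrite -mulNr opprB mulrBl.
Qed.

Lemma cvg2_sq fn f : (forall n, L2f mu (fn n)) -> L2f mu f -> cvg2 fn f ->
  sq mu (fn n) @[n --> \oo] --> sq mu f.
Proof.
move=> hfn hf fnf; have h := cvg2_integ hfn hf hf fnf.
have -> : (fun n => sq mu (fn n)) =
    (fun n => sq mu (fun x => fn n x - f x) + 2 * integ mu (fun x => fn n x * f x) - sq mu f).
  by apply/funext => n; rewrite sqB//; ring.
rewrite [X in _ --> X](_ : sq mu f = 0 + 2 * integ mu (fun x => f x * f x) - sq mu f).
  exact: cvgB (cvgD fnf (cvgM (cvg_cst (2:R)) h)) (cvg_cst (sq mu f)).
by rewrite add0r (_ : integ mu _ = sq mu f); [ring|by apply: eq_integ => x].
Qed.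

Lemma cvg2_unique fn f g : (forall n, L2f mu (fn n)) -> L2f mu f -> L2f mu g ->
  cvg2 fn f -> cvg2 fn g -> f = g %[ae mu].
Proof.
move=> hfn hf hg fnf fng; apply: sq_sub_eq0 => //.
have le n : sq mu (fun x => f x - g x) <=
    2 * sq mu (fun x => fn n x - f x) + 2 * sq mu (fun x => fn n x - g x).
  by have := sq_triangle hf (hfn n) hg; rewrite [X in _ <= 2 * X + _]sqBC.
apply/eqP; rewrite eq_le sq_ge0 andbT.
have : 2 * sq mu (fun x => fn n x - f x) + 2 * sq mu (fun x => fn n x - g x) @[n --> \oo]
    --> 2 * (0:R) + 2 * (0:R).
  exact: cvgD (cvgM (cvg_cst (2:R)) fnf) (cvgM (cvg_cst (2:R)) fng).
rewrite mulr0 addr0 => h; rewrite -(cvg_lim _ h)//.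
by apply: limr_ge; [exact: (cvgP _ h)|exact: nearW].
Qed.

Lemma cvg2_dom fn f g : (forall n, measurable_fun setT (fn n)) ->
  (forall n x, `|fn n x| <= g x) -> L2f mu g ->
  (forall x, fn n x @[n --> \oo] --> f x) ->
  [/\ forall n, L2f mu (fn n), L2f mu f & cvg2 fn f].
Proof.
move=> mfn fng hg fnf.
have mf : measurable_fun setT f by exact: (measurable_fun_cvg mfn).
have fg x : `|f x| <= g x.
  have h : `|fn n x| @[n --> \oo] --> `|f x| by apply: cvg_norm; exact: fnf.
  rewrite -(cvg_lim _ h)//; apply: limr_le; last exact: nearW.
  exact: (cvgP _ h).
have hf : L2f mu f by apply: L2f_le hg => // x; exact: le_trans (fg x) (ler_norm _).
have hfn n : L2f mu (fn n) by apply: L2f_le hg => // x; exact: le_trans (fng n x) (ler_norm _).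
split=> //; rewrite /cvg2 -[X in _ --> X](integ0 mu).
have [] := @dct (fun n x => (fn n x - f x) ^+ 2) (fun=> 0) (fun x => 4 * g x ^+ 2) => //.
- by move=> n; apply: measurable_funX; exact: measurable_funB.
- move=> n x; rewrite normrX.
  have h : `|fn n x - f x| <= 2 * g x.
    by apply: le_trans (ler_normB _ _) _; have := fng n x; have := fg x; lra.
  have g0 : 0 <= g x by exact: le_trans (fg x).
  rewrite (_ : 4 * g x ^+ 2 = (2 * g x) ^+ 2); last by ring.
  by rewrite lerXn2r ?nnegrE ?mulr_ge0.
- by apply: intgZ; case: hg.
move=> x; rewrite -[X in _ --> X](mulr0 (0:R)) (_ : 0 = f x - f x) ?subrr//.
by apply: cvgM; rewrite -[X in _ --> X](subrr (f x)); (apply: cvgB; [exact: fnf|exact: cvg_cst]).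
Qed.

Lemma sum_half_le n : \sum_(0 <= k < n) (2^-1 : R) ^+ k <= 2.
Proof.
suff -> : \sum_(0 <= k < n) (2^-1 : R) ^+ k = 2 - 2 * 2^-1 ^+ n.
  by rewrite lerBlDr lerDl mulr_ge0// exprn_ge0// invr_ge0.
elim: n => [|n IH]; first by rewrite big_nil expr0; ring.
by rewrite big_nat_recr//= IH exprS; move: (2^-1 ^+ n) => a; field.
Qed.

(** The series of 4^k |f_(k+1) - f_k|^2 has integral at most the sum of 4^k 8^-k = 2^-k, hence is
    finite almost everywhere. Where its sum is C, the increments are at most sqrt C 2^-k, which is
    summable. *)
Lemma L2_fast_cvg fn : (forall n, L2f mu (fn n)) ->
  (forall k, sq mu (fun x => fn k.+1 x - fn k x) <= 8^-1 ^+ k) ->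
  exists2 A : set T, measurable A & (forall x, ~ A x -> cvgn (fun n => fn n x)) /\ mu A = 0%E.
Proof.
move=> hfn fast.
pose e k x := (4 ^+ k * (fn k.+1 x - fn k x) ^+ 2)%:E : \bar R.
have e0 k x : (0 <= e k x)%E by rewrite lee_fin mulr_ge0 ?sqr_ge0// exprn_ge0.
have hd k : L2f mu (fun x => fn k.+1 x - fn k x) by exact: L2fB.
have me k : measurable_fun setT (e k).
  apply/measurable_EFinP; apply: measurable_funM => //.
  by apply: measurable_funX; case: (hd k).
pose S x := (\sum_(0 <= k <oo) e k x)%E.
have mS : measurable_fun setT S.
  by apply: (@ge0_emeasurable_sum _ _ _ setT e xpredT).
have S0 x : (0 <= S x)%E by exact: nneseries_ge0.
have Slt : (\int[mu]_x S x < +oo)%E.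
  rewrite integral_nneseries//.
  apply: (@le_lt_trans _ _ 2%:E); last exact: ltry.
  apply: lime_le; first by apply: is_cvg_nneseries => n _ _; exact: integral_ge0.
  apply: nearW => n.
  apply: (@le_trans _ _ (\sum_(0 <= k < n) (2^-1 ^+ k)%:E)%E).
    apply: lee_sum => k _.
    rewrite -(integE (intgZ (4 ^+ k) (proj2 (hd k)))) lee_fin integZ; last by case: (hd k).
    rewrite (_ : 2^-1 = 4 * 8^-1 :> R); last by field.
    rewrite exprMn ler_wpM2l ?exprn_ge0//; exact: fast.
  by rewrite sumEFin lee_fin sum_half_le.
have iS : mu.-integrable setT S.
  apply/integrableP; split=> //.
  by rewrite (eq_integral S)// => x _; rewrite gee0_abs.
have := integrable_ae measurableT iS => -[A [mA A0 hA]].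
exists A => //; split=> // x nAx.
have Sfin : S x \is a fin_num by apply: contrapT => h; apply: nAx; apply: hA => /(_ I).
pose C := fine (S x).
have C0 : 0 <= C by rewrite fine_ge0.
have le k : (fn k.+1 x - fn k x) ^+ 2 <= C * 4^-1 ^+ k.
  have : (e k x <= S x)%E.
    apply: le_trans (nneseries_lim_ge k.+1 _) => //.
    by rewrite big_nat_recr//= leeDr// sume_ge0.
  rewrite -(fineK Sfin) lee_fin exprVn => h.
  by rewrite ler_pdivlMr ?exprn_gt0// mulrC.
(* [C + 1] stands in for the square root of [C], since C <= (C + 1)^2. *)
have le' k : `|fn k.+1 x - fn k x| <= geometric (C + 1) 2^-1 k.
  rewrite /= -(@ler_pXn2r _ 2) ?nnegrE ?mulr_ge0 ?exprn_ge0 ?invr_ge0 ?addr_ge0//.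
  rewrite real_normK ?num_real// (le_trans (le k))// exprMn -exprM mulnC exprM.
  rewrite (_ : 2^-1 ^+ 2 = 4^-1 :> R); last by field.
  by rewrite ler_wpM2r ?exprn_ge0 ?invr_ge0//; nra.
have cd : cvgn (series (telescope (fun n => fn n x))).
  apply: normed_cvg; apply: series_le_cvg le' _ => [n|n|].
  - exact: normr_ge0.
  - by rewrite /= mulr_ge0 ?exprn_ge0 ?invr_ge0 ?addr_ge0.
  by apply: is_cvg_geometric_series; rewrite ger0_norm ?invr_ge0// invf_lt1// ltr1n.
rewrite (_ : (fun n => fn n x) = (fun n => fn 0%N x + series (telescope (fun n => fn n x)) n)).
  by apply: is_cvgD => //; exact: is_cvg_cst.
by apply/funext => n; rewrite -(eq_sum_telescope (fun n => fn n x)).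
Qed.

(** The Riesz-Fischer argument. A fast subsequence converges off a null set [A]; multiplying it by
    the indicator of the complement makes it converge everywhere, the form in which [fatou_sq]
    applies, at the cost of equalities almost everywhere. *)
Lemma L2_complete fn : (forall n, L2f mu (fn n)) ->
  (forall e, 0 < e -> exists N, forall m n, (N <= m)%N -> (N <= n)%N ->
    sq mu (fun x => fn m x - fn n x) <= e) ->
  exists2 f, L2f mu f & cvg2 fn f.
Proof.
move=> hfn cau.
have /choice[N hN] : forall k, exists N, forall m n, (N <= m)%N -> (N <= n)%N ->
    sq mu (fun x => fn m x - fn n x) <= 8^-1 ^+ k.
  by move=> k; apply: cau; rewrite exprn_gt0// invr_gt0.
pose nk k := (\max_(i < k.+1) maxn (N i) i)%N.
have nkN i k : (i <= k)%N -> (maxn (N i) i <= nk k)%N.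
  by move=> ik; apply: (@leq_bigmax_cond _ xpredT _ (Ordinal (_ : i < k.+1)%N)).
have [A mA [Acv A0]] : exists2 A : set T, measurable A &
    (forall x, ~ A x -> cvgn (fun k => fn (nk k) x)) /\ mu A = 0%E.
  apply: L2_fast_cvg => // k; apply: hN; apply: leq_trans (leq_maxl _ k) _; exact: nkN.
pose gk k x := fn (nk k) x * \1_(~` A) x.
have mI : measurable_fun setT (\1_(~` A) : T -> R).
  by apply: measurable_indic; exact: measurableC.
have aeA (F : T -> R) : (fun x => F x * \1_(~` A) x) = F %[ae mu].
  exists A; split=> // x /= h; apply: contrapT => nAx; apply: h => _.
  by rewrite indicE mem_set ?mulr1.
have hgk k : L2f mu (gk k).
  apply: (@ae_L2f _ _ _ _ (fn (nk k))) => //.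
    by apply: measurable_funM => //; case: (hfn (nk k)).
  by have := aeA (fn (nk k)); apply: filterS => x h /h; exact: esym.
pose f x := limn (fun k => gk k x).
have gf x : gk k x @[k --> \oo] --> f x.
  have [Ax|nAx] := pselect (A x).
    have -> : (fun k => gk k x) = (fun=> 0).
      by apply/funext => k; rewrite /gk indicE memNset ?mulr0//= => /(_ Ax).
    by rewrite /f (_ : (fun k => gk k x) = fun=> 0); [rewrite lim_cst//; exact: cvg_cst|
      apply/funext => k; rewrite /gk indicE memNset ?mulr0//= => /(_ Ax)].
  have e : (fun k => gk k x) = (fun k => fn (nk k) x).
    by apply/funext => k; rewrite /gk indicE mem_set ?mulr1.
  by rewrite /f e; exact: Acv.
(* Fatou's lemma in [k] along the subsequence, with [n] fixed; the shift by [i] keeps all its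
   indices beyond [N i]. *)
have key i n : (N i <= n)%N ->
    L2f mu (fun x => fn n x - f x) /\ sq mu (fun x => fn n x - f x) <= 8^-1 ^+ i.
  move=> Nn; apply: (@fatou_sq (fun k x => fn n x - gk (k + i)%N x)) => [k|k|x].
  - exact: L2fB.
  - rewrite (@ae_sq _ _ _ _ _ (fun x => fn n x - fn (nk (k + i)%N) x)).
    + by apply: hN => //; apply: leq_trans (leq_maxl _ i) _; apply: nkN; rewrite leq_addl.
    + by case: (L2fB (hfn n) (hgk (k + i)%N)).
    + by case: (L2fB (hfn n) (hfn (nk (k + i)%N))).
    + by have := aeA (fn (nk (k + i)%N)); apply: filterS => x h /h; rewrite /gk => ->.
  - apply: cvgB; first exact: cvg_cst.
    have := gf x; rewrite -(@cvg_shiftn i _ (fun k => gk k x)); exact.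
have hf : L2f mu f.
  have [h _] := key 0%N (N 0%N) (leqnn _).
  by have := L2fB (hfn (N 0%N)) h; apply: eq_L2f => x; ring.
exists f => //; apply/cvgrPdist_le => e e0.
have : (8^-1 : R) ^+ i @[i --> \oo] --> (0:R).
  by apply: cvg_expr; rewrite ger0_norm ?invr_ge0// invf_lt1// ltr1n.
move=> /cvgrPdist_le/(_ _ e0) [i _ hi].
exists (N i) => // n /= Nn; rewrite sub0r normrN ger0_norm ?sq_ge0//.
apply: le_trans (proj2 (key i n Nn)) _.
have := hi i (leqnn _); rewrite sub0r normrN; apply: le_trans; exact: ler_norm.
Qed.

End L2_convergence.

(** * Affine changes of variables on the line and on the plane *)

Section affine_substitution.
Context (R : realType).
Notation leb := (@lebesgue_measure R).
Notation mu2 := (@lebesgue2 R).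

Lemma measurable_affine (c b : R) : measurable_fun setT (fun x : R => c * x + b).
Proof. by apply: measurable_funD => //; exact: measurable_funM. Qed.

Lemma affine_preimage_oc (c b u v : R) : 0 < c ->
  (fun x : R => c * x + b) @^-1` `]u, v]%classic = `]((u - b) / c), ((v - b) / c)]%classic.
Proof.
move=> c0; apply/seteqP; split=> x /=; rewrite !in_itv/= ltr_pdivrMr// ler_pdivlMr//;
  by rewrite ltrBlDr lerBrDr [x * c]mulrC.
Qed.

Lemma affine_preimage_oc_neg (c b u v : R) : c < 0 ->
  (fun x : R => c * x + b) @^-1` `]u, v]%classic = `[((v - b) / c), ((u - b) / c)[%classic.
Proof.
move=> c0; apply/seteqP; split=> x /=; rewrite !in_itv/= ltr_ndivlMr// ler_ndivrMr//;
  by rewrite ltrBlDr lerBrDr [x * c]mulrC andbC.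
Qed.

(** As a function of [A] the right-hand side is a scaled push-forward measure, so by uniqueness of
    Lebesgue measure it suffices to compare lengths of half-open intervals. A negative [c] moves the
    closed end to the other side, without effect on the length. *)
Lemma lebesgue_affine (c b : R) (A : set (measurableTypeR R)) : c != 0 -> measurable A ->
  leb A = (`|c|%:E * leb ((fun x : R => (c * x + b)%R) @^-1` A))%E.
Proof.
move=> c0 mA.
have cp : 0 < `|c| by rewrite normr_gt0.
pose phi : measurableTypeR R -> measurableTypeR R := fun x : R => (c * x + b)%R : R.
have mphi : measurable_fun setT phi by exact: measurable_affine.
pose nc : {nonneg R} := NngNum (normr_ge0 c).
pose push : {measure set (measurableTypeR R) -> \bar R} :=
  measure_function_pushforward__canonical__measure_function_Measure leb mphi.
suff : leb A = mscale nc push A by [].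
apply: lebesgue_measure_unique => // _ [[u v]] _ <-.
change (leb `]u, v]%classic = (`|c|%:E * leb (phi @^-1` `]u, v]%classic))%E).
have [c_gt0|c_le0] := ltP 0 c.
  rewrite (_ : phi @^-1` _ = `]((u - b) / c), ((v - b) / c)]%classic); last exact: affine_preimage_oc.
  rewrite !lebesgue_measure_itv/= !lte_fin ltr_pM2r ?invr_gt0// ltrD2r.
  case: ifPn => _; last by rewrite mule0.
  by rewrite -!EFinB -EFinM gtr0_norm//; congr EFin; field.
have c_lt0 : c < 0 by rewrite lt_neqAle c0.
rewrite (_ : phi @^-1` _ = `[((v - b) / c), ((u - b) / c)[%classic); last exact: affine_preimage_oc_neg.
rewrite !lebesgue_measure_itv/= !lte_fin ltr_nM2r ?invr_lt0// ltrD2r.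
case: ifPn => _; last by rewrite mule0.
by rewrite -!EFinB -EFinM ltr0_norm//; congr EFin; field.
Qed.

Lemma ge0_integral_affine (f : R -> \bar R) (c b : R) : c != 0 ->
  measurable_fun setT f -> (forall x, 0 <= f x)%E ->
  (\int[leb]_x f (c * x + b)%R = `|c|^-1%:E * \int[leb]_x f x)%E.
Proof.
move=> c0 mf f0.
pose phi : measurableTypeR R -> measurableTypeR R := fun x : R => (c * x + b)%R : R.
have mphi : measurable_fun setT phi by exact: measurable_affine.
pose nc : {nonneg R} := NngNum (normr_ge0 c).
pose push : {measure set (measurableTypeR R) -> \bar R} :=
  measure_function_pushforward__canonical__measure_function_Measure leb mphi.
have -> : (\int[leb]_x f x = \int[mscale nc push]_x f x)%E.
  apply: (@eq_measure_integral _ _ _ _ (mscale nc push)) => A mA _.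
  exact: lebesgue_affine.
rewrite ge0_integral_mscale// muleA -EFinM mulVf ?normr_eq0// mul1e.
by rewrite ge0_integral_pushforward.
Qed.

Definition aff (c : R) (b x : R * R) : R * R := (c * x.1 + b.1, c * x.2 + b.2).

Lemma measurable_aff c b : measurable_fun setT (aff c b).
Proof.
by apply: measurable_fun_pair; apply: measurable_funD => //; apply: measurable_funM.
Qed.

Lemma ge0_integral_aff (f : R * R -> \bar R) c b : c != 0 ->
  measurable_fun setT f -> (forall x, 0 <= f x)%E ->
  (\int[mu2]_x f (aff c b x) = (c ^- 2)%:E * \int[mu2]_x f x)%E.
Proof.
move=> c0 mf f0.
have mfa : measurable_fun setT (fun x => f (aff c b x)).
  by apply: measurableT_comp => //; exact: measurable_aff.
rewrite /lebesgue2 fubini_tonelli1// [in RHS]fubini_tonelli1// /fubini_F /aff/=.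
have mx x : measurable_fun setT (fun y => f (x, y)).
  by apply: measurableT_comp => //; exact: measurable_pair1.
pose F x := (\int[leb]_y f (x, y))%E.
have mF : measurable_fun setT F by exact: measurable_fun_fubini_tonelli_F.
have F0 x : (0 <= F x)%E by exact: integral_ge0.
under eq_integral => x _ do rewrite (ge0_integral_affine b.2 c0 (mx _))//.
rewrite ge0_integralZl//; last first.
- by move=> x _; exact: integral_ge0.
- by apply: (measurableT_comp mF); exact: measurable_affine.
rewrite (ge0_integral_affine b.1 c0 mF F0) muleA -EFinM -invfM.
by rewrite -expr2 real_normK ?num_real.
Qed.

Lemma integ_aff (f : R * R -> R) c b : c != 0 -> intg mu2 f ->
  intg mu2 (fun x => f (aff c b x)) /\
  integ mu2 (fun x => f (aff c b x)) = c ^- 2 * integ mu2 f.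
Proof.
move=> c0 hf.
have key g : (forall x, 0 <= g x) -> intg mu2 g ->
    intg mu2 (fun x => g (aff c b x)) /\
    integ mu2 (fun x => g (aff c b x)) = c ^- 2 * integ mu2 g.
  move=> g0 hg; have mg := intg_meas hg.
  have mEg : measurable_fun setT (EFin \o g) by exact/measurable_EFinP.
  have e : (\int[mu2]_x (g (aff c b x))%:E = (c ^- 2)%:E * \int[mu2]_x (g x)%:E)%E.
    by apply: (ge0_integral_aff b c0 mEg) => x; rewrite lee_fin.
  have iga : intg mu2 (fun x => g (aff c b x)).
    apply/ge0_intgP => //; first by apply: measurableT_comp => //; exact: measurable_aff.
    by rewrite e -(integE hg) -EFinM ltry.
  by split=> //; apply: EFin_inj; rewrite integE// e EFinM integE.
have hn := intg_norm hf.
have [h1 e1] := key _ (fun x => normr_ge0 (f x)) hn.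
(* A signed f is the difference of the nonnegative functions |f| + f and |f|, to which [key]
   applies. *)
have fp0 x : 0 <= `|f x| + f x by have := ler_norm (- f x); rewrite normrN; lra.
have [h2 e2] := key _ fp0 (intgD hn hf).
have E x : f (aff c b x) = (`|f (aff c b x)| + f (aff c b x)) - `|f (aff c b x)| by ring.
split; first by have := intgB h2 h1; apply: eq_intg => x; ring.
transitivity (integ mu2 (fun x => (`|f (aff c b x)| + f (aff c b x)) - `|f (aff c b x)|)).
  exact: eq_integ.
by rewrite integB// e1 e2 integD//; ring.
Qed.

End affine_substitution.

(** * The cosine transform of exp(-|t|) and its total integral *)

Section exponential_kernel.
Context (R : realType).
Notation leb := (@lebesgue_measure R).

Lemma ge0_even_integral (f F : R -> R) (l : R) :
  (forall x, 0 <= f x) -> continuous f -> f =1 f \o -%R ->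
  (forall x, is_derive x (1:R) F (f x)) -> F x @[x --> +oo%R] --> l ->
  (\int[leb]_x (f x)%:E = (2 * (l - F 0))%:E)%E.
Proof.
move=> f0 cf fN dF Fl.
rewrite ge0_symfun_integralT// -set_itvcy EFinM; congr (_ * _)%E.
have cF : continuous F.
  move=> x; apply: differentiable_continuous; apply/derivable1_diffP.
  by have [] := dF x.
rewrite (@ge0_continuous_FTC2y _ _ F _ l)//.
- exact: continuous_subspaceT.
- by apply/cvg_at_right_filter; exact: cF.
- by move=> x _; rewrite derive1E; exact: derive_val.
Qed.

Definition kexp (t : R) : R := expR (- `|t|).

Lemma continuous_kexp : continuous kexp.
Proof.
move=> x; apply: (continuous_comp (f := fun x : R => - `|x|)); last exact: continuous_expR.
by apply: continuousN; exact: norm_continuous.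
Qed.

Lemma measurable_kexp : measurable_fun setT kexp.
Proof. exact: continuous_measurable_fun continuous_kexp. Qed.

Lemma kexp_gt0 t : 0 < kexp t. Proof. exact: expR_gt0. Qed.

Lemma kexp_le1 t : kexp t <= 1.
Proof. by rewrite /kexp -expR0 ler_expR oppr_le0. Qed.

Lemma continuous_cosM (a : R) : continuous (fun t : R => cos (a * t)).
Proof.
move=> x; apply: (continuous_comp (f := fun t : R => a * t)); last exact: continuous_cos.
by apply: continuousM; [exact: cst_continuous|exact: cvg_id].
Qed.

Lemma measurable_cosM (a : R) : measurable_fun setT (fun t : R => cos (a * t)).
Proof. exact: continuous_measurable_fun (@continuous_cosM a). Qed.

(** The summand 1 keeps the integrand nonnegative, as the fundamental theorem on a half-line used
    here requires; the cosine alone changes sign. Its contribution, the case a = 0, is subtracted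
    again in [integ_kexp_cos]. *)
Lemma halfline_kexp (a : R) :
  (\int[leb]_(t in `[0%R, +oo[) (kexp t * (1 + cos (a * t)))%:E = (1 + (1 + a ^+ 2)^-1)%:E)%E.
Proof.
(* [F] is the primitive of e^-t (1 + cos (a t)) that vanishes at infinity, so the integral is
   -F(0). *)
pose G (t : R) : R := - 1 + (1 + a ^+ 2)^-1 * (a * sin (a * t) - cos (a * t)).
pose F (t : R) : R := expR (- t) * G t.
have a1 : 0 < 1 + a ^+ 2 by rewrite ltr_pwDl// sqr_ge0.
have dat (x : R) : is_derive x (1:R) (fun t : R => a * t) a.
  have := @is_deriveZ _ _ _ _ a _ _ _ (@is_derive_id R R x 1).
  by rewrite /GRing.scale/= mulr1.
have dsin (x : R) : is_derive x (1:R) (fun t : R => sin (a * t)) (cos (a * x) * a).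
  exact: (@is_derive1_comp _ sin (fun t => a * t)).
have dcos (x : R) : is_derive x (1:R) (fun t : R => cos (a * t)) (- sin (a * x) * a).
  exact: (@is_derive1_comp _ cos (fun t => a * t)).
have dexp (x : R) : is_derive x (1:R) (fun t : R => expR (- t)) (expR (- x) * -1).
  have h := @is_deriveN _ _ _ _ _ _ _ (@is_derive_id R R x 1).
  exact: (@is_derive1_comp _ expR (fun t => - t)).
have dG (x : R) : is_derive x (1:R) G
    ((1 + a ^+ 2)^-1 * (a * (cos (a * x) * a) - - sin (a * x) * a)).
  have h := is_deriveD (is_derive_cst (-1 : R) x (1:R)) (is_deriveZ (1 + a ^+ 2)^-1
    (is_deriveD (is_deriveZ a (dsin x)) (is_deriveN (dcos x)))).
  by apply: (is_derive_eq (f := G) (f' := _) h); rewrite /GRing.scale/= add0r.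
have dF (x : R) : is_derive x (1:R) F (expR (- x) * (1 + cos (a * x))).
  have h := is_deriveM (dexp x) (dG x).
  apply: (is_derive_eq (f := F) (f' := _) h); rewrite /GRing.scale/= /G.
  by field; rewrite gt_eqF.
have cF : continuous F.
  move=> x; apply: differentiable_continuous; apply/derivable1_diffP.
  by have [] := dF x.
have Gb t : `|G t| <= 2 + `|a|.
  rewrite /G; apply: le_trans (ler_normD _ _) _; rewrite normrN1.
  have h : `|a * sin (a * t) - cos (a * t)| <= `|a| + 1.
    apply: le_trans (ler_normB _ _) _; rewrite normrM lerD//.
      by rewrite ler_piMr// ler_norml sin_geN1 sin_le1.
    by rewrite ler_norml cos_geN1 cos_le1.
  rewrite normrM ger0_norm ?invr_ge0 ?(ltW a1)//.
  have h2 : (1 + a ^+ 2)^-1 <= 1 by rewrite invf_le1// lerDl sqr_ge0.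
  have : (1 + a ^+ 2)^-1 * `|a * sin (a * t) - cos (a * t)| <= 1 * (`|a| + 1).
    by apply: ler_pM => //; rewrite invr_ge0 ltW.
  by rewrite mul1r => h3; lra.
have lF : F x @[x --> +oo%R] --> (0:R).
  apply: norm_cvg0; apply: (@squeeze_cvgr _ _ _ _ (fun=> 0) (fun x : R => expR (- x) * (2 + `|a|))).
  - by apply: nearW => x; rewrite normr_ge0/= normrM ger0_norm ?expR_ge0// ler_wpM2l ?expR_ge0.
  - exact: cvg_cst.
  - rewrite -[X in _ --> X](mul0r (2 + `|a|)).
    by apply: cvgM; [exact: cvgr_expR|exact: cvg_cst].
rewrite (@ge0_continuous_FTC2y _ _ F _ 0)//.
- rewrite -EFinB /F /G oppr0 expR0 mulr0 sin0 cos0; congr EFin; field.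
  by rewrite gt_eqF.
- by move=> x _; rewrite mulr_ge0 ?(ltW (kexp_gt0 _))//; have := cos_geN1 (a * x); lra.
- apply: continuous_subspaceT => x; apply: continuousM; first exact: continuous_kexp.
  by apply: continuousD; [exact: cst_continuous|exact: continuous_cosM].
- by apply/cvg_at_right_filter; exact: cF.
- move=> x; rewrite in_itv/= andbT => x0; rewrite derive1E (@derive_val _ _ _ _ _ _ _ (dF x)).
  by rewrite /kexp gtr0_norm.
Qed.

Lemma integral_kexp1 (a : R) :
  (\int[leb]_t (kexp t * (1 + cos (a * t)))%:E = (2 * (1 + (1 + a ^+ 2)^-1))%:E)%E.
Proof.
rewrite ge0_symfun_integralT//.
- by rewrite -set_itvcy halfline_kexp.
- by move=> x; rewrite mulr_ge0 ?(ltW (kexp_gt0 _))//; have := cos_geN1 (a * x); lra.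
- move=> x; apply: continuousM; first exact: continuous_kexp.
  by apply: continuousD; [exact: cst_continuous|exact: continuous_cosM].
- by move=> x /=; rewrite /kexp normrN mulrN cosN.
Qed.

Lemma intg_kexp : intg leb kexp.
Proof.
have : intg leb (fun t : R => kexp t * (1 + cos (0 * t))).
  apply/ge0_intgP.
  - apply: measurable_funM; first exact: measurable_kexp.
    by apply: measurable_funD => //; exact: measurable_cosM.
  - by move=> x; rewrite mulr_ge0 ?(ltW (kexp_gt0 _))//; have := cos_geN1 (0 * x); lra.
  by rewrite integral_kexp1 ltry.
move=> /(intgZ (2^-1)); apply: eq_intg => t /=.
by rewrite mul0r cos0; field.
Qed.

Lemma intg_kexp_cos (a : R) : intg leb (fun t => kexp t * cos (a * t)).
Proof.
have : intg leb (fun t => cos (a * t) * kexp t).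
  apply: (@intg_mulb _ _ _ _ _ _ 1) intg_kexp; first exact: measurable_cosM.
  by move=> t; rewrite ler_norml cos_geN1 cos_le1.
by apply: eq_intg => t; rewrite mulrC.
Qed.

(** The Fourier transform of [kexp], that is, the Poisson kernel of the half-plane (a Cauchy
    density) in the normalisation with 2 pi in the exponent; its integral is 1. *)
Definition pker (z : R) : R := 2 * (1 + (2 * pi * z) ^+ 2)^-1.

Lemma integ_kexp_cos (z : R) : integ leb (fun t => kexp t * cos (2 * pi * z * t)) = pker z.
Proof.
have key a : integ leb kexp + integ leb (fun t => kexp t * cos (a * t)) =
    2 * (1 + (1 + a ^+ 2)^-1).
  rewrite -integD; [|exact: intg_kexp|exact: intg_kexp_cos].
  apply: EFin_inj; rewrite -integral_kexp1 integE; last first.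
    by apply: intgD; [exact: intg_kexp|exact: intg_kexp_cos].
  by apply: eq_integral => t _; rewrite mulrDr mulr1.
have := key 0; rewrite (@eq_integ _ _ _ leb (fun t => kexp t * cos (0 * t)) kexp); last first.
  by move=> t; rewrite mul0r cos0 mulr1.
have := key (2 * pi * z); rewrite /pker expr0n addr0 invr1.
by move=> h1 h2; lra.
Qed.

Lemma pker_ge0 z : 0 <= pker z.
Proof. by rewrite mulr_ge0// invr_ge0 addr_ge0// sqr_ge0. Qed.

Lemma pkerN z : pker (- z) = pker z.
Proof. by rewrite /pker mulrN sqrrN. Qed.

Lemma continuous_pker : continuous pker.
Proof.
move=> x; apply: (@continuousM _ _ (fun=> 2 : R) (fun z : R => (1 + (2 * pi * z) ^+ 2)^-1) x).
  exact: cst_continuous.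
apply: (@continuousV _ _ (fun x : R => 1 + (2 * pi * x) ^+ 2)).
  by rewrite gt_eqF// ltr_pwDl// sqr_ge0.
apply: continuousD; first exact: cst_continuous.
apply: (@continuous_comp _ _ _ (fun x : R => 2 * pi * x) (fun y : R => y ^+ 2)); last exact: exprn_continuous.
by apply: continuousM; [exact: cst_continuous|exact: cvg_id].
Qed.

Lemma measurable_pker : measurable_fun setT pker.
Proof. exact: continuous_measurable_fun continuous_pker. Qed.

Lemma integral_pker : (\int[leb]_z (pker z)%:E = 1)%E.
Proof.
have pi0 : 0 < (pi : R) by exact: pi_gt0.
pose F (z : R) : R := pi^-1 * atan (2 * pi * z).
have dF (x : R) : is_derive x (1:R) F (pker x).
  have dat : is_derive x (1:R) (fun t : R => 2 * pi * t) (2 * pi).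
    have := @is_deriveZ _ _ _ _ (2 * pi) _ _ _ (@is_derive_id R R x 1).
    by rewrite /GRing.scale/= mulr1.
  have h := is_deriveZ pi^-1 (@is_derive1_comp _ atan _ _ _ _ (is_derive1_atan _) dat).
  apply: (is_derive_eq (f := F) (f' := _) h); rewrite /GRing.scale/= /pker.
  have : 0 < 1 + (2 * pi * x) ^+ 2 by rewrite ltr_pwDl// sqr_ge0.
  have e (p y : R) : 0 < p -> 0 < y -> p^-1 * (y^-1 * (2 * p)) = 2 * y^-1.
    by move=> p0 y0; field; rewrite !gt_eqF.
  exact: e.
have lF : F x @[x --> +oo%R] --> (2^-1 : R).
  rewrite (_ : 2^-1 = pi^-1 * (pi / 2)); last by rewrite mulKf// gt_eqF.
  apply: cvgM; first exact: cvg_cst.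
  apply: (@cvg_comp _ _ _ (fun z => 2 * pi * z) atan); last exact: cvgy_atan.
  by apply: gt0_cvgMry; [rewrite mulr_gt0|exact: cvg_id].
rewrite (ge0_even_integral pker_ge0 continuous_pker (fun x => esym (pkerN x)) dF lF).
by rewrite /F mulr0 atan0 mulr0 subr0 divff.
Qed.

Lemma intg_pker : intg leb pker.
Proof.
apply/ge0_intgP; [exact: measurable_pker|exact: pker_ge0|].
by rewrite integral_pker ltry.
Qed.

Lemma integ_pker : integ leb pker = 1.
Proof. by apply: EFin_inj; rewrite integE ?integral_pker//; exact: intg_pker. Qed.

End exponential_kernel.

(** * Fubini's theorem for a bounded kernel between integrable functions *)

Section fubini_kernel.
Context d1 d2 (T1 : measurableType d1) (T2 : measurableType d2) (R : realType).
Variables (m1 : {sigma_finite_measure set T1 -> \bar R})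
  (m2 : {sigma_finite_measure set T2 -> \bar R}).
Implicit Types (g : T1 -> R) (h : T2 -> R) (k : T1 * T2 -> R).

Lemma measurable_tensor g h : measurable_fun setT g -> measurable_fun setT h ->
  measurable_fun setT (fun z : T1 * T2 => g z.1 * h z.2).
Proof.
move=> mg mh; apply: measurable_funM.
  by apply: measurableT_comp => //; exact: measurable_fst.
by apply: measurableT_comp => //; exact: measurable_snd.
Qed.

Lemma intg_tensor g h : intg m1 g -> intg m2 h ->
  intg (m1 \x m2)%E (fun z => g z.1 * h z.2).
Proof.
move=> hg hh; have mg := intg_meas hg; have mh := intg_meas hh.
apply/integrable12ltyP; first by apply/measurable_EFinP; exact: measurable_tensor.
rewrite (_ : (\int[m1]_x _)%E = (integ m1 (fun x => `|g x| * integ m2 (fun y => `|h y|)))%:E).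
  exact: ltry.
have hhn := intg_norm hh; have hgn := intg_norm hg.
rewrite integE; last first.
  by have := intgZ (integ m2 (fun y => `|h y|)) hgn; apply: eq_intg => x; rewrite mulrC.
apply: eq_integral => x _; rewrite -integZ// integE; last exact: intgZ.
by apply: eq_integral => y _ /=; rewrite normrM.
Qed.

Lemma integ_tensor g h : intg m1 g -> intg m2 h ->
  integ (m1 \x m2)%E (fun z => g z.1 * h z.2) = integ m1 g * integ m2 h.
Proof.
move=> hg hh; apply: EFin_inj; rewrite integE; last exact: intg_tensor.
rewrite -(integral12_prod_meas1 (intg_tensor hg hh)) /fubini_F/=.
rewrite -integZr// integE; last first.
  by have := intgZ (integ m2 h) hg; apply: eq_intg => x; rewrite mulrC.
apply: eq_integral => x _; rewrite -integZ// integE//; exact: intgZ.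
Qed.

Lemma intg_kernel g h k (c : R) : intg m1 g -> intg m2 h -> measurable_fun setT k ->
  (forall z, `|k z| <= c) -> intg (m1 \x m2)%E (fun z => k z * (g z.1 * h z.2)).
Proof. by move=> hg hh mk kc; apply: (intg_mulb mk kc); exact: intg_tensor. Qed.

Lemma measurable_section1 k x : measurable_fun setT k -> measurable_fun setT (fun y => k (x, y)).
Proof. by move=> mk; apply: measurableT_comp => //; exact: measurable_pair1. Qed.

Lemma measurable_section2 k y : measurable_fun setT k -> measurable_fun setT (fun x => k (x, y)).
Proof. by move=> mk; apply: measurableT_comp => //; exact: measurable_pair2. Qed.

Lemma intg_section1 h k c x : intg m2 h -> measurable_fun setT k -> (forall z, `|k z| <= c) ->
  intg m2 (fun y => h y * k (x, y)).
Proof.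
move=> hh mk kc; have := intg_mulb (measurable_section1 x mk) (fun y => kc (x, y)) hh.
by apply: eq_intg => y; rewrite mulrC.
Qed.

Lemma intg_section2 g k c y : intg m1 g -> measurable_fun setT k -> (forall z, `|k z| <= c) ->
  intg m1 (fun x => g x * k (x, y)).
Proof.
move=> hh mk kc; have := intg_mulb (measurable_section2 y mk) (fun x => kc (x, y)) hh.
by apply: eq_intg => x; rewrite mulrC.
Qed.

Lemma fubini_section1 g h k c : intg m1 g -> intg m2 h -> measurable_fun setT k ->
  (forall z, `|k z| <= c) ->
  intg m1 (fun x => g x * integ m2 (fun y => h y * k (x, y))) /\
  integ m1 (fun x => g x * integ m2 (fun y => h y * k (x, y))) =
  integ (m1 \x m2)%E (fun z => k z * (g z.1 * h z.2)).
Proof.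
move=> hg hh mk kc; have hF := intg_kernel hg hh mk kc.
have e x : (g x * integ m2 (fun y => h y * k (x, y)))%:E =
    (\int[m2]_y (k (x, y) * (g x * h y))%:E)%E.
  have hs := intg_section1 x hh mk kc.
  rewrite -integZ// integE; last exact: intgZ.
  by apply: eq_integral => y _; congr EFin; ring.
have i1 : intg m1 (fun x => g x * integ m2 (fun y => h y * k (x, y))).
  have := integrable_fubini_F hF; apply: eq_integrable => // x _.
  by rewrite /fubini_F /= -e.
split=> //; apply: EFin_inj; rewrite !integE// -(integral12_prod_meas1 hF).
by apply: eq_integral => x _; rewrite e.
Qed.

(** Boundedness of [k] reduces integrability on the product space to that of the tensor product of
    [g] and [h]. The integrability of the partial integral is what later makes Hartley transforms
    measurable. *)
Lemma fubini_section2 g h k c : intg m1 g -> intg m2 h -> measurable_fun setT k ->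
  (forall z, `|k z| <= c) ->
  intg m2 (fun y => h y * integ m1 (fun x => g x * k (x, y))) /\
  integ m2 (fun y => h y * integ m1 (fun x => g x * k (x, y))) =
  integ (m1 \x m2)%E (fun z => k z * (g z.1 * h z.2)).
Proof.
move=> hg hh mk kc; have hF := intg_kernel hg hh mk kc.
have e y : (h y * integ m1 (fun x => g x * k (x, y)))%:E =
    (\int[m1]_x (k (x, y) * (g x * h y))%:E)%E.
  have hs := intg_section2 y hg mk kc.
  rewrite -integZ// integE; last exact: intgZ.
  by apply: eq_integral => x _; congr EFin; ring.
have i1 : intg m2 (fun y => h y * integ m1 (fun x => g x * k (x, y))).
  have mG : measurable_fun setT (fun y => h y * integ m1 (fun x => g x * k (x, y))).
    apply/measurable_EFinP; have := measurable_fubini_G hF.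
    by apply: eq_measurable_fun => y _; rewrite /fubini_G /= e.
  apply: (intg_le mG) (intgZ (c * integ m1 (fun x => `|g x|)) (intg_norm hh)) => y.
  rewrite normrM mulrC ler_wpM2r//.
  have hs := intg_section2 y hg mk kc.
  apply: le_trans (norm_integ_le hs) _; rewrite -integZ; last exact: intg_norm.
  apply: le_integ; [exact: intg_norm|by apply: intgZ; exact: intg_norm|].
  by move=> x; rewrite normrM mulrC ler_wpM2r.
split=> //; apply: EFin_inj; rewrite !integE// -(integral21_prod_meas1 hF).
by apply: eq_integral => y _; rewrite e.
Qed.

Lemma fubini_kernel g h k c : intg m1 g -> intg m2 h -> measurable_fun setT k ->
  (forall z, `|k z| <= c) ->
  integ m1 (fun x => g x * integ m2 (fun y => h y * k (x, y))) =
  integ m2 (fun y => h y * integ m1 (fun x => g x * k (x, y))).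
Proof.
move=> hg hh mk kc.
by rewrite (proj2 (fubini_section1 hg hh mk kc)) (proj2 (fubini_section2 hg hh mk kc)).
Qed.

End fubini_kernel.

(** * Planar Lebesgue measure as a sigma-finite measure *)

Section plane_measure.
Context (R : realType).
Notation leb := (@lebesgue_measure R).
Notation mu2 := (@lebesgue2 R).

HB.instance Definition _ := Measure.on (@lebesgue2 R).

Lemma lebesgue2_square n : measurable (@square R n) /\ (mu2 (@square R n) < +oo)%E.
Proof.
have m : @measurable _ (measurableTypeR R) `[- n%:R, n%:R]%classic by exact: measurable_itv.
split; first exact: measurableX.
by rewrite /lebesgue2 /square product_measure1E//= lebesgue_measure_itv/=; case: ifPn => _;
  rewrite ?mule0 ?ltry// -!EFinB -EFinM ltry.
Qed.

Lemma mem_square (x : R * R) : exists n0, forall n, (n0 <= n)%N -> square n x.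
Proof.
have [n1 h1] : exists n, `|x.1| <= n%:R by exists (Num.bound `|x.1|); apply/ltW/archi_boundP.
have [n2 h2] : exists n, `|x.2| <= n%:R by exists (Num.bound `|x.2|); apply/ltW/archi_boundP.
exists (maxn n1 n2) => n; rewrite geq_max => /andP[n1n n2n].
by split; rewrite /= in_itv/= -ler_norml; [apply: le_trans h1 _|apply: le_trans h2 _]; rewrite ler_nat.
Qed.

Lemma lebesgue2_sigma_finite : sigma_finite setT mu2.
Proof.
exists (@square R); last exact: lebesgue2_square.
by apply/seteqP; split=> // x _; have [n h] := mem_square x; exists n => //; exact: h.
Qed.

HB.instance Definition _ := Measure_isSigmaFinite.Build _ _ _ (@lebesgue2 R)
  lebesgue2_sigma_finite.

End plane_measure.

#[global] Instance ae_plane_filter (R : realType) : Filter (almost_everywhere (@lebesgue2 R)).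
Proof. exact: (@ae_filter_ringOfSetsType _ _ _ (@lebesgue2 R : {measure set _ -> \bar R})). Qed.

#[global] Instance ae_plane_nbhs_filter (R : realType) :
  Filter (nbhs (almost_everywhere (@lebesgue2 R))).
Proof. exact: ae_plane_filter. Qed.

(** * The Hartley kernel and its exponentially weighted products *)

Section hartley_kernel.
Context (R : realType).
Notation leb := (@lebesgue_measure R).
Notation mu2 := (@lebesgue2 R).
Implicit Types (x y z xi : R * R).

(* [lebesgue_measure] lives on [measurableTypeR R], whose display differs from the default one of [R]. *)
Local Notation plane := (measurableTypeR R * measurableTypeR R)%type.

Definition cas (t : R) : R := cos t + sin t.
Definition ker (z : (R * R) * (R * R)) : R := cas (2 * pi * dot2 z.1 z.2).

(** Against an even weight the sine term integrates to 0 and only the difference a - b survives, so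
    a weighted product of two kernels gives a convolution kernel. *)
Lemma casM a b : cas a * cas b = cos (a - b) + sin (a + b) :> R.
Proof. by rewrite /cas cosB sinD; ring. Qed.

Lemma norm_cas_le t : `|cas t| <= 2.
Proof.
apply: le_trans (ler_normD _ _) _.
have h1 : `|cos t| <= 1 by rewrite ler_norml cos_geN1 cos_le1.
have h2 : `|sin t| <= 1 by rewrite ler_norml sin_geN1 sin_le1.
lra.
Qed.

Lemma norm_ker_le (z : (R * R) * (R * R)) : `|ker z| <= 2. Proof. exact: norm_cas_le. Qed.

Lemma dot2C x y : dot2 x y = dot2 y x.
Proof. by rewrite /dot2 mulrC [x.2 * _]mulrC. Qed.

Lemma kerC x y : ker (x, y) = ker (y, x).
Proof. by rewrite /ker/= dot2C. Qed.

Lemma measurable_cas : measurable_fun setT cas.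
Proof. by apply: measurable_funD; apply: continuous_measurable_fun; [exact: continuous_cos|exact: continuous_sin]. Qed.

Lemma measurable_dot2 :
  measurable_fun [set: plane * plane] (fun z : (R * R) * (R * R) => dot2 z.1 z.2).
Proof.
apply: measurable_funD; apply: measurable_funM.
- by apply: (measurableT_comp measurable_fst); exact: measurable_fst.
- by apply: (measurableT_comp measurable_fst); exact: measurable_snd.
- by apply: (measurableT_comp measurable_snd); exact: measurable_fst.
- by apply: (measurableT_comp measurable_snd); exact: measurable_snd.
Qed.

Lemma measurable_ker : measurable_fun [set: plane * plane] ker.
Proof.
apply: (measurableT_comp measurable_cas); apply: measurable_funM => //.
exact: measurable_dot2.
Qed.

Definition expw (c : R) (xi : R * R) : R := kexp (c * xi.1) * kexp (c * xi.2).
(** The transform of the weight [expw c]: the product of two one-dimensional Poisson kernels at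
    scale c, not the rotation-invariant kernel of the plane. It has mass 1 and concentrates at the
    origin as c tends to 0. *)
Definition poisson (c : R) (z : R * R) : R := c ^- 2 * (pker (z.1 / c) * pker (z.2 / c)).

Lemma expw_gt0 c xi : 0 < expw c xi.
Proof. by rewrite mulr_gt0// kexp_gt0. Qed.

Lemma expw_le1 c xi : expw c xi <= 1.
Proof.
by rewrite -[leRHS](mulr1 1); apply: ler_pM; rewrite ?kexp_le1// ltW// kexp_gt0.
Qed.

Lemma measurable_expw c : measurable_fun [set: plane] (expw c).
Proof.
by apply: measurable_funM; apply: (measurableT_comp (@measurable_kexp R));
  apply: measurable_funM.
Qed.

Lemma intg_expw1 : intg mu2 (fun z => kexp z.1 * kexp z.2).
Proof. exact: intg_tensor (@intg_kexp R) (@intg_kexp R). Qed.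

Lemma intg_expw c : c != 0 -> intg mu2 (expw c).
Proof.
move=> c0; have [h _] := integ_aff (0, 0) c0 intg_expw1.
by move: h; apply: eq_intg => x; rewrite /aff/= !addr0.
Qed.

Lemma integ_kexp_sin (a : R) : intg leb (fun t => kexp t * sin (a * t)) /\
  integ leb (fun t => kexp t * sin (a * t)) = 0.
Proof.
have cs : continuous (fun t : R => sin (a * t)).
  move=> x; apply: (continuous_comp (f := fun t : R => a * t)); last exact: continuous_sin.
  by apply: continuousM; [exact: cst_continuous|exact: cvg_id].
have ms := continuous_measurable_fun cs.
have i1 : intg leb (fun t => sin (a * t) * kexp t).
  apply: (@intg_mulb _ _ _ _ _ _ 1) (@intg_kexp R); first exact: ms.
  by move=> t; rewrite ler_norml sin_geN1 sin_le1.
have i2 : intg leb (fun t => kexp t * sin (a * t)) by move: i1; apply: eq_intg => t; rewrite mulrC.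
split=> //.
have ik := @intg_kexp R.
(* The reflection t -> -t shows that the odd integrand has integral 0; adding [kexp] makes it
   nonnegative, as [ge0_integral_affine] requires. *)
have f0 t : 0 <= kexp t + kexp t * sin (a * t).
  have := kexp_gt0 t; have := sin_geN1 (a * t); nra.
have iD := intgD ik i2; have iB := intgB ik i2.
have mD : measurable_fun setT (fun t => (kexp t + kexp t * sin (a * t))%:E).
  by apply/measurable_EFinP; exact: (intg_meas iD).
have := @ge0_integral_affine R (fun t => (kexp t + kexp t * sin (a * t))%:E) (-1) 0.
rewrite normrN1 invr1 mul1e => /(_ _ mD f0); rewrite oppr_eq0 oner_eq0 => /(_ isT).
rewrite -(integE iD) => e.
have e2 : (\int[leb]_x (kexp (-1 * x + 0)%R + kexp (-1 * x + 0)%R * sin (a * (-1 * x + 0)))%:E)%E =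
    (integ leb (fun t => kexp t - kexp t * sin (a * t)))%:E.
  rewrite integE//; apply: eq_integral => t _; congr EFin.
  by rewrite addr0 mulN1r /kexp normrN mulrN sinN mulrN.
move: e; rewrite e2 => -[]; rewrite integB// integD//; lra.
Qed.

Lemma integ_expw_ker1 x y :
  integ mu2 (fun xi => kexp xi.1 * kexp xi.2 * (ker (x, xi) * ker (y, xi))) =
  pker (x.1 - y.1) * pker (x.2 - y.2).
Proof.
pose c1 (w t : R) := kexp t * cos (2 * pi * w * t).
pose s1 (w t : R) := kexp t * sin (2 * pi * w * t).
have ic w : intg leb (c1 w) by exact: intg_kexp_cos.
have [is0 s0] : (forall w, intg leb (s1 w)) /\ (forall w, integ leb (s1 w) = 0).
  by split=> w; have [] := integ_kexp_sin (2 * pi * w).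
pose dm : R * R := (x.1 - y.1, x.2 - y.2).
pose dp : R * R := (x.1 + y.1, x.2 + y.2).
transitivity (integ mu2 (fun xi => (c1 dm.1 xi.1 * c1 dm.2 xi.2 - s1 dm.1 xi.1 * s1 dm.2 xi.2) +
   (s1 dp.1 xi.1 * c1 dp.2 xi.2 + c1 dp.1 xi.1 * s1 dp.2 xi.2))).
  apply: eq_integ => xi; rewrite /ker casM /dot2/=.
  rewrite (_ : _ - _ = 2 * pi * dm.1 * xi.1 + 2 * pi * dm.2 * xi.2); last by rewrite /dm/=; ring.
  rewrite (_ : 2 * pi * (_ + _) + _ = 2 * pi * dp.1 * xi.1 + 2 * pi * dp.2 * xi.2); last by rewrite /dp/=; ring.
  by rewrite cosD sinD /c1 /s1; ring.
have tc w1 w2 := intg_tensor (ic w1) (ic w2).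
have ts w1 w2 := intg_tensor (is0 w1) (is0 w2).
have tsc w1 w2 := intg_tensor (is0 w1) (ic w2).
have tcs w1 w2 := intg_tensor (ic w1) (is0 w2).
rewrite integD; [|exact: intgB|exact: intgD].
rewrite integB// integD// !integ_tensor// !s0 !mulr0 !mul0r subr0 !addr0.
by rewrite /c1 !integ_kexp_cos.
Qed.

(** Replacing xi by c xi and dividing x and y by c leaves the kernels unchanged, so the case of
    weight 1 suffices. *)
Lemma integ_expw_ker (c : R) x y : 0 < c ->
  integ mu2 (fun xi => expw c xi * (ker (x, xi) * ker (y, xi))) =
  poisson c (x.1 - y.1, x.2 - y.2).
Proof.
move=> c0; have cn : c != 0 by rewrite gt_eqF.
pose sc (u : R * R) : R * R := (u.1 / c, u.2 / c).
pose F xi := kexp xi.1 * kexp xi.2 * (ker (sc x, xi) * ker (sc y, xi)).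
have iF : intg mu2 F.
  have : intg mu2 (fun xi => ker (sc x, xi) * ker (sc y, xi) * (kexp xi.1 * kexp xi.2)).
    apply: (@intg_mulb _ _ _ _ _ _ 4) intg_expw1.
      by apply: measurable_funM; apply: measurable_section1; exact: measurable_ker.
    move=> xi; rewrite normrM (_ : 4 = 2 * 2); last by ring.
    by apply: ler_pM => //; exact: norm_ker_le.
  by apply: eq_intg => xi; rewrite mulrC.
have [_] := integ_aff (0, 0) cn iF.
rewrite integ_expw_ker1 /poisson /sc/= -!mulrBl => <-; apply: eq_integ => xi.
rewrite /F /aff /expw/= !addr0 /ker /dot2 /sc/=; congr (_ * (cas _ * cas _)); field => //.
Qed.

Lemma poisson_ge0 c z : 0 <= poisson c z.
Proof. by rewrite mulr_ge0 ?invr_ge0 ?sqr_ge0// mulr_ge0// pker_ge0. Qed.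

Lemma measurable_poisson c : measurable_fun [set: plane] (poisson c).
Proof.
apply: measurable_funM => //; apply: measurable_funM;
  by apply: (measurableT_comp (@measurable_pker R)); apply: measurable_funM.
Qed.

Definition pker2 z : R := pker z.1 * pker z.2.

Lemma intg_pker2 : intg mu2 pker2.
Proof. exact: intg_tensor (@intg_pker R) (@intg_pker R). Qed.

Lemma integ_pker2 : integ mu2 pker2 = 1.
Proof.
by have := integ_tensor (@intg_pker R) (@intg_pker R); rewrite integ_pker mulr1.
Qed.

Lemma pker2_ge0 z : 0 <= pker2 z.
Proof. by rewrite mulr_ge0// pker_ge0. Qed.

End hartley_kernel.

(** * The Hartley transform of integrable functions and Poisson means *)

Section hartley_L1.
Context (R : realType).
Notation leb := (@lebesgue_measure R).
Notation mu2 := (@lebesgue2 R).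
Local Notation plane := (measurableTypeR R * measurableTypeR R)%type.
Implicit Types (x y z xi : R * R) (g h phi : R * R -> R) (c : R).

Definition hart g xi : R := integ mu2 (fun x => g x * ker (x, xi)).

Lemma intg_hart g xi : intg mu2 g -> intg mu2 (fun x => g x * ker (x, xi)).
Proof. by move=> hg; exact: (intg_section2 (m1 := mu2) xi hg (@measurable_ker R) (@norm_ker_le R)). Qed.

Lemma norm_hart_le g xi : intg mu2 g -> `|hart g xi| <= 2 * integ mu2 (fun x => `|g x|).
Proof.
move=> hg; apply: le_trans (norm_integ_le (intg_hart xi hg)) _.
have hn := intg_norm hg.
rewrite -integZ//; apply: le_integ; [exact/intg_norm/intg_hart|exact: intgZ|].
by move=> x; rewrite normrM mulrC ler_wpM2r// norm_ker_le.
Qed.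

(** Fubini's theorem gives measurability only after multiplication by an integrable function of xi.
    The strictly positive weight [expw 1] serves for this and is then divided out. *)
Lemma measurable_hart g : intg mu2 g -> measurable_fun [set: plane] (hart g).
Proof.
move=> hg.
have [/intg_meas h _] := fubini_section2 hg (intg_expw (oner_neq0 R))
  (@measurable_ker R) (@norm_ker_le R).
have -> : hart g = (fun xi => expR (`|1 * xi.1| + `|1 * xi.2|) * (expw 1 xi * hart g xi)).
  apply/funext => xi; rewrite mulrA /expw /kexp -!expRD.
  by rewrite [X in expR X](_ : _ = 0) ?expR0 ?mul1r//; ring.
apply: measurable_funM; last exact: h.
apply: measurableT_comp => //; apply: measurable_funD; apply: measurableT_comp => //;
  exact: measurable_funM.
Qed.

Lemma hartD g h xi : intg mu2 g -> intg mu2 h ->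
  hart (fun x => g x + h x) xi = hart g xi + hart h xi.
Proof.
move=> hg hh; rewrite /hart -integD; [|exact: intg_hart..].
by apply: eq_integ => x; rewrite mulrDl.
Qed.

Lemma hartZ a g xi : intg mu2 g -> hart (fun x => a * g x) xi = a * hart g xi.
Proof.
move=> hg; rewrite /hart -integZ; last exact: intg_hart.
by apply: eq_integ => x; rewrite mulrA.
Qed.

Lemma hartB g h xi : intg mu2 g -> intg mu2 h ->
  hart (fun x => g x - h x) xi = hart g xi - hart h xi.
Proof.
move=> hg hh; rewrite /hart -integB; [|exact: intg_hart..].
by apply: eq_integ => x; rewrite mulrBl.
Qed.

Lemma hart_mul g h : intg mu2 g -> intg mu2 h ->
  integ mu2 (fun x => hart g x * h x) = integ mu2 (fun x => g x * hart h x).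
Proof.
move=> hg hh; have := fubini_kernel hg hh (@measurable_ker R) (@norm_ker_le R).
rewrite (@eq_integ _ _ _ mu2 (fun x => hart g x * h x) (fun x => h x * hart g x)); last first.
  by move=> x; rewrite mulrC.
move=> <-; apply: eq_integ => x; congr (_ * _).
by apply: eq_integ => y; rewrite kerC.
Qed.

Definition subp x y : R * R := (x.1 - y.1, x.2 - y.2).

Definition poisson_mean c g x : R := integ mu2 (fun y => g y * poisson c (subp x y)).

Lemma intg_expw_hart c g : c != 0 -> intg mu2 g -> intg mu2 (fun xi => expw c xi * hart g xi).
Proof.
move=> c0 hg.
have := intg_mulb (measurable_hart hg) (fun xi => norm_hart_le xi hg) (intg_expw c0).
by apply: eq_intg => xi; rewrite mulrC.
Qed.

(** The weight makes the double integral absolutely convergent, so Fubini's theorem applies; the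
    inner integral is then [integ_expw_ker]. *)
Lemma hart_expw_hart c g x : 0 < c -> intg mu2 g ->
  hart (fun xi => expw c xi * hart g xi) x = poisson_mean c g x.
Proof.
move=> c0 hg.
have hw := intg_expw (lt0r_neq0 c0).
have hh : intg mu2 (fun xi => expw c xi * ker (xi, x)) by exact: intg_hart.
have := fubini_kernel hg hh (@measurable_ker R) (@norm_ker_le R).
rewrite [X in _ = X -> _](_ : _ = hart (fun xi => expw c xi * hart g xi) x); last first.
  by apply: eq_integ => xi; rewrite -/(hart g xi); ring.
move=> <-; apply: eq_integ => y; congr (_ * _).
rewrite -integ_expw_ker//; apply: eq_integ => xi.
by rewrite [ker (xi, x)]kerC; ring.
Qed.

(** The square of [expw (c / 2)] is [expw c]. One factor [hart g] is then moved across by the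
    symmetry of the kernel, which leaves the double transform, a Poisson mean. *)
Lemma sq_expw_hart c g : 0 < c -> intg mu2 g ->
  L2f mu2 (fun xi => expw (c / 2) xi * hart g xi) /\
  sq mu2 (fun xi => expw (c / 2) xi * hart g xi) = integ mu2 (fun x => g x * poisson_mean c g x).
Proof.
move=> c0 hg.
have c2 : c / 2 != 0 by rewrite gt_eqF// divr_gt0.
have e xi : (expw (c / 2) xi * hart g xi) ^+ 2 = (expw c xi * hart g xi) * hart g xi.
  rewrite exprMn expr2 [hart g xi ^+ 2]expr2 mulrA; congr (_ * _ * _).
  rewrite /expw /kexp -!expRD; congr expR.
  have h u : `|c / 2 * u| = `|c * u| / 2.
    by rewrite mulrAC normrM [`|2^-1|]ger0_norm.
  by rewrite !h; field.
have hw := intg_expw_hart (lt0r_neq0 c0) hg.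
split.
  split.
    by apply: measurable_funM; [exact: measurable_expw|exact: measurable_hart].
  have := intg_mulb (measurable_hart hg) (fun xi => norm_hart_le xi hg) hw.
  by apply: eq_intg => xi; rewrite e mulrC.
transitivity (integ mu2 (fun xi => (expw c xi * hart g xi) * hart g xi)).
  exact: eq_integ.
rewrite -(hart_mul hw hg).
by apply: eq_integ => x; rewrite hart_expw_hart// mulrC.
Qed.

Lemma measurable_subp : measurable_fun [set: plane * plane] (fun z : (R * R) * (R * R) => subp z.1 z.2).
Proof.
apply: measurable_fun_pair; apply: measurable_funB.
- by apply: (measurableT_comp measurable_fst); exact: measurable_fst.
- by apply: (measurableT_comp measurable_fst); exact: measurable_snd.
- by apply: (measurableT_comp measurable_snd); exact: measurable_fst.
- by apply: (measurableT_comp measurable_snd); exact: measurable_snd.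
Qed.

(** The signs 1 and -1 of [e] give the two marginals of the kernel [poisson c (subp x y)], in x and
    in y. *)
Lemma integ_poisson_aff c (e : R) b : 0 < c -> `|e| = 1 ->
  intg mu2 (fun y => poisson c (aff e b y)) /\ integ mu2 (fun y => poisson c (aff e b y)) = 1.
Proof.
move=> c0 e1; have cn := lt0r_neq0 c0.
have en : e != 0 by rewrite -normr_eq0 e1 oner_eq0.
have ec : e / c != 0 by rewrite mulf_neq0// invr_eq0.
have [i1 i2] := integ_aff (b.1 / c, b.2 / c) ec (@intg_pker2 R).
have E y : c ^- 2 * pker2 (aff (e / c) (b.1 / c, b.2 / c) y) = poisson c (aff e b y).
  by rewrite /poisson /pker2 /aff/=; congr (_ * (pker _ * pker _)); field.
split; first by have := intgZ (c ^- 2) i1; apply: eq_intg.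
have <- : integ mu2 (fun y => c ^- 2 * pker2 (aff (e / c) (b.1 / c, b.2 / c) y)) =
    integ mu2 (fun y => poisson c (aff e b y)) by apply: eq_integ.
rewrite integZ// i2 integ_pker2 exprMn -[e ^+ 2]real_normK ?num_real// e1.
by field.
Qed.

Lemma integ_poisson1 c y : 0 < c -> intg mu2 (fun x => poisson c (subp x y)) /\
  integ mu2 (fun x => poisson c (subp x y)) = 1.
Proof.
move=> c0; have [i1 i2] := integ_poisson_aff (- y.1, - y.2) c0 (normr1 R).
have E x : poisson c (aff 1 (- y.1, - y.2) x) = poisson c (subp x y).
  by rewrite /aff /subp/= !mul1r.
split; first by move: i1; apply: eq_intg.
by rewrite -i2; apply: eq_integ => x; rewrite E.
Qed.

Lemma integ_poisson2 c x : 0 < c -> intg mu2 (fun y => poisson c (subp x y)) /\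
  integ mu2 (fun y => poisson c (subp x y)) = 1.
Proof.
move=> c0; have [i1 i2] := integ_poisson_aff x c0 (normrN1 R).
have E y : poisson c (aff (-1) x y) = poisson c (subp x y).
  by rewrite /aff /subp/= !mulN1r ![- _ + _]addrC.
split; first by move: i1; apply: eq_intg.
by rewrite -i2; apply: eq_integ => y; rewrite E.
Qed.

Lemma norm_poisson_le c z : `|poisson c z| <= 4 * c ^- 2.
Proof.
have h t : `|pker t : R| <= 2.
  rewrite ger0_norm ?pker_ge0// /pker ler_piMr// invf_le1 ?lerDl ?sqr_ge0//.
  by rewrite ltr_pwDl// sqr_ge0.
rewrite /poisson normrM ger0_norm ?invr_ge0 ?sqr_ge0// mulrC ler_wpM2r ?invr_ge0 ?sqr_ge0//.
by rewrite normrM (_ : 4 = 2 * 2); [apply: ler_pM => //; exact: h|ring].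
Qed.

Lemma measurable_poisson_subp c :
  measurable_fun [set: plane * plane] (fun z : (R * R) * (R * R) => poisson c (subp z.1 z.2)).
Proof. by apply: (measurableT_comp (measurable_poisson c)); exact: measurable_subp. Qed.

(** Schur's test: g(x) g(y) <= (g(x)^2 + g(y)^2) / 2 against a nonnegative kernel both of whose
    marginals are 1. *)
Lemma integ_mul_poisson_mean_le c g : 0 < c -> intg mu2 g -> L2f mu2 g ->
  integ mu2 (fun x => g x * poisson_mean c g x) <= sq mu2 g.
Proof.
move=> c0 hg h2; pose k (z : (R * R) * (R * R)) := poisson c (subp z.1 z.2).
have mk : measurable_fun setT k by exact: measurable_poisson_subp.
have kb w : `|k w| <= 4 * c ^- 2 by exact: norm_poisson_le.
rewrite (proj2 (fubini_section1 (m1 := mu2) hg hg mk kb)).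
have mg := intg_meas hg.
have k0 w : 0 <= k w by exact: poisson_ge0.
have i2 : intg mu2 (fun x => g x ^+ 2) by case: h2.
have mg1 : measurable_fun setT (fun z : (R * R) * (R * R) => g z.1 ^+ 2).
  by apply: measurable_funX; apply: measurableT_comp => //; exact: measurable_fst.
have mg2 : measurable_fun setT (fun z : (R * R) * (R * R) => g z.2 ^+ 2).
  by apply: measurable_funX; apply: measurableT_comp => //; exact: measurable_snd.
have mF1 : measurable_fun setT (fun z : (R * R) * (R * R) => k z * g z.1 ^+ 2) by exact: measurable_funM.
have mF2 : measurable_fun setT (fun z : (R * R) * (R * R) => k z * g z.2 ^+ 2) by exact: measurable_funM.
have F10 w : 0 <= k w * g w.1 ^+ 2 by rewrite mulr_ge0// sqr_ge0.
have F20 w : 0 <= k w * g w.2 ^+ 2 by rewrite mulr_ge0// sqr_ge0.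
have e1 : (\int[mu2 \x mu2]_z (k z * g z.1 ^+ 2)%:E = (sq mu2 g)%:E)%E.
  rewrite fubini_tonelli1//; [|exact/measurable_EFinP].
  rewrite /fubini_F integE//; apply: eq_integral => x _ /=.
  have [j1 j2] := integ_poisson2 x c0.
  rewrite -[RHS]mul1e -j2 integE//= -ge0_integralZr//.
  - by apply/measurable_EFinP; exact: intg_meas j1.
  - by move=> y _; rewrite lee_fin poisson_ge0.
  - by rewrite lee_fin sqr_ge0.
have e2 : (\int[mu2 \x mu2]_z (k z * g z.2 ^+ 2)%:E = (sq mu2 g)%:E)%E.
  rewrite fubini_tonelli2//; [|exact/measurable_EFinP].
  rewrite /fubini_G integE//; apply: eq_integral => y _ /=.
  have [j1 j2] := integ_poisson1 y c0.
  rewrite -[RHS]mul1e -j2 integE//= -ge0_integralZr//.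
  - by apply/measurable_EFinP; exact: intg_meas j1.
  - by move=> x _; rewrite lee_fin poisson_ge0.
  - by rewrite lee_fin sqr_ge0.
have i1' : intg (mu2 \x mu2)%E (fun z : (R * R) * (R * R) => k z * g z.1 ^+ 2).
  by apply/ge0_intgP => //; rewrite e1 ltry.
have i2' : intg (mu2 \x mu2)%E (fun z : (R * R) * (R * R) => k z * g z.2 ^+ 2).
  by apply/ge0_intgP => //; rewrite e2 ltry.
have := @le_integ _ _ _ (mu2 \x mu2)%E _ (fun z : (R * R) * (R * R) => 2^-1 * (k z * g z.1 ^+ 2 + k z * g z.2 ^+ 2))
  (intg_kernel (m1 := mu2) hg hg mk kb) (intgZ _ (intgD i1' i2')).
rewrite integZ ?integD//; last exact: intgD.
have -> : integ (mu2 \x mu2)%E (fun z : (R * R) * (R * R) => k z * g z.1 ^+ 2) = sq mu2 g.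
  by apply: EFin_inj; rewrite integE.
have -> : integ (mu2 \x mu2)%E (fun z : (R * R) * (R * R) => k z * g z.2 ^+ 2) = sq mu2 g.
  by apply: EFin_inj; rewrite integE.
rewrite (_ : 2^-1 * (sq mu2 g + sq mu2 g) = sq mu2 g); last by field.
apply => z; have := mulr_ge0 (k0 z) (sqr_ge0 (g z.1 - g z.2)).
by move: (k z) (g z.1) (g z.2) => a b b'; nra.
Qed.

Lemma cvg_invS : (n.+1%:R^-1 : R) @[n --> \oo] --> (0 : R).
Proof. exact: cvg_harmonic. Qed.

Lemma invS_gt0 n : 0 < n.+1%:R^-1 :> R. Proof. by rewrite invr_gt0 ltr0n. Qed.

Lemma cvg_expw (u : nat -> R) xi : u n @[n --> \oo] --> (0 : R) ->
  expw (u n) xi @[n --> \oo] --> (1 : R).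
Proof.
move=> u0; rewrite -[X in _ --> X](mulr1 1).
have h (t : R) : kexp (u n * t) @[n --> \oo] --> (1 : R).
  rewrite -[X in _ --> X](_ : kexp (0 * t) = 1); last by rewrite mul0r /kexp normr0 oppr0 expR0.
  apply: continuous_cvg; first exact: continuous_kexp.
  by apply: cvgM => //; exact: cvg_cst.
by apply: cvgM; exact: h.
Qed.

(** By the two preceding estimates every damped transform has squared norm at most that of g;
    Fatou's lemma removes the damping. *)
Lemma hart_L2 g : intg mu2 g -> L2f mu2 g -> L2f mu2 (hart g) /\ sq mu2 (hart g) <= sq mu2 g.
Proof.
move=> hg h2.
apply: (@fatou_sq _ _ _ mu2 (fun n xi => expw (n.+1%:R^-1 / 2) xi * hart g xi)) => [n|n|xi].
- exact: (proj1 (sq_expw_hart (invS_gt0 n) hg)).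
- rewrite (proj2 (sq_expw_hart (invS_gt0 n) hg)).
  by apply: integ_mul_poisson_mean_le => //; exact: invS_gt0.
rewrite -[X in _ --> X]mul1r; apply: cvgM; last exact: cvg_cst.
apply: cvg_expw; rewrite -[X in _ --> X](mul0r (2^-1 : R)).
by apply: cvgM; [exact: cvg_invS|exact: cvg_cst].
Qed.

(** The substitution y = x - c z moves the scale from the kernel to g. For bounded g the integrand
    then has a majorant independent of c. *)
Lemma poisson_meanE c g x : 0 < c -> intg mu2 g ->
  poisson_mean c g x = integ mu2 (fun z => g (aff (- c) x z) * pker2 z).
Proof.
move=> c0 hg; have cn : - c != 0 by rewrite oppr_eq0 gt_eqF.
have c0' := lt0r_neq0 c0.
have hf : intg mu2 (fun y => g y * poisson c (subp x y)).
  have := intg_mulb (measurable_section1 x (@measurable_poisson_subp c)) (fun y => norm_poisson_le c _) hg.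
  by apply: eq_intg => y; rewrite mulrC.
have [i1 i2] := integ_aff x cn hf.
have -> : poisson_mean c g x = c ^+ 2 * integ mu2 (fun z => g (aff (- c) x z) * poisson c (subp x (aff (- c) x z))).
  by rewrite i2 sqrrN mulrA divff ?mul1r// expf_neq0.
rewrite -integZ//; apply: eq_integ => z.
rewrite mulrCA; congr (_ * _); rewrite /poisson mulrA divff ?expf_neq0// mul1r /pker2.
by rewrite /subp /aff/=; congr (pker _ * pker _); field.
Qed.

(* The functions whose Poisson means are shown to converge pointwise. *)
Definition tame phi := [/\ intg mu2 phi, continuous phi & exists M, forall x, `|phi x| <= M].

Lemma tame_L2f phi : tame phi -> L2f mu2 phi.
Proof. by move=> [i _ [M hM]]; exact: (@L2f_bounded _ _ _ mu2 phi M). Qed.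

Lemma poisson_mean_tame phi M : tame phi -> (forall x, `|phi x| <= M) ->
  (forall n x, `|poisson_mean n.+1%:R^-1 phi x| <= M) /\
  (forall x, poisson_mean n.+1%:R^-1 phi x @[n --> \oo] --> phi x).
Proof.
move=> [hphi cphi _] hM; have mphi := intg_meas hphi.
have mz c x : measurable_fun setT (fun z => phi (aff (- c) x z) * pker2 z).
  apply: measurable_funM; last exact: intg_meas (@intg_pker2 R).
  by apply: measurableT_comp => //; exact: measurable_aff.
have bz c x z : `|phi (aff (- c) x z) * pker2 z| <= M * pker2 z.
  by rewrite normrM [`|pker2 z|]ger0_norm ?pker2_ge0// ler_wpM2r// pker2_ge0.
have iz := intgZ M (@intg_pker2 R).
split=> [n x|x].
  rewrite poisson_meanE ?invS_gt0//.
  have hz := @intg_le _ _ _ mu2 _ _ (mz _ x) (bz n.+1%:R^-1 x) iz.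
  apply: le_trans (norm_integ_le hz) _.
  have := le_integ (intg_norm hz) iz (bz _ _).
  by rewrite integZ ?integ_pker2 ?mulr1//; exact: intg_pker2.
have -> : (fun n => poisson_mean n.+1%:R^-1 phi x) =
    (fun n => integ mu2 (fun z => phi (aff (- n.+1%:R^-1) x z) * pker2 z)).
  by apply/funext => n; rewrite poisson_meanE ?invS_gt0.
have -> : phi x = integ mu2 (fun z => phi x * pker2 z).
  by rewrite integZ ?integ_pker2 ?mulr1//; exact: intg_pker2.
apply: (proj2 (@dct _ _ _ mu2 _ _ _ (fun n => mz _ x) (fun n => bz _ x) iz _)) => z.
apply: cvgM; last exact: cvg_cst.
apply: continuous_cvg; first exact: cphi.
rewrite [X in _ --> X](surjective_pairing x) /aff.
have h (s t : R) : - n.+1%:R^-1 * s + t @[n --> \oo] --> t.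
  rewrite -[X in _ --> X](_ : - 0 * s + t = t); last by rewrite oppr0 mul0r add0r.
  apply: cvgD; last exact: cvg_cst.
  by apply: cvgM; [apply: cvgN; exact: cvg_invS|exact: cvg_cst].
exact: (cvg_pair (h z.1 x.1) (h z.2 x.2)).
Qed.

(** Only the lower bound is new. The integral of phi times its Poisson mean tends to [sq mu2 phi],
    and it equals the squared norm of a damped transform, which is at most that of [hart phi]. *)
Lemma sq_hart_tame phi : tame phi -> sq mu2 (hart phi) = sq mu2 phi.
Proof.
move=> tphi; have [hphi cphi [M hM]] := tphi; have h2 := tame_L2f tphi.
have [hL hle] := hart_L2 hphi h2.
apply/eqP; rewrite eq_le hle/=.
have [bs cs] := poisson_mean_tame tphi hM.
have M0 : 0 <= M by exact: le_trans (hM (0, 0)).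
have ms n : measurable_fun setT (poisson_mean n.+1%:R^-1 phi).
  have h := intg_expw_hart (lt0r_neq0 (invS_gt0 n)) hphi.
  have := measurable_hart h; apply: eq_measurable_fun => x _.
  by rewrite hart_expw_hart ?invS_gt0.
have lim : integ mu2 (fun x => phi x * poisson_mean n.+1%:R^-1 phi x) @[n --> \oo] --> sq mu2 phi.
  apply: (proj2 (@dct _ _ _ mu2 (fun n x => phi x * poisson_mean n.+1%:R^-1 phi x) _ (fun x => M * `|phi x|) _ _ _ _)).
  - by move=> n; apply: measurable_funM; [exact: intg_meas hphi|exact: ms].
  - by move=> n x; rewrite normrM mulrC ler_wpM2r.
  - by apply: intgZ; exact: intg_norm.
  - by move=> x; rewrite expr2; apply: cvgM; [exact: cvg_cst|exact: cs].
rewrite -(cvg_lim _ lim)//; apply: limr_le; first exact: (cvgP _ lim).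
apply: nearW => n; have [hn <-] := sq_expw_hart (invS_gt0 n) hphi.
apply: le_integ; [by case: hn|by case: hL|] => xi.
rewrite exprMn -[leRHS]mul1r ler_wpM2r ?sqr_ge0//.
by rewrite expr_le1 ?expw_le1// ltW// expw_gt0.
Qed.

End hartley_L1.

(** * Vanishing of integrals on generated sigma-algebras *)

Section dynkin_integral.
Context d d' (T : measurableType d) (T' : measurableType d') (R : realType).
Variables (mu : {measure set T -> \bar R}).

(** The sets over which the integral vanishes form a Dynkin system. The map [p] and the fixed set
    [C] let one statement serve for either coordinate, with the other one restricted, and for the
    plane itself. *)
Lemma dynkin_integral_eq0 (G : set (set T')) (p : T -> T') (f : T -> \bar R) (C : set T) :
  d'.-measurable = <<s G >> -> setI_closed G -> measurable_fun setT p ->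
  measurable C -> mu.-integrable setT f ->
  (\int[mu]_(x in C) f x = 0)%E ->
  (forall A, G A -> \int[mu]_(x in C `&` p @^-1` A) f x = 0)%E ->
  forall A, measurable A -> (\int[mu]_(x in C `&` p @^-1` A) f x = 0)%E.
Proof.
move=> GE GI mp mC fi fC fG A mA.
have mpre S : measurable S -> measurable (p @^-1` S).
  by move=> mS; rewrite -[X in measurable X]setTI; exact: mp.
have mCp S : measurable S -> measurable (C `&` p @^-1` S).
  by move=> mS; apply: measurableI => //; exact: mpre.
have fS S : measurable S -> mu.-integrable S f by move=> mS; exact: integrableS fi.
apply: (@dynkin_induction _ _ G (fun S => \int[mu]_(x in C `&` p @^-1` S) f x = 0)%E) => //.
- by rewrite preimage_setT setIT.
- move=> S mS S0.
  have : (\int[mu]_(x in (C `&` p @^-1` S) `|` (C `&` p @^-1` (~` S))) f x = 0)%E.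
    by rewrite -setIUr preimage_setC setUv setIT.
  rewrite integral_setU//; last 4 first.
  + exact: mCp.
  + by apply: mCp; exact: measurableC.
  + apply: (@measurable_funS _ _ _ _ setT) => //; by case/integrableP: fi.
  + by apply/disj_setPS => x [[_ Sx] [_ nSx]]; exact: (nSx Sx).
  by rewrite S0 add0e.
- move=> F mF tF F0; rewrite preimage_bigcup setI_bigcupr integral_bigcup.
  + by rewrite eseries0.
  + apply/trivIsetP => i j _ _ ij; apply/seteqP; split=> // x [[_ xi] [_ xj]].
    by have /trivIsetP/(_ i j I I ij)/seteqP[/(_ (p x)) h _] := tF; apply: h.
  + by move=> k; exact: mCp.
  + by apply: fS; apply: bigcupT_measurable => k; exact: mCp.
by rewrite -GE.
Qed.

End dynkin_integral.

(** * A locally integrable function orthogonal to all bumps is null *)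

Section tame_uniqueness.
Context (R : realType).
Notation mu2 := (@lebesgue2 R).
Implicit Types (w phi : R * R -> R) (x : R * R).

(** With t = k (v + |v|), twice the positive part of k v, the quotient t / (1 + t) is continuous,
    vanishes outside (a, b) and tends to 1 inside as k grows. *)
Definition bump (a b : R) (k : nat) (y : R) : R :=
  let v := (y - a) * (b - y) in
  k%:R * (v + `|v|) / (1 + k%:R * (v + `|v|)).

Lemma bump_arg_ge0 (v : R) k : 0 <= k%:R * (v + `|v|).
Proof. by rewrite mulr_ge0//; have := ler_norm (- v); rewrite normrN; lra. Qed.

Lemma bump_ge0 a b k y : 0 <= bump a b k y.
Proof.
have h := bump_arg_ge0 ((y - a) * (b - y)) k.
by rewrite /bump; apply: divr_ge0 => //; exact: addr_ge0.
Qed.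

Lemma bump_le1 a b k y : bump a b k y <= 1.
Proof.
have h := bump_arg_ge0 ((y - a) * (b - y)) k.
by rewrite /bump ler_pdivrMr ?ltr_wpDr//; lra.
Qed.

Lemma bump_support (a b y : R) : a <= b -> y \notin `]a, b[ -> (y - a) * (b - y) <= 0.
Proof.
move=> ab; rewrite in_itv/= negb_and -!leNgt => /orP[h|h]; nra.
Qed.

Lemma bump_eq0 a b k y : a <= b -> y \notin `]a, b[ -> bump a b k y = 0.
Proof.
move=> ab /(bump_support ab) h; rewrite /bump ler0_norm// subrr mulr0 mul0r//.
Qed.

Lemma continuous_bump a b k : continuous (bump a b k).
Proof.
move=> y.
pose q (y : R) := k%:R * ((y - a) * (b - y) + `|(y - a) * (b - y)|).
have cv : {for y, continuous (fun y : R => (y - a) * (b - y))}.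
  apply: continuousM.
    by apply: continuousB; [exact: cvg_id|exact: cst_continuous].
  by apply: continuousB; [exact: cst_continuous|exact: cvg_id].
have cq : {for y, continuous q}.
  apply: continuousM; first exact: cst_continuous.
  apply: continuousD => //.
  by apply: (@continuous_comp _ _ _ (fun y : R => (y - a) * (b - y)) Num.norm) => //; exact: norm_continuous.
apply: (@continuousM _ _ q (fun y => (1 + q y)^-1)) => //.
apply: (@continuousV _ _ (fun y => 1 + q y)).
  by rewrite gt_eqF//; have := bump_arg_ge0 ((y - a) * (b - y)) k; rewrite -/(q y); lra.
by apply: continuousD => //; exact: cst_continuous.
Qed.

Lemma cvg_bump a b y : a <= b ->
  bump a b k y @[k --> \oo] --> (\1_(`]a, b[%classic) y : R).
Proof.
move=> ab; rewrite indicE; have [yab|yab] := boolP (y \in `]a, b[); last first.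
  rewrite memNset; last by move=> /=; exact/negP.
  by rewrite (_ : (fun k => bump a b k y) = fun=> 0); [exact: cvg_cst|
    apply/funext => k; rewrite bump_eq0].
rewrite mem_set//.
have v0 : 0 < (y - a) * (b - y).
  by move: yab; rewrite in_itv/= => /andP[h1 h2]; rewrite mulr_gt0 ?subr_gt0.
set v := (y - a) * (b - y) in v0 *.
have e k : bump a b k.+1 y = 1 - (1 + k.+1%:R * (v + `|v|))^-1.
  rewrite /bump -/v; move: (bump_arg_ge0 v k.+1); move: (_ * (v + _)) => t t0.
  have t1 : 1 + t != 0 by rewrite gt_eqF// ltr_wpDr.
  by apply: (mulIf t1); rewrite mulrBl divfK// mulVf//; ring.
suff H : bump a b k.+1 y @[k --> \oo] --> (1 : R).
  by have := H; rewrite (@cvg_shiftS _ (fun k => bump a b k y)); apply.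
rewrite (_ : (fun k => bump a b k.+1 y) = (fun k => 1 - (1 + k.+1%:R * (v + `|v|))^-1)); last exact/funext.
rewrite -[X in _ --> X]subr0; apply: cvgB; first exact: cvg_cst.
apply: (@squeeze_cvgr _ _ _ _ (fun=> 0) (fun k => k.+1%:R^-1 * v^-1)).
- apply: nearW => k; rewrite (gtr0_norm v0) -invfM.
  have k0 : 0 < k.+1%:R :> R by rewrite ltr0n.
  move: (k.+1%:R : R) k0 => K k0.
  have kv : 0 < K * v by rewrite mulr_gt0.
  have kv' : 0 < 1 + K * (v + v) by rewrite mulrDr; lra.
  apply/andP; split; first by rewrite invr_ge0 ltW.
  by rewrite lef_pV2// mulrDr; lra.
- exact: cvg_cst.
- rewrite -[X in _ --> X](mul0r v^-1); apply: cvgM; last exact: cvg_cst.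
  exact: cvg_invS.
Qed.

Definition bump2 (a b c d : R) (k : nat) (x : R * R) := bump a b k x.1 * bump c d k x.2.

Lemma bump2_ge0 a b c d k x : 0 <= bump2 a b c d k x.
Proof. by rewrite mulr_ge0// bump_ge0. Qed.

Lemma bump2_le a b c d k n x : a <= b -> c <= d -> - n%:R <= a -> b <= n%:R ->
  - n%:R <= c -> d <= n%:R -> bump2 a b c d k x <= \1_(@square R n) x.
Proof.
move=> ab cd na bn nc dn.
have [h1|h1] := boolP (x.1 \in `]a, b[); last by rewrite /bump2 bump_eq0// mul0r indicE.
have [h2|h2] := boolP (x.2 \in `]c, d[); last by rewrite /bump2 [bump c d _ _]bump_eq0// mulr0 indicE.
rewrite indicE mem_set; first by rewrite -[leRHS](mulr1 1) ler_pM ?bump_ge0 ?bump_le1.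
move: h1 h2; rewrite !in_itv/= => /andP[u1 u2] /andP[u3 u4].
by split; rewrite /= in_itv/=; apply/andP; split; lra.
Qed.

Lemma intg_square n : intg mu2 (\1_(@square R n) : R * R -> R).
Proof.
have [m f] := lebesgue2_square R n.
apply/ge0_intgP; [exact: measurable_indic|by []|].
by rewrite integral_indic// setIT.
Qed.

Lemma tame_bump2 a b c d k n : a <= b -> c <= d -> - n%:R <= a -> b <= n%:R ->
  - n%:R <= c -> d <= n%:R -> tame (bump2 a b c d k).
Proof.
move=> ab cd na bn nc dn.
have cb : continuous (bump2 a b c d k).
  move=> x; apply: (@continuousM _ _ (fun x : R * R => bump a b k x.1) (fun x => bump c d k x.2)).
    by apply: (@continuous_comp _ _ _ fst (bump a b k)); [exact: cvg_fst|exact: continuous_bump].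
  by apply: (@continuous_comp _ _ _ snd (bump c d k)); [exact: cvg_snd|exact: continuous_bump].
split=> //; last first.
  exists 1 => x; rewrite ger0_norm ?bump2_ge0//.
  by rewrite -[leRHS](mulr1 1) ler_pM ?bump_ge0 ?bump_le1.
apply: (@intg_le _ _ _ mu2 _ (\1_(@square R n))); last exact: intg_square.
  apply: measurable_funM.
    apply: (@measurableT_comp _ _ _ _ _ _ (bump a b k)); last exact: measurable_fst.
    exact: continuous_measurable_fun (@continuous_bump a b k).
  apply: (@measurableT_comp _ _ _ _ _ _ (bump c d k)); last exact: measurable_snd.
  exact: continuous_measurable_fun (@continuous_bump c d k).
by move=> x; rewrite ger0_norm ?bump2_ge0//; exact: bump2_le.
Qed.

Section uniqueness.
Variable w : R * R -> R.
Hypothesis w_loc : forall n, intg mu2 (fun x => w x * \1_(@square R n) x).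
Hypothesis w_test : forall phi, tame phi ->
  (exists n, forall x, `|phi x| <= \1_(@square R n) x) -> integ mu2 (fun x => w x * phi x) = 0.

Let rect (a b c d : R) x : R := \1_(`]a, b[%classic) x.1 * \1_(`]c, d[%classic) x.2.

Let rect0 a b c d n : a <= b -> c <= d -> - n%:R <= a -> b <= n%:R ->
  - n%:R <= c -> d <= n%:R ->
  intg mu2 (fun x => w x * rect a b c d x) /\ integ mu2 (fun x => w x * rect a b c d x) = 0.
Proof.
move=> ab cd na bn nc dn.
have tb k := tame_bump2 k ab cd na bn nc dn.
have le k x := bump2_le k x ab cd na bn nc dn.
have i1 := w_loc n.
(* [w] is known to be measurable only after truncation; the support of the bump allows the indicator
   of the square to be inserted. *)
have wE k : (fun x => w x * bump2 a b c d k x) =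
    (fun x => bump2 a b c d k x * (w x * \1_(@square R n) x)).
  apply/funext => x; have := le k x; have := bump2_ge0 a b c d k x.
  rewrite indicE; case: (_ \in _) => /=; first by rewrite mulr1 mulrC.
  move=> h1 h2; have -> : bump2 a b c d k x = 0 by apply/eqP; rewrite eq_le h2.
  by rewrite mulr0 mul0r.
have [] := @dct _ _ _ mu2 (fun k x => w x * bump2 a b c d k x) (fun x => w x * rect a b c d x)
  (fun x => `|w x * \1_(@square R n) x|).
- move=> k; rewrite wE; apply: measurable_funM; last exact: intg_meas i1.
  by have [h _ _] := tb k; exact: intg_meas h.
- move=> k x; rewrite normrM [leRHS]normrM ler_wpM2l// (ger0_norm (bump2_ge0 _ _ _ _ _ _)).
  exact: le_trans (le k x) (ler_norm _).
- exact: intg_norm.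
- move=> x; apply: cvgM; first exact: cvg_cst.
  by apply: cvgM; exact: cvg_bump.
move=> hi; rewrite (_ : (fun k => _) = fun=> 0); last first.
  apply/funext => k; apply: w_test => //; exists n => x.
  by rewrite ger0_norm ?bump2_ge0.
by move=> h; split=> //; apply/esym/(cvg_unique _ (cvg_cst 0) h).
Qed.

Let fN (n : nat) x : R := w x * rect (- n%:R) n%:R (- n%:R) n%:R x.

Let nnat (n : nat) : - n%:R <= n%:R :> R.
Proof. by have := ler0n R n; lra. Qed.

Let intg_fN n : intg mu2 (fN n).
Proof. by case: (@rect0 (- n%:R) n%:R (- n%:R) n%:R n). Qed.

(** Inside (-n, n) both the whole line and every ray have the form (a, n), so products of such sets
    cut out rectangles covered by [rect0]. The value a = n gives the empty trace of rays starting
    beyond n. *)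
Let good (n : nat) (A : set R) :=
  exists2 a, - n%:R <= a <= n%:R & A `&` `]- n%:R, n%:R[%classic = `]a, n%:R[%classic.

Let integral_good n A B : good n A -> good n B ->
  (\int[mu2]_(x in (snd @^-1` B) `&` (fst @^-1` A)) (fN n x)%:E = 0)%E.
Proof.
move=> [a /andP[na an] Aa] [b /andP[nb bn] Bb].
have [i0 e0] := rect0 an bn na (lexx _) nb (lexx _).
have -> : (\int[mu2]_(x in (snd @^-1` B) `&` (fst @^-1` A)) (fN n x)%:E =
    \int[mu2]_x (w x * rect a n%:R b n%:R x)%:E)%E; last first.
  by rewrite -integE// e0.
rewrite integral_mkcond; apply: eq_integral => x _; rewrite patchE.
have key (C : set R) (c y : R) : C `&` `]- n%:R, n%:R[%classic = `]c, n%:R[%classic ->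
    \1_(`]c, n%:R[%classic) y = \1_C y * \1_(`]- n%:R, n%:R[%classic) y :> R.
  by move=> <-; rewrite indicI.
rewrite /fN /rect (key _ _ _ Aa) (key _ _ _ Bb) !indicE.
case: ifPn => [|].
  by rewrite inE => -[h1 h2]; rewrite (@mem_set _ B x.2 h1) (@mem_set _ A x.1 h2)/= !mul1r.
rewrite notin_setE/= => h; have [h1|h1] := pselect (B x.2); last first.
  by rewrite (memNset h1)/= mul0r !mulr0.
have h2 : ~ A x.1 by move=> h2; apply: h.
by rewrite (memNset h2)/= !mul0r mulr0.
Qed.

Let goodT n : good n setT.
Proof. by exists (- n%:R); [rewrite lexx/=; exact: nnat|rewrite setTI]. Qed.

Let good_ray n (x : R) : good n `]x, +oo[%classic.
Proof.
rewrite /good; have := nnat n; move: (n%:R : R) => m hm.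
have [xm|xm] := leP x m; last first.
  exists m; first by rewrite lexx andbT; lra.
  apply/seteqP; split=> y /=; rewrite !in_itv/= ?andbT.
    by case=> h1 /andP[h2 h3]; lra.
  by move=> /andP[h1 h2]; lra.
have [xn|xn] := leP x (- m).
  exists (- m); first by rewrite lexx.
  apply/seteqP; split=> y /=; rewrite !in_itv/= ?andbT; first by case.
  by move=> /andP[h1 h2]; split; [lra|apply/andP; split].
exists x; first by apply/andP; split => //; exact: ltW.
apply/seteqP; split=> y /=; rewrite !in_itv/= ?andbT.
  by case=> h1 /andP[h2 h3]; apply/andP.
by move=> /andP[h1 h2]; split=> //; apply/andP; split => //; lra.
Qed.

Let rays := [set A : set R | exists y : R, A = `]y, +oo[%classic].

Let raysI : setI_closed rays.
Proof.
move=> _ _ [a ->] [b ->]; exists (Num.max a b).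
by apply/seteqP; split=> y /=; rewrite !in_itv/= !andbT gt_max => /andP.
Qed.

Let measurable_rays : @measurable _ (measurableTypeR R) = <<s rays >>.
Proof. exact: RGenOInfty.measurableE. Qed.

(** Bumps converge to indicators of open rectangles, so the integrals of [w] over rectangles vanish.
    Dynkin arguments pass to all measurable subsets of a square, and the two sets on which [w] has a
    given sign finish the proof. *)
Lemma tame_unique : w = (fun=> 0) %[ae mu2].
Proof.
have mfst : @measurable_fun _ _ (measurableTypeR R * measurableTypeR R)%type (measurableTypeR R) setT fst.
  exact: measurable_fst.
have msnd : @measurable_fun _ _ (measurableTypeR R * measurableTypeR R)%type (measurableTypeR R) setT snd.
  exact: measurable_snd.
have mpf (B : set (measurableTypeR R)) : measurable B -> measurable (fst @^-1` B : set (measurableTypeR R * measurableTypeR R)).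
  by move=> mB; rewrite -[X in measurable X]setTI; exact: mfst.
have mps (B : set (measurableTypeR R)) : measurable B -> measurable (snd @^-1` B : set (measurableTypeR R * measurableTypeR R)).
  by move=> mB; rewrite -[X in measurable X]setTI; exact: msnd.
have mray (y : R) : measurable (`]y, +oo[%classic : set (measurableTypeR R)) by exact: measurable_itv.
(* One coordinate is generalised at a time: arbitrary A with B still [good], then arbitrary B, and
   finally from products to measurable sets of the plane. *)
have step1 n B : measurable B -> good n B -> forall A : set (measurableTypeR R), measurable A ->
    (\int[mu2]_(x in (snd @^-1` B) `&` (fst @^-1` A)) (fN n x)%:E = 0)%E.
  move=> mB gB A mA.
  apply: (dynkin_integral_eq0 (mu := mu2) measurable_rays raysI mfst (mps _ mB) (intg_fN n)) => //.
    by have := integral_good (goodT n) gB; rewrite preimage_setT setIT.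
  by move=> _ [x ->]; apply: integral_good => //; exact: good_ray.
have step2 n (A B : set (measurableTypeR R)) : measurable A -> measurable B ->
    (\int[mu2]_(x in (fst @^-1` A) `&` (snd @^-1` B)) (fN n x)%:E = 0)%E.
  move=> mA mB.
  apply: (dynkin_integral_eq0 (mu := mu2) measurable_rays raysI msnd (mpf _ mA) (intg_fN n)) => //.
    by have := step1 n setT measurableT (goodT n) A mA; rewrite preimage_setT setTI.
  move=> _ [x ->]; rewrite setIC; apply: step1 => //; exact: good_ray.
have step3 n (S : set (measurableTypeR R * measurableTypeR R)) : measurable S ->
    (\int[mu2]_(x in S) (fN n x)%:E = 0)%E.
  move=> mS; rewrite -[S]setTI -[S in _ `&` S]preimage_id.
  apply: (dynkin_integral_eq0 (mu := mu2) (measurable_prod_measurableType _ _) _ _ _ (intg_fN n)) => //.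
  - move=> _ _ [A1 mA1 [B1 mB1 <-]] [A2 mA2 [B2 mB2 <-]].
    exists (A1 `&` A2); first exact: measurableI.
    by exists (B1 `&` B2); [exact: measurableI|rewrite setXI].
  - by have := step2 n setT setT measurableT measurableT; rewrite !preimage_setT setTI.
  - move=> _ [A mA [B mB <-]]; rewrite preimage_id setTI.
    by rewrite (_ : A `*` B = (fst @^-1` A) `&` (snd @^-1` B)); [exact: step2|].
have fN0 n : fN n = (fun=> 0) %[ae mu2].
  have mf := intg_meas (intg_fN n).
  (* On [S] and on its complement the function has constant sign and integral 0, hence vanishes
     almost everywhere on each. *)
  pose S := [set x | 0 <= fN n x].
  have mS : measurable (S : set (measurableTypeR R * measurableTypeR R)).
    have := mf measurableT `[0, +oo[%classic (measurable_itv _).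
    by rewrite setTI; congr measurable; apply/seteqP; split=> x /=; rewrite /S/= in_itv/= andbT.
  have key (P : set (measurableTypeR R * measurableTypeR R)) : measurable P ->
      intg mu2 (fun x => \1_P x * fN n x) /\ integ mu2 (fun x => \1_P x * fN n x) = 0.
    move=> mP; have i1 : intg mu2 (fun x => \1_P x * fN n x).
      apply: (@intg_mulb _ _ _ mu2 _ _ 1) (intg_fN n); first exact: measurable_indic.
      by move=> x; rewrite indicE; case: (_ \in _); rewrite ?normr1 ?normr0.
    split=> //; apply: EFin_inj; rewrite integE//; apply: etrans (step3 n P mP); rewrite [RHS]integral_mkcond.
    apply: eq_integral => x _; rewrite patchE indicE; case: (_ \in _); by rewrite ?mul1r ?mul0r.
  have [i1 e1] := key _ mS; have [i2 e2] := key _ (measurableC mS).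
  have z1 := integ_eq0 i1 _ e1.
  have z2 := integ_eq0 (intgN i2) _ (etrans (integN i2) (etrans (congr1 -%R e2) (oppr0 _))).
  have {z1} := z1 _; have {z2} := z2 _.
  move=> H1 H2; have h1 : forall x, 0 <= - (\1_(~` S) x * fN n x).
    move=> x; rewrite indicE; have [Sx|nSx] := pselect (S x).
      by rewrite memNset ?mul0r ?oppr0//= => /(_ Sx).
    rewrite mem_set// mul1r oppr_ge0; apply/ltW; rewrite ltNge; exact/negP.
  have h2 : forall x, 0 <= \1_S x * fN n x.
    move=> x; rewrite indicE; have [Sx|nSx] := pselect (S x); last by rewrite memNset ?mul0r.
    by rewrite mem_set// mul1r.
  have := H1 h1; apply: filterS2 (H2 h2) => x /= a b xT.
  have /eqP := b xT; have := a xT; rewrite oppr_eq0 !indicE in_setC.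
  by case: (_ \in _); rewrite ?mul1r ?mul0r // => _ /eqP.
have hall : \forall x \ae mu2, forall n, fN n x = 0.
  apply: (@ae_foralln _ _ _ mu2 (fun n x => fN n x = 0)) => n.
  exact/(ae_eqE mu2)/fN0.
apply/(ae_eqE mu2); have := hall; apply: filterS => x h.
(* [square n] is closed while [rect] is open, hence the step to [n.+1]. *)
have [n hn] := mem_square x; have := h n.+1.
have [] := hn n (leqnn _); rewrite /= !in_itv/= => /andP[a1 a2] /andP[a3 a4].
have n1 : (n%:R : R) < n.+1%:R by rewrite ltr_nat.
rewrite /fN /rect !indicE !mem_set /=; first by rewrite !mulr1.
- by rewrite in_itv/=; apply/andP; split; lra.
- by rewrite in_itv/=; apply/andP; split; lra.
Qed.

End uniqueness.

End tame_uniqueness.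

(** * Algebra of L2 limits *)

Section L2_convergence_algebra.
Context d (T : measurableType d) (R : realType) (mu : {measure set T -> \bar R}).
Implicit Types (f g h : T -> R) (fn gn hn : nat -> T -> R) (c : R).

Lemma squeeze0 (u v : nat -> R) : (forall n, 0 <= u n <= v n) ->
  v n @[n --> \oo] --> (0 : R) -> u n @[n --> \oo] --> (0 : R).
Proof.
move=> le v0; apply: (@squeeze_cvgr _ _ _ _ (fun=> 0) v) => //; last exact: cvg_cst.
exact: nearW.
Qed.

Lemma cvg2_le fn f (v : nat -> R) : (forall n, sq mu (fun x => fn n x - f x) <= v n) ->
  v n @[n --> \oo] --> (0 : R) -> cvg2 mu fn f.
Proof.
by move=> le; apply: squeeze0 => n; rewrite sq_ge0 le.
Qed.

Lemma cvg_lin2 (u v : nat -> R) (a b : R) : u n @[n --> \oo] --> (0 : R) ->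
  v n @[n --> \oo] --> (0 : R) -> a * u n + b * v n @[n --> \oo] --> (0 : R).
Proof.
move=> u0 v0; rewrite -[X in _ --> X](_ : a * 0 + b * 0 = 0 :> R); last by ring.
exact: cvgD (cvgM (cvg_cst a) u0) (cvgM (cvg_cst b) v0).
Qed.

Lemma cvg2_trans fn gn g : (forall n, L2f mu (fn n)) -> (forall n, L2f mu (gn n)) ->
  L2f mu g -> sq mu (fun x => fn n x - gn n x) @[n --> \oo] --> (0 : R) ->
  cvg2 mu gn g -> cvg2 mu fn g.
Proof.
move=> hf hg hg' fg gg; apply: cvg2_le (cvg_lin2 2 2 fg gg) => n.
exact: sq_triangle.
Qed.

Lemma cvg2D fn f gn g : (forall n, L2f mu (fn n)) -> (forall n, L2f mu (gn n)) ->
  L2f mu f -> L2f mu g -> cvg2 mu fn f -> cvg2 mu gn g ->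
  cvg2 mu (fun n x => fn n x + gn n x) (fun x => f x + g x).
Proof.
move=> hfn hgn hf hg ff gg; apply: cvg2_le (cvg_lin2 2 2 ff gg) => n.
apply: le_trans (sq_triangle (L2fD (hfn n) (hgn n)) (L2fD hf (hgn n)) (L2fD hf hg)) _.
have -> : sq mu (fun x => (fn n x + gn n x) - (f x + gn n x)) = sq mu (fun x => fn n x - f x).
  by apply: eq_integ => x; congr (_ ^+ 2); ring.
have -> // : sq mu (fun x => (f x + gn n x) - (f x + g x)) = sq mu (fun x => gn n x - g x).
by apply: eq_integ => x; congr (_ ^+ 2); ring.
Qed.

Lemma cvg2Z fn f c : (forall n, L2f mu (fn n)) -> L2f mu f -> cvg2 mu fn f ->
  cvg2 mu (fun n x => c * fn n x) (fun x => c * f x).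
Proof.
move=> hfn hf ff; rewrite /cvg2 -[X in _ --> X](mulr0 (c ^+ 2)).
rewrite (_ : (fun n => sq mu _) = (fun n => c ^+ 2 * sq mu (fun x => fn n x - f x))).
  exact: cvgM (cvg_cst (c ^+ 2)) ff.
by apply/funext => n; rewrite -sqZ; [apply: eq_integ => x; rewrite mulrBr|exact: L2fB].
Qed.

(** By polarisation, from the convergence of norms in [cvg2_sq]. *)
Lemma cvg2_integ2 fn f gn g : (forall n, L2f mu (fn n)) -> (forall n, L2f mu (gn n)) ->
  L2f mu f -> L2f mu g -> cvg2 mu fn f -> cvg2 mu gn g ->
  integ mu (fun x => fn n x * gn n x) @[n --> \oo] --> integ mu (fun x => f x * g x).
Proof.
move=> hfn hgn hf hg ff gg.
have pol f' g' : L2f mu f' -> L2f mu g' -> integ mu (fun x => f' x * g' x) =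
    2^-1 * (sq mu (fun x => f' x + g' x) - sq mu f' - sq mu g').
  by move=> hf' hg'; rewrite sqD//; field.
rewrite pol// (_ : (fun n => integ mu _) = (fun n =>
    2^-1 * (sq mu (fun x => fn n x + gn n x) - sq mu (fn n) - sq mu (gn n)))); last first.
  by apply/funext => n; rewrite pol.
have h1 := cvg2_sq hfn hf ff; have h2 := cvg2_sq hgn hg gg.
have h3 := cvg2_sq (fun n => L2fD (hfn n) (hgn n)) (L2fD hf hg) (cvg2D hfn hgn hf hg ff gg).
exact: cvgM (cvg_cst _) (cvgB (cvgB h3 h1) h2).
Qed.

End L2_convergence_algebra.

(** * The Hartley transform on L2: isometry, involution and inversion *)

Section hartley_L2.
Context (R : realType).
Notation mu2 := (@lebesgue2 R).
Implicit Types (f g h phi : R * R -> R).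

Definition trunc (n : nat) g (x : R * R) : R := g x * \1_(@square R n) x.

Lemma L2f_square n : L2f mu2 (\1_(@square R n) : R * R -> R).
Proof.
apply: (@L2f_bounded _ _ _ mu2 _ 1); last exact: intg_square.
by move=> x; rewrite indicE; case: (_ \in _); rewrite ?normr1 ?normr0.
Qed.

Lemma trunc_L1 n g : L2f mu2 g -> intg mu2 (trunc n g).
Proof. by move=> hg; exact: intg_mul hg (L2f_square n). Qed.

Lemma norm_trunc_le n g x : `|trunc n g x| <= `|g x|.
Proof. by rewrite /trunc indicE; case: (_ \in _); rewrite ?mulr1 ?mulr0 ?normr0. Qed.

Lemma cvg_trunc g x : trunc n g x @[n --> \oo] --> g x.
Proof.
have [n0 h] := mem_square x; apply: cvg_near_cst.
by exists n0 => // n /= n0n; rewrite /trunc indicE mem_set ?mulr1//; exact: h.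
Qed.

Lemma trunc_L2 g : L2f mu2 g -> (forall n, L2f mu2 (trunc n g)) /\ cvg2 mu2 (trunc^~ g) g.
Proof.
move=> hg.
have hn : L2f mu2 (fun x => `|g x|).
  by apply: (@L2f_le _ _ _ mu2 _ g) => //; [apply: measurableT_comp => //; exact: L2f_meas hg|
    move=> x; rewrite normr_id].
have [h1 _ h2] := @cvg2_dom _ _ _ mu2 (trunc^~ g) g (fun x => `|g x|)
  (fun n => intg_meas (trunc_L1 n hg)) (fun n => norm_trunc_le n g) hn (@cvg_trunc g).
by split.
Qed.

Lemma sq_hartB_le f g : intg mu2 f -> L2f mu2 f -> intg mu2 g -> L2f mu2 g ->
  sq mu2 (fun x => hart f x - hart g x) <= sq mu2 (fun x => f x - g x).
Proof.
move=> f1 f2 g1 g2; have [_] := hart_L2 (intgB f1 g1) (L2fB f2 g2).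
apply: le_trans; rewrite le_eqVlt; apply/orP; left; apply/eqP.
by apply: eq_integ => x; rewrite hartB.
Qed.

(** Truncations lie in L1 and L2, where [hart] is a contraction, so their transforms form a Cauchy
    sequence. The premise sits under the existential so that [HT] can be chosen as a total
    function. *)
Lemma HT_exists g : exists h, L2f mu2 g -> L2f mu2 h /\ cvg2 mu2 (fun n => hart (trunc n g)) h.
Proof.
have [hg|ng] := pselect (L2f mu2 g); last by exists g.
have [ht ct] := trunc_L2 hg.
have hh n : L2f mu2 (hart (trunc n g)) by have [] := hart_L2 (trunc_L1 n hg) (ht n).
have [|h h2 ch] := @L2_complete _ _ _ mu2 _ hh; last by exists h.
move=> e e0; have e4 : 0 < e / 4 by rewrite divr_gt0.
have := ct; move=> /cvgrPdist_le /(_ _ e4) [N _ hN]; exists N => m n Nm Nn.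
apply: le_trans (sq_hartB_le (trunc_L1 m hg) (ht m) (trunc_L1 n hg) (ht n)) _.
apply: le_trans (sq_triangle (ht m) hg (ht n)) _; rewrite [X in _ + _ * X <= _]sqBC.
have := hN m Nm; have := hN n Nn; rewrite !sub0r !normrN.
by rewrite !ger0_norm ?sq_ge0//; lra.
Qed.

Definition HT g : R * R -> R := projT1 (cid (HT_exists g)).

Lemma HT_spec g : L2f mu2 g -> L2f mu2 (HT g) /\ cvg2 mu2 (fun n => hart (trunc n g)) (HT g).
Proof. exact: (projT2 (cid (HT_exists g))). Qed.

Lemma HT_L2 g : L2f mu2 g -> L2f mu2 (HT g). Proof. by case/HT_spec. Qed.

(** Independence of the approximating sequence: sums, multiples and reflections of truncations may
    replace truncations of the result. *)
Lemma HT_lim fn g : (forall n, intg mu2 (fn n)) -> (forall n, L2f mu2 (fn n)) ->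
  L2f mu2 g -> cvg2 mu2 fn g -> cvg2 mu2 (fun n => hart (fn n)) (HT g).
Proof.
move=> f1 f2 hg cf; have [hH cH] := HT_spec hg; have [ht ct] := trunc_L2 hg.
have hh n : L2f mu2 (hart (trunc n g)) by have [] := hart_L2 (trunc_L1 n hg) (ht n).
have hf n : L2f mu2 (hart (fn n)) by have [] := hart_L2 (f1 n) (f2 n).
apply: (cvg2_trans hf hh hH _ cH).
apply: squeeze0 (cvg_lin2 2 2 cf ct) => n; rewrite sq_ge0/=.
apply: le_trans (sq_hartB_le (f1 n) (f2 n) (trunc_L1 n hg) (ht n)) _.
by apply: le_trans (sq_triangle (f2 n) hg (ht n)) _; rewrite [X in _ + _ * X <= _]sqBC.
Qed.

Lemma HT_hart g : intg mu2 g -> L2f mu2 g -> HT g = hart g %[ae mu2].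
Proof.
move=> g1 g2; have [h2 _] := hart_L2 g1 g2.
apply: (@cvg2_unique _ _ _ mu2 (fun=> hart g)) => //; first exact: HT_L2.
  apply: (@HT_lim (fun=> g)) => //.
  rewrite /cvg2 (_ : sq _ _ = 0); first exact: cvg_cst.
  by rewrite -[RHS](integ0 mu2); apply: eq_integ => x; rewrite subrr expr0n.
rewrite /cvg2 (_ : sq _ _ = 0); first exact: cvg_cst.
by rewrite -[RHS](integ0 mu2); apply: eq_integ => x; rewrite subrr expr0n.
Qed.

Lemma sq_HT_le g : L2f mu2 g -> sq mu2 (HT g) <= sq mu2 g.
Proof.
move=> hg; have [hH cH] := HT_spec hg; have [ht ct] := trunc_L2 hg.
have hh n : L2f mu2 (hart (trunc n g)) by have [] := hart_L2 (trunc_L1 n hg) (ht n).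
have h1 := cvg2_sq hh hH cH; have h2 := cvg2_sq ht hg ct.
rewrite -(cvg_lim _ h1)// -(cvg_lim _ h2)//; apply: ler_lim.
- exact: (cvgP _ h1).
- exact: (cvgP _ h2).
by apply: nearW => n; have [] := hart_L2 (trunc_L1 n hg) (ht n).
Qed.

Lemma HTD f g : L2f mu2 f -> L2f mu2 g ->
  HT (fun x => f x + g x) = (fun x => HT f x + HT g x) %[ae mu2].
Proof.
move=> hf hg; have [ff cf] := trunc_L2 hf; have [gg cg] := trunc_L2 hg.
have f1 n := trunc_L1 n hf; have g1 n := trunc_L1 n hg.
have hff n : L2f mu2 (hart (trunc n f)) by have [] := hart_L2 (f1 n) (ff n).
have hgg n : L2f mu2 (hart (trunc n g)) by have [] := hart_L2 (g1 n) (gg n).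
apply: (@cvg2_unique _ _ _ mu2 (fun n => hart (fun x => trunc n f x + trunc n g x))).
- by move=> n; have [] := hart_L2 (intgD (f1 n) (g1 n)) (L2fD (ff n) (gg n)).
- exact/HT_L2/L2fD.
- by apply: L2fD; exact: HT_L2.
- apply: HT_lim; [by move=> n; exact: intgD|by move=> n; exact: L2fD|exact: L2fD|].
  exact: cvg2D.
have [f3 f4] := HT_spec hf; have [g3 g4] := HT_spec hg.
have -> : (fun n => hart (fun x => trunc n f x + trunc n g x)) =
    (fun n x => hart (trunc n f) x + hart (trunc n g) x).
  by apply/funext => n; apply/funext => x; rewrite hartD.
exact: (cvg2D hff hgg f3 g3 f4 g4).
Qed.

Lemma HTZ c g : L2f mu2 g -> HT (fun x => c * g x) = (fun x => c * HT g x) %[ae mu2].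
Proof.
move=> hg; have [gg cg] := trunc_L2 hg; have g1 n := trunc_L1 n hg.
have hgg n : L2f mu2 (hart (trunc n g)) by have [] := hart_L2 (g1 n) (gg n).
apply: (@cvg2_unique _ _ _ mu2 (fun n => hart (fun x => c * trunc n g x))).
- by move=> n; have [] := hart_L2 (intgZ c (g1 n)) (L2fZ c (gg n)).
- exact/HT_L2/L2fZ.
- by apply: L2fZ; exact: HT_L2.
- apply: HT_lim; [by move=> n; exact: intgZ|by move=> n; exact: L2fZ|exact: L2fZ|].
  exact: cvg2Z.
have [g3 g4] := HT_spec hg.
have -> : (fun n => hart (fun x => c * trunc n g x)) = (fun n x => c * hart (trunc n g) x).
  by apply/funext => n; apply/funext => x; rewrite hartZ.
exact: (cvg2Z c hgg g3 g4).
Qed.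

Lemma HT_mul f g : L2f mu2 f -> L2f mu2 g ->
  integ mu2 (fun x => HT f x * g x) = integ mu2 (fun x => f x * HT g x).
Proof.
move=> hf hg; have [ff cf] := trunc_L2 hf; have [gg cg] := trunc_L2 hg.
have f1 n := trunc_L1 n hf; have g1 n := trunc_L1 n hg.
have hff n : L2f mu2 (hart (trunc n f)) by have [] := hart_L2 (f1 n) (ff n).
have hgg n : L2f mu2 (hart (trunc n g)) by have [] := hart_L2 (g1 n) (gg n).
have [f3 f4] := HT_spec hf; have [g3 g4] := HT_spec hg.
have h1 := cvg2_integ2 hff gg f3 hg f4 cg.
have h2 := cvg2_integ2 ff hgg hf g3 cf g4.
have e : (fun n => integ mu2 (fun x => hart (trunc n f) x * trunc n g x)) =
    (fun n => integ mu2 (fun x => trunc n f x * hart (trunc n g) x)).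
  by apply/funext => n; exact: hart_mul.
by rewrite e in h1; rewrite -(cvg_lim _ h1)//; exact: cvg_lim h2.
Qed.

(** In the expansion of |HT HT phi - phi|^2 the mixed term is -2 |HT phi|^2 by symmetry, which is -2
    |phi|^2 by the isometry on tame functions. The contraction property bounds |HT HT phi|^2 by
    |phi|^2, so the sum is at most 0. *)
Lemma HTK_tame phi : tame phi -> HT (HT phi) = phi %[ae mu2].
Proof.
move=> tphi; have hp := tame_L2f tphi; have [p1 _ _] := tphi.
have hH := HT_L2 hp; have hHH := HT_L2 hH.
have e : sq mu2 (HT phi) = sq mu2 phi.
  rewrite -(sq_hart_tame tphi); apply: ae_sq.
  - exact: L2f_meas hH.
  - by have [/L2f_meas] := hart_L2 p1 hp.
  - exact: HT_hart.
apply: (sq_sub_eq0 hHH hp); apply/eqP; rewrite eq_le sq_ge0 andbT (sqB hHH hp) (HT_mul hH hp).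
have -> : integ mu2 (fun x => HT phi x * HT phi x) = sq mu2 (HT phi) by exact: eq_integ.
have := sq_HT_le hH; rewrite e; move: (sq mu2 (HT (HT phi))) (sq mu2 phi) => A B AB; lra.
Qed.

Lemma intg_trunc g n : L2f mu2 g -> intg mu2 (fun x => g x * \1_(@square R n) x).
Proof. exact: trunc_L1. Qed.

Lemma ae_integ_mul f g h : L2f mu2 f -> L2f mu2 g -> L2f mu2 h -> f = g %[ae mu2] ->
  integ mu2 (fun x => h x * f x) = integ mu2 (fun x => h x * g x).
Proof.
move=> hf hg hh fg; apply: ae_integ; [exact: intg_meas (intg_mul hh hf)|exact: intg_meas (intg_mul hh hg)|].
by have := fg; apply: filterS => x e /e ->.
Qed.

(** Symmetry moves both transforms onto a tame test function, where [HTK_tame] applies;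
    [tame_unique] turns the equality of all these integrals into equality almost everywhere. *)
Lemma HTK g : L2f mu2 g -> HT (HT g) = g %[ae mu2].
Proof.
move=> hg; have hH := HT_L2 hg; have hHH := HT_L2 hH; have hw := L2fB hHH hg.
have : (fun x => HT (HT g) x - g x) = (fun=> 0) %[ae mu2].
  apply: tame_unique => [n|phi tphi _]; first exact: intg_trunc.
  have hp := tame_L2f tphi.
  transitivity (integ mu2 (fun x => HT (HT g) x * phi x) - integ mu2 (fun x => g x * phi x)).
    by rewrite -integB; [apply: eq_integ => x; rewrite mulrBl|exact: intg_mul|exact: intg_mul].
  rewrite HT_mul// HT_mul//; last exact: HT_L2.
  rewrite (ae_integ_mul _ hp hg (HTK_tame tphi)) ?subrr//.
  by do 2 apply: HT_L2.
by apply: filterS => x h /h /eqP; rewrite subr_eq0 => /eqP.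
Qed.

Lemma sq_HT g : L2f mu2 g -> sq mu2 (HT g) = sq mu2 g.
Proof.
move=> hg; have hH := HT_L2 hg; have hHH := HT_L2 hH.
apply/eqP; rewrite eq_le sq_HT_le//=.
rewrite -(ae_sq (L2f_meas hHH) (L2f_meas hg) (HTK hg)); exact: sq_HT_le.
Qed.

Lemma integ_HT_HT f g : L2f mu2 f -> L2f mu2 g ->
  integ mu2 (fun x => HT f x * HT g x) = integ mu2 (fun x => f x * g x).
Proof.
move=> hf hg; have hH := HT_L2 hg; have hHH := HT_L2 hH.
by rewrite HT_mul//; apply: ae_integ_mul => //; exact: HTK.
Qed.

Lemma HTB f g : L2f mu2 f -> L2f mu2 g ->
  HT (fun x => f x - g x) = (fun x => HT f x - HT g x) %[ae mu2].
Proof.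
move=> hf hg; have := HTD hf (L2fZ (-1) hg); have := HTZ (-1) hg.
apply: filterS2 => x /= h1 h2 xT; have := h2 xT; rewrite h1// mulN1r.
by rewrite (_ : (fun x => f x + -1 * g x) = (fun x => f x - g x))//; apply/funext => y; rewrite mulN1r.
Qed.

(** [V] is not assumed to be in L2, so [HTK] does not apply to it. Against a tame phi, the integral
    of V times the Poisson mean of phi equals that of hart V times the damped hart phi. Letting the
    scale tend to 0 on both sides, and moving the transform back by symmetry, yields the claim in
    tested form. *)
Lemma hart_L1_inv (V : R * R -> R) : intg mu2 V -> L2f mu2 (hart V) -> V = HT (hart V) %[ae mu2].
Proof.
move=> V1 hV2; have hH := HT_L2 hV2.
have : (fun x => V x - HT (hart V) x) = (fun=> 0) %[ae mu2].
  apply: tame_unique => [n|phi tphi _].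
    have i1 : intg mu2 (fun x => \1_(@square R n) x * V x).
      apply: (@intg_mulb _ _ _ mu2 _ _ 1) V1; first exact: L2f_meas (L2f_square n).
      by move=> x; rewrite indicE; case: (_ \in _); rewrite ?normr1 ?normr0.
    by have := intgB i1 (intg_trunc n hH); apply: eq_intg => x; ring.
  have hp := tame_L2f tphi; have [p1 _ [M hM]] := tphi; have [hp2 _] := hart_L2 p1 hp.
  have i1 : intg mu2 (fun x => V x * phi x).
    by have := @intg_mulb _ _ _ mu2 _ _ M (intg_meas p1) hM V1; apply: eq_intg => x; rewrite mulrC.
  transitivity (integ mu2 (fun x => V x * phi x) - integ mu2 (fun x => HT (hart V) x * phi x)).
    by rewrite -integB//; [apply: eq_integ => x; rewrite mulrBl|exact: intg_mul].
  have [bs cs] := poisson_mean_tame tphi hM.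
  have M0 : 0 <= M by exact: le_trans (hM (0, 0)).
  have iw n := intg_expw_hart (lt0r_neq0 (invS_gt0 R n)) p1.
  have e n : integ mu2 (fun x => hart V x * (expw n.+1%:R^-1 x * hart phi x)) =
      integ mu2 (fun x => V x * poisson_mean n.+1%:R^-1 phi x).
    by rewrite hart_mul//; apply: eq_integ => x; rewrite hart_expw_hart ?invS_gt0.
  have ms n : measurable_fun setT (fun x => V x * poisson_mean n.+1%:R^-1 phi x).
    apply: measurable_funM; first exact: intg_meas V1.
    have := measurable_hart (iw n); apply: eq_measurable_fun => x _.
    by rewrite hart_expw_hart ?invS_gt0.
  have [_ l1] := @dct _ _ _ mu2 (fun n x => V x * poisson_mean n.+1%:R^-1 phi x) (fun x => V x * phi x)
    (fun x => M * `|V x|) ms (fun n x => ltac:(rewrite normrM mulrC; exact: ler_wpM2r))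
    (intgZ M (intg_norm V1)) (fun x => cvgM (cvg_cst _) (cs x)).
  have b2 n x : `|hart V x * (expw n.+1%:R^-1 x * hart phi x)| <= `|hart V x * hart phi x|.
    by rewrite mulrCA normrM (ger0_norm (ltW (expw_gt0 _ _))) ler_piMl// expw_le1.
  have c2 x : hart V x * (expw n.+1%:R^-1 x * hart phi x) @[n --> \oo] --> hart V x * hart phi x.
    have h : expw n.+1%:R^-1 x @[n --> \oo] --> (1 : R) by apply: cvg_expw; exact: cvg_invS.
    rewrite -[X in _ --> X](_ : hart V x * (1 * hart phi x) = _); last by rewrite mul1r.
    exact: cvgM (cvg_cst _) (cvgM h (cvg_cst _)).
  have [_ l2] := @dct _ _ _ mu2 (fun n x => hart V x * (expw n.+1%:R^-1 x * hart phi x))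
    (fun x => hart V x * hart phi x) (fun x => `|hart V x * hart phi x|)
    (fun n => measurable_funM (L2f_meas hV2) (intg_meas (iw n)))
    b2
    (intg_norm (intg_mul hV2 hp2))
    c2.
  have -> : integ mu2 (fun x => V x * phi x) = integ mu2 (fun x => hart V x * hart phi x).
    have e' := funext e; rewrite e' in l2.
    by rewrite -(cvg_lim _ l1)//; exact: cvg_lim l2.
  rewrite HT_mul// (ae_integ_mul (HT_L2 hp) hp2 hV2) ?subrr//; exact: HT_hart.
by apply: filterS => x h /h /eqP; rewrite subr_eq0 => /eqP.
Qed.

End hartley_L2.

(** * The convolution theorem in Hartley form *)

Section convolution.
Context (R : realType).
Notation mu2 := (@lebesgue2 R).
Implicit Types (f g h k u v w a b : R * R -> R) (x y xi : R * R).

Lemma affN1 x y : aff (-1) x y = x - y.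
Proof. by rewrite /aff !mulN1r ![- _ + _]addrC. Qed.

Lemma intg_refl x g : intg mu2 g -> intg mu2 (fun y => g (x - y)) /\
  integ mu2 (fun y => g (x - y)) = integ mu2 g.
Proof.
move=> hg; have [] := integ_aff x (_ : (-1 : R) != 0) hg; first by rewrite oppr_eq0 oner_eq0.
rewrite sqrrN expr1n invr1 mul1r => h1 h2; split.
  by move: h1; apply: eq_intg => y; rewrite affN1.
by rewrite -h2; apply: eq_integ => y; rewrite affN1.
Qed.

Lemma L2f_refl x g : L2f mu2 g -> L2f mu2 (fun y => g (x - y)).
Proof.
move=> [mg g2]; have [i _] := intg_refl x g2; split=> //.
have h := measurableT_comp mg (@measurable_aff R (-1) x).
by move: h; apply: eq_measurable_fun => y _; rewrite /= affN1.
Qed.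

Lemma sq_refl x g : L2f mu2 g -> sq mu2 (fun y => g (x - y)) = sq mu2 g.
Proof. by move=> [_ g2]; exact: (proj2 (intg_refl x g2)). Qed.

Lemma intg_opp g : intg mu2 g -> intg mu2 (fun y => g (- y)) /\
  integ mu2 (fun y => g (- y)) = integ mu2 g.
Proof.
move=> hg; have [h1 h2] := intg_refl 0 hg; split.
  by move: h1; apply: eq_intg => y; rewrite sub0r.
by rewrite -h2; apply: eq_integ => y; rewrite sub0r.
Qed.

Lemma L2f_opp g : L2f mu2 g -> L2f mu2 (fun y => g (- y)).
Proof. by move=> hg; have := L2f_refl 0 hg; apply: eq_L2f => y; rewrite sub0r. Qed.

Lemma sq_opp g : L2f mu2 g -> sq mu2 (fun y => g (- y)) = sq mu2 g.
Proof. by move=> hg; rewrite -(sq_refl 0 hg); apply: eq_integ => y; rewrite sub0r. Qed.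

Lemma integ_odd g : intg mu2 g -> (forall x, g (- x) = - g x) -> integ mu2 g = 0.
Proof.
move=> hg gN; have [_] := intg_opp hg.
have -> : integ mu2 (fun y => g (- y)) = - integ mu2 g by rewrite -integN//; exact: eq_integ.
by move=> h; lra.
Qed.

Definition cosw x xi : R := cos (2 * pi * dot2 x xi).
Definition sinw x xi : R := sin (2 * pi * dot2 x xi).

Lemma dot2N x xi : dot2 x (- xi) = - dot2 x xi.
Proof. by rewrite /dot2/=; ring. Qed.

Lemma coswN x xi : cosw x (- xi) = cosw x xi.
Proof. by rewrite /cosw dot2N mulrN cosN. Qed.

Lemma sinwN x xi : sinw x (- xi) = - sinw x xi.
Proof. by rewrite /sinw dot2N mulrN sinN. Qed.

Lemma norm_cosw_le x xi : `|cosw x xi| <= 1.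
Proof. by rewrite ler_norml cos_geN1 cos_le1. Qed.

Lemma norm_sinw_le x xi : `|sinw x xi| <= 1.
Proof. by rewrite ler_norml sin_geN1 sin_le1. Qed.

Lemma measurable_dot2l x : measurable_fun setT (fun xi => 2 * pi * dot2 x xi).
Proof.
apply: measurable_funM => //; apply: measurable_funD; apply: measurable_funM => //.
Qed.

Lemma measurable_cosw x : measurable_fun setT (cosw x).
Proof.
apply: (measurableT_comp _ (@measurable_dot2l x)).
exact: continuous_measurable_fun (@continuous_cos R).
Qed.

Lemma measurable_sinw x : measurable_fun setT (sinw x).
Proof.
apply: (measurableT_comp _ (@measurable_dot2l x)).
exact: continuous_measurable_fun (@continuous_sin R).
Qed.

Lemma L2f_cosw x g : L2f mu2 g -> L2f mu2 (fun xi => cosw x xi * g xi).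
Proof. by apply: (@L2f_mulb _ _ _ mu2 _ _ 1); [exact: measurable_cosw|exact: norm_cosw_le]. Qed.

Lemma L2f_sinw x g : L2f mu2 g -> L2f mu2 (fun xi => sinw x xi * g xi).
Proof. by apply: (@L2f_mulb _ _ _ mu2 _ _ 1); [exact: measurable_sinw|exact: norm_sinw_le]. Qed.

(** The substitution z = x - y and the addition formula cas (s - t) = cos s cas (-t) + sin s cas
    t. *)
Lemma hart_refl x g xi : intg mu2 g ->
  hart (fun y => g (x - y)) xi = cosw x xi * hart g (- xi) + sinw x xi * hart g xi.
Proof.
move=> hg; rewrite /hart.
have i1 := intg_hart xi hg; have i2 := intg_hart (- xi) hg.
have e z : g z * ker (x - z, xi) =
    cosw x xi * (g z * ker (z, - xi)) + sinw x xi * (g z * ker (z, xi)).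
  rewrite /ker/= /cas dot2N mulrN cosN sinN /cosw /sinw.
  rewrite (_ : 2 * pi * dot2 (x - z) xi = 2 * pi * dot2 x xi - 2 * pi * dot2 z xi); last first.
    by rewrite /dot2/=; ring.
  by rewrite cosB sinB; ring.
rewrite -!integZ// -integD; [|exact: intgZ|exact: intgZ].
have hF : intg mu2 (fun z => g z * ker (x - z, xi)).
  by have := intgD (intgZ (cosw x xi) i2) (intgZ (sinw x xi) i1); apply: eq_intg.
transitivity (integ mu2 (fun z => g z * ker (x - z, xi))); last exact: eq_integ.
by rewrite -(proj2 (intg_refl x hF)); apply: eq_integ => y; rewrite subKr.
Qed.

Lemma cvg2_mulb (m : R * R -> R) (fn : nat -> R * R -> R) g : measurable_fun setT m ->
  (forall x, `|m x| <= 1) -> (forall n, L2f mu2 (fn n)) -> L2f mu2 g -> cvg2 mu2 fn g ->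
  cvg2 mu2 (fun n x => m x * fn n x) (fun x => m x * g x).
Proof.
move=> mm m1 hf hg fg; apply: cvg2_le fg => n.
have [ma i1] := @L2f_mulb _ _ _ mu2 _ _ 1 mm m1 (L2fB (hf n) hg); have [_ i2] := L2fB (hf n) hg.
have -> : sq mu2 (fun x => m x * fn n x - m x * g x) = sq mu2 (fun x => m x * (fn n x - g x)).
  by apply: eq_integ => x; rewrite mulrBr.
apply: le_integ => // x; rewrite exprMn ler_piMl ?sqr_ge0//.
by rewrite -real_normK ?num_real// expr_le1.
Qed.

Lemma HT_refl x g : L2f mu2 g -> HT (fun y => g (x - y)) =
  (fun xi => cosw x xi * HT g (- xi) + sinw x xi * HT g xi) %[ae mu2].
Proof.
move=> hg; have [gg cg] := trunc_L2 hg; have g1 n := trunc_L1 n hg.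
have hgg n : L2f mu2 (hart (trunc n g)) by have [] := hart_L2 (g1 n) (gg n).
have [g3 g4] := HT_spec hg.
apply: (@cvg2_unique _ _ _ mu2 (fun n => hart (fun y => trunc n g (x - y)))).
- by move=> n; have [] := hart_L2 (proj1 (intg_refl x (g1 n))) (L2f_refl x (gg n)).
- exact/HT_L2/L2f_refl.
- by apply: L2fD; [apply: L2f_cosw; exact: L2f_opp|exact: L2f_sinw].
- apply: HT_lim; [by move=> n; have [] := intg_refl x (g1 n)|by move=> n; exact: L2f_refl|exact: L2f_refl|].
  apply: cvg2_le cg => n.
  by rewrite -(sq_refl x (L2fB (gg n) hg)).
have hop n := L2f_opp (hgg n).
have cop : cvg2 mu2 (fun n y => hart (trunc n g) (- y)) (fun y => HT g (- y)).
  apply: cvg2_le g4 => n.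
  by rewrite -(sq_opp (L2fB (hgg n) g3)).
have c1 := cvg2_mulb (measurable_cosw x) (norm_cosw_le x) hop (L2f_opp g3) cop.
have c2 := cvg2_mulb (measurable_sinw x) (norm_sinw_le x) hgg g3 g4.
have := cvg2D (fun n => L2f_cosw x (hop n)) (fun n => L2f_sinw x (hgg n))
  (L2f_cosw x (L2f_opp g3)) (L2f_sinw x g3) c1 c2.
congr (cvg2 _ _ _); apply/funext => n; apply/funext => xi.
by rewrite hart_refl.
Qed.

(* If a and b are the Hartley transforms of real functions k and u, whose Fourier transforms are
   the even part minus i times the odd part, this is the Hartley counterpart of the product of
   these Fourier transforms. *)
Definition hprod a b xi : R :=
  (a xi * b xi + a xi * b (- xi) + a (- xi) * b xi - a (- xi) * b (- xi)) / 2.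

Lemma intg_hprod a b : L2f mu2 a -> L2f mu2 b -> intg mu2 (hprod a b).
Proof.
move=> ha hb; have ha' := L2f_opp ha; have hb' := L2f_opp hb.
have := intgZ (2^-1) (intgB (intgD (intgD (intg_mul ha hb) (intg_mul ha hb')) (intg_mul ha' hb))
  (intg_mul ha' hb')).
by apply: eq_intg => x; rewrite mulrC.
Qed.

Lemma convolution_hart k u : L2f mu2 k -> L2f mu2 u ->
  convolution k u = hart (hprod (HT k) (HT u)).
Proof.
move=> hk hu; apply/funext => x.
have hk' := HT_L2 hk; have hu' := HT_L2 hu; have hr := L2f_refl x hu.
have hl : L2f mu2 (fun xi => cosw x xi * HT u (- xi) + sinw x xi * HT u xi).
  by apply: L2fD; [apply: L2f_cosw; exact: L2f_opp|exact: L2f_sinw].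
rewrite /convolution RintegralE.
rewrite -(integ_HT_HT hk hr) (ae_integ_mul (HT_L2 hr) hl hk' (HT_refl x hu)) /hart.
have i1 := intg_mul hk' hl; have i2 := intg_hart x (intg_hprod hk' hu').
(* The two integrands are not equal pointwise; their difference is odd in xi, so the integrals
   agree. *)
apply/eqP; rewrite -subr_eq0 -integB//; apply/eqP; apply: integ_odd; first exact: intgB.
move=> xi; rewrite /hprod /ker/= ![dot2 _ x]dot2C dot2N mulrN coswN sinwN opprK /cas cosN sinN.
by rewrite /cosw /sinw; field.
Qed.

(** [hart V] is in L2 exactly when [V] is: by [hart_L1_inv] in one direction and by the contraction
    property in the other. If neither is, both integrals are infinite, since f and HT f are
    square-integrable. *)
Lemma integral_sq_plancherel f V : L2f mu2 f -> intg mu2 V ->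
  (\int[mu2]_x ((f x - hart V x) ^+ 2)%:E = \int[mu2]_x ((HT f x - V x) ^+ 2)%:E)%E.
Proof.
move=> hf V1; have mh := measurable_hart V1; have mV := intg_meas V1.
have hHf := HT_L2 hf.
have L2P w : measurable_fun setT w -> (\int[mu2]_x ((w x) ^+ 2)%:E < +oo)%E -> L2f mu2 w.
  move=> mw h; split=> //; apply/ge0_intgP => //; first exact: measurable_funX.
  by move=> x; exact: sqr_ge0.
have [h2|h2] := pselect (L2f mu2 (hart V)).
  have e := hart_L1_inv V1 h2; have hH := HT_L2 h2.
  have V2 : L2f mu2 V by apply: ae_L2f hH => //; have := e; apply: filterS => x h /h.
  have i1 := L2fB hf h2; have i2 := L2fB hHf V2.
  rewrite -(integE (proj2 i1)) -(integE (proj2 i2)); congr EFin.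
  rewrite -/(sq mu2 (fun x => f x - hart V x)) -/(sq mu2 (fun x => HT f x - V x)).
  rewrite -(sq_HT i1); apply: ae_sq; [exact: L2f_meas (HT_L2 i1)|exact: L2f_meas i2|].
  have := HTB hf h2; have := e; apply: filterS2 => x a b xT.
  by rewrite b// -a.
have nV : ~ L2f mu2 V by move=> V2; apply: h2; have [] := hart_L2 V1 V2.
have m1 : measurable_fun setT (fun x => f x - hart V x).
  by apply: measurable_funB => //; exact: L2f_meas hf.
have m2 : measurable_fun setT (fun x => HT f x - V x).
  by apply: measurable_funB => //; exact: L2f_meas hHf.
transitivity (+oo : \bar R)%E.
  apply/eqP; rewrite -leye_eq leNgt; apply/negP => h.
  apply: h2; have := L2fB hf (L2P _ m1 h); apply: eq_L2f => x; ring.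
apply/esym/eqP; rewrite -leye_eq leNgt; apply/negP => h.
apply: nV; have := L2fB hHf (L2P _ m2 h); apply: eq_L2f => x; ring.
Qed.

Lemma convolution_plancherel f k u : L2f mu2 f -> L2f mu2 k -> L2f mu2 u ->
  (\int[mu2]_x ((f x - convolution k u x) ^+ 2)%:E =
   \int[mu2]_x ((HT f x - hprod (HT k) (HT u) x) ^+ 2)%:E)%E.
Proof.
move=> hf hk hu; rewrite convolution_hart//; apply: integral_sq_plancherel => //.
by apply: intg_hprod; exact: HT_L2.
Qed.

End convolution.

Local Open Scope complex_scope.

(** * Passage from [Lnorm] and complex norms to squared integrals *)

Section L2_norms.
Context (R : realType).
Notation mu2 := (@lebesgue2 R).
Implicit Types (u w a b : R * R -> R) (g h : R * R -> R[i]).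

Lemma integral_sqr_ge0 w : (0 <= \int[mu2]_x ((w x) ^+ 2)%:E)%E.
Proof. by apply: integral_ge0 => x _; rewrite lee_fin sqr_ge0. Qed.

Lemma L2norm_def w : L2norm w = ((\int[mu2]_x ((w x) ^+ 2)%:E) `^ 2^-1)%E.
Proof.
have e x : (`|(w x)%:E| `^ 2 = ((w x) ^+ 2)%:E)%E.
  by rewrite abse_EFin poweR_EFin powR_mulrn// real_normK ?num_real.
rewrite /L2norm Lnorm.unlock; congr poweR.
by apply: eq_integral => x _; rewrite -e.
Qed.

Lemma sqr_L2norm w : (L2norm w ^+ 2 = \int[mu2]_x ((w x) ^+ 2)%:E)%E.
Proof.
rewrite L2norm_def; have := integral_sqr_ge0 w.
case: (\int[mu2]_x _)%E => [r| |] //.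
  rewrite lee_fin => r0; rewrite poweR_EFin powR12_sqrt// -EFin_expe.
  by rewrite sqr_sqrtr.
by move=> _; rewrite poweRyr ?invr_eq0// expe2 mulyy.
Qed.

Lemma L2norm_fin w : L2f mu2 w -> L2norm w = (Num.sqrt (sq mu2 w))%:E.
Proof.
by move=> [_ w2]; rewrite L2norm_def -(integE w2) poweR_EFin powR12_sqrt// sq_ge0.
Qed.

Lemma inL2P w : inL2 w <-> L2f mu2 w.
Proof.
have key : finite_norm mu2 2%:E w <-> (\int[mu2]_x ((w x) ^+ 2)%:E < +oo)%E.
  rewrite /finite_norm -/(L2norm w) L2norm_def; split; last exact: poweR_lty.
  by apply: lty_poweRy; rewrite invr_eq0.
rewrite /inL2 /Lfun inE /= /finLfun /mfun; split.
  move=> /andP[/set_mem mw /set_mem/key fw].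
  split=> //; apply/ge0_intgP => //; first exact: measurable_funX.
  by move=> x; exact: sqr_ge0.
move=> [mw /ge0_intgP H]; apply/andP; split; apply/mem_set => //=.
apply/key; apply: H; first exact: measurable_funX.
by move=> x; exact: sqr_ge0.
Qed.

Lemma normc_sqr (z : R[i]) : Normc.normc z ^+ 2 = complex.Re z ^+ 2 + complex.Im z ^+ 2.
Proof. by case: z => x y /=; rewrite sqr_sqrtr// addr_ge0 ?sqr_ge0. Qed.

Lemma normc_ge0 (z : R[i]) : 0 <= Normc.normc z.
Proof. by case: z => x y /=; exact: sqrtr_ge0. Qed.

Lemma sqr_L2normC g :
  (L2normC g ^+ 2 = \int[mu2]_x (complex.Re (g x) ^+ 2 + complex.Im (g x) ^+ 2)%:E)%E.
Proof.
by rewrite /L2normC sqr_L2norm; apply: eq_integral => x _; rewrite normc_sqr.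
Qed.

Lemma inL2CP g : inL2C g <->
  L2f mu2 (fun x => complex.Re (g x)) /\ L2f mu2 (fun x => complex.Im (g x)).
Proof. by rewrite /inL2C; split=> -[/inL2P ? /inL2P ?]. Qed.

Lemma L2f_normc g : inL2C g -> L2f mu2 (fun x => Normc.normc (g x)) /\
  sq mu2 (fun x => Normc.normc (g x)) =
  sq mu2 (fun x => complex.Re (g x)) + sq mu2 (fun x => complex.Im (g x)).
Proof.
move=> /inL2CP[[mr r2] [mi i2]]; split; last first.
  by rewrite /sq -integD//; apply: eq_integ => x; rewrite normc_sqr.
split; last by have := intgD r2 i2; apply: eq_intg => x; rewrite normc_sqr.
rewrite (_ : (fun x => _) = (fun x => Num.sqrt (complex.Re (g x) ^+ 2 + complex.Im (g x) ^+ 2))).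
  apply: (@measurableT_comp _ _ _ _ _ _ (fun t : R => Num.sqrt t)).
    exact: continuous_measurable_fun (@sqrt_continuous R).
  by apply: measurable_funD; exact: measurable_funX.
by apply/funext => x; case: (g x).
Qed.

Lemma cvg_sqrt0 (v : nat -> R) : (forall n, 0 <= v n) ->
  (v n @[n --> \oo] --> (0 : R)) <-> ((Num.sqrt (v n))%:E @[n --> \oo] --> 0%E).
Proof.
move=> v0; split=> [h|/fine_cvgP[_ h]].
  apply: cvg_EFin; first exact: nearW.
  have := cvg_comp _ _ h (@sqrt_continuous R 0).
  by rewrite sqrtr0.
have -> : v = (fun n => Num.sqrt (v n) * Num.sqrt (v n)).
  by apply/funext => n; rewrite -expr2 sqr_sqrtr.
by rewrite -[X in _ --> X](mulr0 (0 : R)); apply: cvgM; exact: h.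
Qed.

End L2_norms.

Section ae_opp.
Context (R : realType).
Notation mu2 := (@lebesgue2 R).

(** The reflection of a null set is null, by the change of variables applied to its indicator. *)
Lemma ae_opp (P : R * R -> Prop) : (\forall x \ae mu2, P x) -> \forall x \ae mu2, P (- x).
Proof.
move=> [A [mA A0 hA]].
have e x : aff (-1) 0 x = - x by rewrite affN1 sub0r.
have mN : measurable ((fun x => - x) @^-1` A : set (measurableTypeR R * measurableTypeR R)).
  have := @measurable_aff R (-1) 0 measurableT A mA; rewrite setTI.
  by congr measurable; apply/seteqP; split=> x /=; rewrite e.
exists ((fun x => - x) @^-1` A); split=> //; last by move=> x /= h; exact: hA.
have n1 : (-1 : R) != 0 by rewrite oppr_eq0 oner_eq0.
have mI : measurable_fun setT (fun x : R * R => (\1_A x : R)%:E).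
  by apply/measurable_EFinP; exact: measurable_indic.
have I0 (x : R * R) : (0 <= (\1_A x : R)%:E)%E by rewrite lee_fin.
have z : (\int[mu2]_x (\1_A x : R)%:E = 0)%E.
  by rewrite (@integral_indic _ _ _ mu2 setT measurableT A mA) setIT; exact: A0.
have := ge0_integral_aff 0 n1 mI I0; rewrite z mule0 => z'.
have := @integral_indic _ _ _ mu2 setT measurableT _ mN; rewrite setIT => h.
apply: (etrans (esym h)); rewrite -z'.
by apply: eq_integral => x _; rewrite e !indicE.
Qed.

End ae_opp.

(** * The Fourier transform of real functions through the Hartley transform *)

Section fourier_hartley.
Context (R : realType).
Notation mu2 := (@lebesgue2 R).
Implicit Types (f u k w a b : R * R -> R) (g h : R * R -> R[i]).

(* Fourier transform of a real function, in terms of its Hartley transform [a]. *)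
Definition hatc a (x : R * R) : R[i] := ((a x + a (- x)) / 2) -i* ((a x - a (- x)) / 2).

Lemma hartN u x : intg mu2 u ->
  (hart u x + hart u (- x)) / 2 = integ mu2 (fun y => u y * cos (2 * pi * dot2 x y)) /\
  (hart u x - hart u (- x)) / 2 = integ mu2 (fun y => u y * sin (2 * pi * dot2 x y)).
Proof.
move=> hu; have i1 := intg_hart x hu; have i2 := intg_hart (- x) hu.
rewrite /hart -(integD i1 i2) -(integB i1 i2).
rewrite -(integZr _ (intgD i1 i2)) -(integZr _ (intgB i1 i2)).
by split; apply: eq_integ => y; rewrite /ker/= dot2N mulrN /cas cosN sinN dot2C; field.
Qed.

Lemma truncated_fourierE n u x : L2f mu2 u ->
  truncated_fourier n (fun x => (u x)%:C) x = hatc (hart (trunc n u)) x.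
Proof.
move=> hu; have [e1 e2] := hartN x (trunc_L1 n hu).
rewrite /truncated_fourier /integralC /hatc e1 e2 -integN; last first.
  have := @intg_mulb _ _ _ mu2 _ _ 1 (measurable_sinw x) (norm_sinw_le x) (trunc_L1 n hu).
  by apply: eq_intg => y; rewrite mulrC.
have r (F : R * R -> R) : Rintegral mu2 (@square R n) F = integ mu2 (F \_ (@square R n)).
  by rewrite -RintegralE -Rintegral_mkcond.
rewrite !r /expNi.
by congr Complex; apply: eq_integ => y; rewrite patchE /trunc indicE;
  case: (_ \in _) => /=; rewrite ?mulr1 ?mulr0 ?mul0r ?subr0 ?addr0 ?mulrN ?oppr0.
Qed.

Lemma hatcN a x : hatc a (- x) = (hatc a x)^*.
Proof. by rewrite /hatc /= opprK; congr Complex; rewrite ?opprK; field. Qed.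

Lemma hatcD a b x : hatc (fun x => a x + b x) x = hatc a x + hatc b x.
Proof. by rewrite /hatc; simpc; congr Complex; field. Qed.

Lemma hatcB a b x : hatc (fun x => a x - b x) x = hatc a x - hatc b x.
Proof. by rewrite /hatc; simpc; congr Complex; field. Qed.

Lemma hatcM a b x : hatc (hprod a b) x = hatc a x * hatc b x.
Proof. by rewrite /hatc /hprod opprK; simpc; congr Complex; field. Qed.

Lemma inL2C_hatc a : L2f mu2 a -> inL2C (hatc a).
Proof.
move=> ha; have ha' := L2f_opp ha; apply/inL2CP; split.
  by have := L2fZ (2^-1) (L2fD ha ha'); apply: eq_L2f => x; rewrite mulrC.
by have := L2fZ (2^-1) (L2fB ha' ha); apply: eq_L2f => x /=; field.
Qed.

Lemma sq_hatc a : L2f mu2 a ->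
  sq mu2 (fun x => complex.Re (hatc a x)) + sq mu2 (fun x => complex.Im (hatc a x)) = sq mu2 a.
Proof.
move=> ha; have /inL2CP[[_ h1] [_ h2]] := inL2C_hatc ha.
have [_ a1] := ha; have [_ a2] := L2f_opp ha.
have e : sq mu2 (fun x => a (- x)) = sq mu2 a by exact: sq_opp.
rewrite /sq -(integD h1 h2).
transitivity (integ mu2 (fun x => 2^-1 * (a x ^+ 2 + a (- x) ^+ 2))).
  by apply: eq_integ => x /=; field.
rewrite (integZ _ (intgD a1 a2)) (integD a1 a2) -/(sq mu2 (fun x => a (- x))) e.
by rewrite -/(sq mu2 a); field.
Qed.

Lemma L2normC_hatc a : L2f mu2 a -> L2normC (hatc a) = (Num.sqrt (sq mu2 a))%:E.
Proof.
move=> ha; have [h1 h2] := L2f_normc (inL2C_hatc ha).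
by rewrite /L2normC L2norm_fin// h2 sq_hatc.
Qed.

Lemma hatc_ae a b : a = b %[ae mu2] -> hatc a = hatc b %[ae mu2].
Proof.
move=> /(ae_eqE mu2) ab; have := ae_opp ab; apply: filterS2 (ab) => x /= e1 e2 _.
by rewrite /hatc e1 e2.
Qed.

Lemma is_fourier_hatc u : L2f mu2 u -> is_fourier (fun x => (u x)%:C) (hatc (HT u)).
Proof.
move=> hu; have [hH cH] := HT_spec hu; split; first exact: inL2C_hatc.
have [ht _] := trunc_L2 hu.
have hh n : L2f mu2 (hart (trunc n u)) by have [] := hart_L2 (trunc_L1 n hu) (ht n).
rewrite (_ : (fun n => L2normC _) =
    (fun n => (Num.sqrt (sq mu2 (fun x => hart (trunc n u) x - HT u x)))%:E)).
  apply/cvg_sqrt0 => // n; exact: sq_ge0.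
apply/funext => n; rewrite sqBC -(L2normC_hatc (L2fB hH (hh n))).
by congr L2normC; apply/funext => x; rewrite truncated_fourierE// hatcB.
Qed.

Lemma is_fourier_unique u h : L2f mu2 u -> is_fourier (fun x => (u x)%:C) h ->
  h = hatc (HT u) %[ae mu2].
Proof.
move=> hu [/[dup] hC /inL2CP[hr hi] ch]; have [hH cH] := HT_spec hu.
have [ht _] := trunc_L2 hu.
pose t n := hart (trunc n u).
have hh n : L2f mu2 (t n) by have [] := hart_L2 (trunc_L1 n hu) (ht n).
have tr n : L2f mu2 (fun x => complex.Re (hatc (t n) x)) by have /inL2CP[] := inL2C_hatc (hh n).
have ti n : L2f mu2 (fun x => complex.Im (hatc (t n) x)) by have /inL2CP[] := inL2C_hatc (hh n).
have /inL2CP[Hr Hi] := inL2C_hatc hH.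
pose v n := sq mu2 (fun x => complex.Re (hatc (t n) x) - complex.Re (h x)) +
  sq mu2 (fun x => complex.Im (hatc (t n) x) - complex.Im (h x)).
have v0 n : 0 <= v n by rewrite addr_ge0 ?sq_ge0.
have E : (fun n => L2normC (fun x => h x - truncated_fourier n (fun x => (u x)%:C) x)) =
    (fun n => (Num.sqrt (v n))%:E).
  apply/funext => n.
  have dC : inL2C (fun x => h x - truncated_fourier n (fun x => (u x)%:C) x).
    apply/inL2CP; split.
      have := L2fB hr (tr n); apply: eq_L2f => x; rewrite truncated_fourierE//.
      by case: (h x) => p q.
    have := L2fB hi (ti n); apply: eq_L2f => x; rewrite truncated_fourierE//.
    by case: (h x) => p q.
  have [d1 d2] := L2f_normc dC; rewrite /L2normC L2norm_fin// d2; congr (Num.sqrt _)%:E.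
  by rewrite /v; congr (_ + _); apply: eq_integ => x; rewrite truncated_fourierE//;
    case: (h x) => p q; rewrite -[RHS]sqrrN opprB.
have cv : v n @[n --> \oo] --> (0 : R) by apply/(cvg_sqrt0 v0); rewrite -E.
pose v' n := sq mu2 (fun x => t n x - HT u x).
have e n : sq mu2 (fun x => complex.Re (hatc (t n) x) - complex.Re (hatc (HT u) x)) +
    sq mu2 (fun x => complex.Im (hatc (t n) x) - complex.Im (hatc (HT u) x)) = v' n.
  rewrite /v' -(sq_hatc (L2fB (hh n) hH)).
  by congr (_ + _); apply: eq_integ => x; rewrite hatcB.
have c1 : cvg2 mu2 (fun n x => complex.Re (hatc (t n) x)) (fun x => complex.Re (hatc (HT u) x)).
  by apply: (@cvg2_le _ _ _ mu2 _ _ v' _ cH) => m; rewrite -e lerDl sq_ge0.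
have c2 : cvg2 mu2 (fun n x => complex.Im (hatc (t n) x)) (fun x => complex.Im (hatc (HT u) x)).
  by apply: (@cvg2_le _ _ _ mu2 _ _ v' _ cH) => m; rewrite -e lerDr sq_ge0.
have c3 : cvg2 mu2 (fun n x => complex.Re (hatc (t n) x)) (fun x => complex.Re (h x)).
  by apply: (@cvg2_le _ _ _ mu2 _ _ v _ cv) => m; rewrite lerDl sq_ge0.
have c4 : cvg2 mu2 (fun n x => complex.Im (hatc (t n) x)) (fun x => complex.Im (h x)).
  by apply: (@cvg2_le _ _ _ mu2 _ _ v _ cv) => m; rewrite lerDr sq_ge0.
have := cvg2_unique tr hr Hr c3 c1; have := cvg2_unique ti hi Hi c4 c2.
apply: filterS2 => x /= h1 h2 xT; have := h1 xT; have := h2 xT.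
by case: (h x) => p q /= -> ->.
Qed.

(** [hat u] is an unspecified choice made by [xget]. Existence of a transform shows that the choice
    is one, and uniqueness identifies it almost everywhere; nothing is known at individual
    points. *)
Lemma hat_spec u : inL2 u -> inL2C (hat u) /\ hat u = hatc (HT u) %[ae mu2].
Proof.
move=> /inL2P hu.
have H : is_fourier (fun x => (u x)%:C) (hat u).
  by apply: (@xgetPex _ (fun=> 0) (is_fourier (fun x => (u x)%:C))); exists (hatc (HT u)); exact: is_fourier_hatc.
by split; [case: H|exact: is_fourier_unique].
Qed.

Lemma hat_inL2C u : inL2 u -> inL2C (hat u). Proof. by case/hat_spec. Qed.

Lemma inL2D u w : inL2 u -> inL2 w -> inL2 (u \+ w).
Proof. by move=> /inL2P hu /inL2P hw; apply/inL2P; exact: L2fD. Qed.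

Lemma inL2B u w : inL2 u -> inL2 w -> inL2 (u \- w).
Proof. by move=> /inL2P hu /inL2P hw; apply/inL2P; exact: L2fB. Qed.

Lemma inL20 : inL2 (fun=> 0 : R).
Proof. by apply/inL2P; exact: L2f0. Qed.

Lemma hatD u w : inL2 u -> inL2 w -> hat (u \+ w) = hat u \+ hat w %[ae mu2].
Proof.
move=> iu iw; have [_ e1] := hat_spec iu; have [_ e2] := hat_spec iw.
have [_ e3] := hat_spec (inL2D iu iw).
move: iu iw => /inL2P hu /inL2P hw.
have e4 := hatc_ae (HTD hu hw).
have e34 : hat (u \+ w) = (fun x => hatc (HT u) x + hatc (HT w) x) %[ae mu2].
  by apply: filterS2 e3 e4 => x h1 h2 xT; rewrite h1// h2// hatcD.
by apply: filterS3 e1 e2 e34 => x h1 h2 h3 xT; rewrite h3// -h1// -h2.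
Qed.

Lemma hatB u w : inL2 u -> inL2 w -> hat (u \- w) = hat u \- hat w %[ae mu2].
Proof.
move=> iu iw; have [_ e1] := hat_spec iu; have [_ e2] := hat_spec iw.
have [_ e3] := hat_spec (inL2B iu iw).
move: iu iw => /inL2P hu /inL2P hw.
have e4 := hatc_ae (HTB hu hw).
have e34 : hat (u \- w) = (fun x => hatc (HT u) x - hatc (HT w) x) %[ae mu2].
  by apply: filterS2 e3 e4 => x h1 h2 xT; rewrite h1// h2// hatcB.
by apply: filterS3 e1 e2 e34 => x h1 h2 h3 xT; rewrite h3// -h1// -h2.
Qed.

Lemma hat0 : hat (fun=> 0 : R) = (fun=> 0) %[ae mu2].
Proof.
have := hatB inL20 inL20.
rewrite (_ : (fun=> 0) \- (fun=> 0) = (fun=> 0 : R)); last by apply/funext => x /=; rewrite subrr.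
by apply: filterS => x h /h /= ->; rewrite subrr.
Qed.

Lemma hat_hermitian u : inL2 u -> \forall x \ae mu2, hat u x = (hat u (- x))^*.
Proof.
move=> /hat_spec[_ /(ae_eqE mu2) e]; have := ae_opp e; apply: filterS2 (e) => x -> ->.
by rewrite hatcN conjcK.
Qed.

(** For Hermitian g the real part is even and the imaginary part odd, so g = [hatc a] forces a = Re
    g - Im g. Since [HT] is an involution, u = HT a has this Hartley transform. *)
Lemma hat_surjective g : inL2C g -> (\forall x \ae mu2, g x = (g (- x))^*) ->
  exists2 u, inL2 u & hat u = g %[ae mu2].
Proof.
move=> /inL2CP[gr gi] gN; pose a x := complex.Re (g x) - complex.Im (g x).
have ha : L2f mu2 a by exact: L2fB.
exists (HT a); first by apply/inL2P; exact: HT_L2.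
have [_ e1] := hat_spec ((inL2P (HT a)).2 (HT_L2 ha)).
have e2 := hatc_ae (HTK ha).
have gN' : g = (fun x => (g (- x))^*) %[ae mu2] by exact/(ae_eqE mu2).
apply: filterS3 e1 e2 gN' => x h1 h2 h3 xT.
rewrite h1// h2// h3// /hatc /a h3//; case: (g (- x)) => p q /=.
by congr Complex; field.
Qed.

Definition measurable_cplx g := measurable_fun setT (fun x => complex.Re (g x)) /\
  measurable_fun setT (fun x => complex.Im (g x)).

Lemma measurable_cplx_inL2C g : inL2C g -> measurable_cplx g.
Proof. by move=> /inL2CP[[m1 _] [m2 _]]. Qed.

Lemma measurable_cplxD g h : measurable_cplx g -> measurable_cplx h -> measurable_cplx (g \+ h).
Proof.
move=> [g1 g2] [h1 h2]; split.
  have := measurable_funD g1 h1; apply: eq_measurable_fun => x _ /=.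
  by case: (g x); case: (h x).
have := measurable_funD g2 h2; apply: eq_measurable_fun => x _ /=.
by case: (g x); case: (h x).
Qed.

Lemma measurable_cplxB g h : measurable_cplx g -> measurable_cplx h -> measurable_cplx (g \- h).
Proof.
move=> [g1 g2] [h1 h2]; split.
  have := measurable_funB g1 h1; apply: eq_measurable_fun => x _ /=.
  by case: (g x); case: (h x).
have := measurable_funB g2 h2; apply: eq_measurable_fun => x _ /=.
by case: (g x); case: (h x).
Qed.

Lemma measurable_cplxM g h : measurable_cplx g -> measurable_cplx h -> measurable_cplx (g \* h).
Proof.
move=> [g1 g2] [h1 h2]; split.
  have := measurable_funB (measurable_funM g1 h1) (measurable_funM g2 h2).
  by apply: eq_measurable_fun => x _ /=; case: (g x); case: (h x).
have := measurable_funD (measurable_funM g1 h2) (measurable_funM g2 h1).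
by apply: eq_measurable_fun => x _ /=; case: (g x); case: (h x).
Qed.

Lemma measurable_normc_sqr g : measurable_cplx g ->
  measurable_fun setT (fun x => (complex.Re (g x) ^+ 2 + complex.Im (g x) ^+ 2)%:E).
Proof.
move=> [m1 m2]; apply/measurable_EFinP; apply: measurable_funD; exact: measurable_funX.
Qed.

Lemma ae_L2normC g h : measurable_cplx g -> measurable_cplx h -> g = h %[ae mu2] ->
  (L2normC g ^+ 2 = L2normC h ^+ 2)%E.
Proof.
move=> mg mh gh; rewrite !sqr_L2normC.
apply: (@ae_eq_integral _ _ _ mu2) => //; [exact: measurable_normc_sqr|exact: measurable_normc_sqr|].
by have := gh; apply: filterS => x h' /h' ->.
Qed.

End fourier_hartley.

(** * Measurable selection of a minimiser on [0, 1] *)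

Section smallest_minimizer.
Context (R : realType).
Implicit Types (h : R -> R) (c t s : R).

Definition clamp t : R := Num.max 0 (Num.min 1 t).

Lemma clamp_itv t : 0 <= clamp t <= 1.
Proof. by rewrite /clamp le_max lexx/= ge_max ler01/= ge_min lexx. Qed.

Lemma clamp_id t : 0 <= t <= 1 -> clamp t = t.
Proof. by move=> /andP[t0 t1]; rewrite /clamp (min_r t1) (max_r t0). Qed.

Lemma continuous_clamp : continuous clamp.
Proof.
have e t : clamp t = (`|t| - `|t - 1| + 1) / 2.
  rewrite /clamp; have [t1|t1] := leP 1 t.
    rewrite max_r// !ger0_norm ?subr_ge0//; first by field.
    exact: le_trans t1.
  have h1 : t - 1 < 0 by rewrite subr_lt0.
  have [t0|t0] := leP 0 t.
    by rewrite (ger0_norm t0) (ltr0_norm h1); field.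
  by rewrite (ltr0_norm t0) (ltr0_norm h1); field.
rewrite (funext e) => x.
apply: (@continuousM _ _ (fun t : R => `|t| - `|t - 1| + 1) (fun=> 2^-1)); last exact: cst_continuous.
apply: continuousD; last exact: cst_continuous.
apply: continuousB; first exact: norm_continuous.
apply: (@continuous_comp _ _ _ (fun t : R => t - 1) Num.norm); last exact: norm_continuous.
by apply: continuousB; [exact: cvg_id|exact: cst_continuous].
Qed.

Lemma continuous_rat_approx h v e : continuous h -> 0 < e ->
  exists q : rat, `|h v - h (ratr q)| < e.
Proof.
move=> ch e0; have /cvgrPdist_lt/(_ e e0) := ch v.
move=> /nbhs_ballP[d /= d0 hd].
have [q] := @rat_in_itvoo R v (v + d) (ltac:(by rewrite ltrDl)).
rewrite in_itv/= => /andP[q1 q2]; exists q; apply: hd.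
by rewrite /ball/= ltr0_norm ?subr_lt0//; lra.
Qed.

Lemma continuous_le_rat h M : continuous h -> (forall q : rat, M <= h (ratr q)) -> forall t, M <= h t.
Proof.
move=> ch hM t; rewrite leNgt; apply/negP => tM.
have [q hq] := continuous_rat_approx t ch (ltac:(by rewrite subr_gt0) : 0 < M - h t).
by have := hM q; move: hq; rewrite ltr_norml => /andP[h1 h2]; lra.
Qed.

Definition is_minimizer h t := 0 <= t <= 1 /\ forall s, 0 <= s <= 1 -> h t <= h s.

(* The smallest minimiser depends measurably on a parameter of [h]; an arbitrary one need not. *)
Definition tmin h : R := inf [set t | is_minimizer h t].

Lemma minimizer_exists h c : continuous h -> 0 <= c <= 1 ->
  exists2 t, 0 <= t <= c & forall s, 0 <= s <= c -> h t <= h s.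
Proof.
move=> ch /andP[c0 c1].
have [|t tc tm] := @EVT_min R h 0 c c0; first exact: continuous_subspaceT.
exists t; first by move: tc; rewrite in_itv.
by move=> s sc; apply: tm; rewrite in_itv.
Qed.

(** The set of minimisers is closed: were h larger at the infimum than somewhere else, it would be
    so at minimisers arbitrarily near. *)
Lemma tmin_spec h : continuous h -> is_minimizer h (tmin h).
Proof.
move=> ch; pose A := [set t | is_minimizer h t].
have [t0 t01 t0m] := minimizer_exists ch (ltac:(by rewrite ler01 lexx) : 0 <= 1 <= (1:R)).
have A0 : A !=set0 by exists t0.
have lA : has_lbound A by exists 0 => t [/andP[]].
have hA : has_inf A by split.
have b0 : 0 <= tmin h by apply: lb_le_inf => // t [/andP[]].
have b1 : tmin h <= 1.
  by apply: le_trans (ge_inf lA (_ : A t0)) _; [split|case/andP: t01].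
split=> [|s s01]; first by rewrite b0.
rewrite leNgt; apply/negP => lt.
have e0 : 0 < h (tmin h) - h s by rewrite subr_gt0.
have /cvgrPdist_lt/(_ _ e0) := ch (tmin h).
move=> /nbhs_ballP[d /= d0 hd].
have [t At tlt] := inf_adherent d0 hA.
have tge : tmin h <= t by exact: ge_inf.
have := hd t; rewrite /ball/= ler0_norm ?subr_le0// => H.
have {H} := H (ltac:(by rewrite opprB ltrBlDl)).
have [_ /(_ s s01) hts] := At.
by rewrite ltr_norml => /andP[h1 h2]; lra.
Qed.

(* [clamp] turns rational test points into a countable dense subset of [[0, 1]]. *)
Lemma tmin_leP h c : continuous h -> 0 <= c <= 1 ->
  tmin h <= c <-> forall (s : rat) (n : nat), exists q : rat,
    h (c * clamp (ratr q)) < h (clamp (ratr s)) + n.+1%:R^-1.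
Proof.
move=> ch c01; have /andP[c0 c1] := c01; have [t01 tm] := tmin_spec ch.
have cc : continuous (fun v => h (c * clamp v)).
  move=> v; apply: (@continuous_comp _ _ _ (fun v => c * clamp v) h); last exact: ch.
  by apply: continuousM; [exact: cst_continuous|exact: continuous_clamp].
have ccl : continuous (fun v => h (clamp v)).
  by move=> v; apply: (@continuous_comp _ _ _ clamp h); [exact: continuous_clamp|exact: ch].
split=> [tc s n|H].
  have [v ev] : exists v, tmin h = c * clamp v.
    have /andP[h0 h1] := t01.
    have [c00|cn0] := eqVneq c 0.
      by exists 0; rewrite c00 mul0r; apply/eqP; rewrite eq_le -{1}c00 tc.
    have cp : 0 < c by rewrite lt_neqAle eq_sym cn0.
    exists (tmin h / c); rewrite clamp_id; first by rewrite mulrC divfK.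
    by rewrite divr_ge0//= ler_pdivrMr// mul1r.
  have n0 : 0 < n.+1%:R^-1 :> R by rewrite invr_gt0.
  have [q hq] := continuous_rat_approx v cc n0.
  exists q; have := tm _ (clamp_itv (ratr s)); rewrite ev.
  move: hq => /=; rewrite ltr_norml => /andP[h1 h2].
  move: (n.+1%:R^-1) h1 h2 => e h1 h2 h3; lra.
(* Conversely, a minimiser over [0, c] is compared with rational test points up to every 1/(n+1),
   hence minimises over [0, 1] and bounds [tmin h] from above. *)
have [t tc ht] := minimizer_exists ch c01.
have /andP[t0 tc'] := tc.
suff mt : is_minimizer h t.
  apply: le_trans tc'; apply: ge_inf => //; exists 0 => s [/andP[]//].
split; first by rewrite t0 (le_trans tc').
move=> s s01; rewrite -(clamp_id s01); apply: (continuous_le_rat ccl) => q.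
apply/ler_addgt0Pr => e e0.
have [n hn] : exists n, n.+1%:R^-1 < e.
  have [n _ hn] := @near_infty_natSinv_lt R (PosNum e0).
  by exists n; exact: hn n (leqnn _).
have [q' hq'] := H q n.
have : h t <= h (c * clamp (ratr q')).
  apply: ht; have /andP[u0 u1] := clamp_itv (ratr q').
  by rewrite mulr_ge0//= ler_piMr.
move: hq' hn => /=; move: (n.+1%:R^-1) => e' h1 h2 h3; lra.
Qed.

(** By [tmin_leP] the set where the smallest minimiser is at most c is built from countably many
    strict inequalities between values of G at fixed arguments; a c outside [0, 1] is trivial. *)
Lemma measurable_tmin d (T : measurableType d) (G : T -> R -> R) :
  (forall t, measurable_fun setT (fun x => G x t)) -> (forall x, continuous (G x)) ->
  measurable_fun setT (fun x => tmin (G x)).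
Proof.
move=> mG cG; apply: (measurability _ (RGenOInfty.measurableE R)) => //.
move=> _ [_ [c ->] <-]; rewrite setTI.
have itv x : 0 <= tmin (G x) <= 1 by have [] := tmin_spec (cG x).
have [c0|c0] := ltP c 0.
  rewrite (_ : _ @^-1` _ = setT)//; apply/seteqP; split=> // x _ /=.
  by rewrite in_itv/= andbT; have /andP[h _] := itv x; exact: lt_le_trans h.
have [c1|c1] := ltP 1 c.
  rewrite (_ : _ @^-1` _ = set0)//; apply/seteqP; split=> // x /=.
  by rewrite in_itv/= andbT => h; have /andP[_ h'] := itv x; lra.
have c01 : 0 <= c <= 1 by rewrite c0.
rewrite (_ : _ @^-1` _ = ~` (\bigcap_(s : rat) \bigcap_(n : nat) \bigcup_(q : rat)
  [set x | G x (c * clamp (ratr q)) < G x (clamp (ratr s)) + n.+1%:R^-1])); last first.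
  apply/seteqP; split=> x /=; rewrite in_itv/= andbT.
    move=> h H; have : tmin (G x) <= c.
      by apply/(tmin_leP (cG x) c01) => s n; have [q _ hq] := H s I n I; exists q.
    lra.
  move=> H; rewrite ltNge; apply/negP => /(tmin_leP (cG x) c01) h; apply: H => s _ n _.
  by have [q hq] := h s n; exists q.
rewrite setC_bigcap; apply: bigcupT_measurable_rat => s; apply: measurableC.
apply: bigcapT_measurable => n.
apply: bigcupT_measurable_rat => q.
have h : measurable_fun setT
    (fun x => G x (c * clamp (ratr q)) < G x (clamp (ratr s)) + n.+1%:R^-1).
  by apply: measurable_fun_ltr => //; exact: measurable_funD.
have := h measurableT [set true] _; rewrite setTI; exact.
Qed.

End smallest_minimizer.

(** * The real minimisation problem at one frequency *)

Section scalar_minimization.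
Context (R : realType).
Implicit Types (a U K l m P Q : R).

Definition scal a U K l m P Q : R := (a - P * Q) ^+ 2 + l * (P - U) ^+ 2 + m * (Q - K) ^+ 2.

(** The minimum of [scal] over P, attained at [bestP]: completing the square in P gives [scalE]. *)
Definition redu a U K l m Q : R := l * (a - U * Q) ^+ 2 / (Q ^+ 2 + l) + m * (Q - K) ^+ 2.

Definition bestP a U l Q : R := (a * Q + l * U) / (Q ^+ 2 + l).

Lemma scalE a U K l m P Q : 0 < l ->
  scal a U K l m P Q = redu a U K l m Q + (Q ^+ 2 + l) * (P - bestP a U l Q) ^+ 2.
Proof.
move=> l0; have h : Q ^+ 2 + l != 0 by rewrite gt_eqF// ltr_wpDl// sqr_ge0.
by rewrite /scal /redu /bestP; field.
Qed.

Lemma redu_le_scal a U K l m P Q : 0 < l -> redu a U K l m Q <= scal a U K l m P Q.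
Proof.
by move=> l0; rewrite scalE// lerDl mulr_ge0 ?sqr_ge0// addr_ge0 ?sqr_ge0// ltW.
Qed.

Lemma scal_bestP a U K l m Q : 0 < l -> scal a U K l m (bestP a U l Q) Q = redu a U K l m Q.
Proof. by move=> l0; rewrite scalE// subrr expr0n mulr0 addr0. Qed.

(* [sqrt m * width] equals [a], and [a^2] bounds the reduced functional at [K]. *)
Definition width a m : R := a / Num.sqrt m.

(** Below K the value at K is no larger: there a - U Q >= a - U K >= 0, the denominator is smaller
    and the penalty nonnegative. Beyond K + [width] the penalty alone is at least a^2, which bounds
    the value at K. *)
Lemma redu_restrict a U K l m Q : 0 <= a -> 0 <= U -> 0 <= K -> 0 < l -> 0 < m ->
  U * K <= a -> 0 <= Q ->
  exists2 t, 0 <= t <= 1 & redu a U K l m (K + t * width a m) <= redu a U K l m Q.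
Proof.
move=> a0 U0 K0 l0 m0 UK Q0.
have sm0 : 0 < Num.sqrt m by rewrite sqrtr_gt0.
have w0 : 0 <= width a m by rewrite divr_ge0// ltW.
have mw : m * width a m ^+ 2 = a ^+ 2.
  rewrite /width expr_div_n sqr_sqrtr ?(ltW m0)//; field; exact: lt0r_neq0.
have den q : 0 < q ^+ 2 + l by rewrite ltr_wpDl// sqr_ge0.
have gK : redu a U K l m K <= a ^+ 2.
  rewrite /redu subrr expr0n mulr0 addr0 ler_pdivrMr//.
  have h : (a - U * K) ^+ 2 <= a ^+ 2.
    by rewrite lerXn2r ?nnegrE ?subr_ge0// lerBlDr lerDl mulr_ge0.
  rewrite mulrC; apply: ler_pM => //; [exact: sqr_ge0|exact: ltW|].
  by rewrite lerDr sqr_ge0.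
have rm q : m * (q - K) ^+ 2 <= redu a U K l m q.
  by rewrite /redu lerDr divr_ge0 ?(ltW (den q))// mulr_ge0 ?sqr_ge0// ltW.
have [QK|KQ] := leP Q K.
  exists 0; first by rewrite lexx ler01.
  rewrite mul0r addr0 /redu subrr expr0n mulr0 addr0 -[leLHS]addr0 lerD//; last first.
    by rewrite mulr_ge0 ?sqr_ge0// ltW.
  rewrite ler_pM ?invr_ge0 ?(ltW (den _))//; first by rewrite mulr_ge0 ?sqr_ge0// ltW.
    rewrite ler_wpM2l ?(ltW l0)// lerXn2r ?nnegrE ?subr_ge0//.
      by apply: le_trans UK; rewrite ler_wpM2l.
    by rewrite lerD2l lerN2 ler_wpM2l.
  by rewrite lef_pV2 ?posrE// lerD2r lerXn2r.
have [Qw|wQ] := leP Q (K + width a m).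
  have [w00|wn0] := eqVneq (width a m) 0.
    by move: Qw; rewrite w00 addr0 leNgt KQ.
  have wp : 0 < width a m by rewrite lt_neqAle eq_sym wn0.
  exists ((Q - K) / width a m).
    by rewrite divr_ge0 ?subr_ge0 ?(ltW KQ)//= ler_pdivrMr// mul1r lerBlDl.
  by rewrite divfK// addrC subrK.
exists 0; first by rewrite lexx ler01.
rewrite mul0r addr0; apply: le_trans gK _; apply: le_trans (rm Q); rewrite -mw.
rewrite ler_wpM2l ?(ltW m0)// lerXn2r ?nnegrE//; [by rewrite subr_ge0 ltW|lra].
Qed.

(** If U Q > a, the point a / U lies between K and Q, annihilates the first term and has a strictly
    smaller penalty. *)
Lemma redu_bound a U K l m Q : 0 <= a -> 0 <= U -> 0 <= K -> 0 < l -> 0 < m ->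
  U * K <= a -> 0 <= Q -> K <= Q -> (forall q, 0 <= q -> redu a U K l m Q <= redu a U K l m q) ->
  U * Q <= a.
Proof.
move=> a0 U0 K0 l0 m0 UK Q0 KQ Qm; rewrite leNgt; apply/negP => aUQ.
have Up : 0 < U by rewrite lt_neqAle U0 andbT; apply/eqP => e; move: aUQ; rewrite -e mul0r; lra.
have Un := lt0r_neq0 Up.
have q0 : 0 <= a / U by rewrite divr_ge0.
have qK : K <= a / U by rewrite ler_pdivlMr// mulrC.
have qQ : a / U < Q by rewrite ltr_pdivrMr// mulrC.
have := Qm _ q0; rewrite /redu [U * (a / U)]mulrC divfK// subrr expr0n mulr0 mul0r add0r.
have h1 : m * (a / U - K) ^+ 2 < m * (Q - K) ^+ 2.
  rewrite ltr_pM2l// ltrXn2r//; first by rewrite subr_ge0.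
  by rewrite ltrD2r.
have h2 : 0 <= l * (a - U * Q) ^+ 2 / (Q ^+ 2 + l).
  by rewrite divr_ge0 ?addr_ge0 ?sqr_ge0 ?(ltW l0)// mulr_ge0 ?sqr_ge0// ltW.
by move=> h3; lra.
Qed.

Lemma continuous_redu a U K l m (b : R) : 0 < l -> continuous (fun t : R => redu a U K l m (K + t * b)).
Proof.
move=> l0 t.
have cq : {for t, continuous (fun t : R => K + t * b)}.
  by apply: continuousD; [exact: cst_continuous|apply: continuousM; [exact: cvg_id|exact: cst_continuous]].
have sqc (f : R -> R) : {for t, continuous f} -> {for t, continuous (fun t => f t ^+ 2)}.
  by move=> cf; apply: (@continuous_comp _ _ _ f (fun y : R => y ^+ 2)) => //; exact: exprn_continuous.
rewrite /redu; apply: (@continuousD _ _ _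
  (fun t : R => l * (a - U * (K + t * b)) ^+ 2 / ((K + t * b) ^+ 2 + l))
  (fun t : R => m * ((K + t * b) - K) ^+ 2)); last first.
  apply: continuousM; first exact: cst_continuous.
  by apply: sqc; apply: continuousB => //; exact: cst_continuous.
apply: (@continuousM _ _ (fun t : R => l * (a - U * (K + t * b)) ^+ 2)
  (fun t : R => ((K + t * b) ^+ 2 + l)^-1)).
  apply: continuousM; first exact: cst_continuous.
  apply: sqc; apply: continuousB; first exact: cst_continuous.
  by apply: continuousM => //; exact: cst_continuous.
apply: (@continuousV _ _ (fun t : R => (K + t * b) ^+ 2 + l)).
  by rewrite gt_eqF// ltr_wpDl// sqr_ge0.
by apply: continuousD; [exact: sqc|exact: cst_continuous].
Qed.

(** The interval of candidates depends on the data; the affine parameter gives [tmin] the fixed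
    domain [0, 1]. *)
Definition bestQ a U K l m : R := K + tmin (fun t => redu a U K l m (K + t * width a m)) * width a m.

Lemma bestQ_spec a U K l m : 0 <= a -> 0 <= U -> 0 <= K -> 0 < l -> 0 < m -> U * K <= a ->
  [/\ K <= bestQ a U K l m, U * bestQ a U K l m <= a &
      forall P Q, 0 <= Q ->
        scal a U K l m (bestP a U l (bestQ a U K l m)) (bestQ a U K l m) <= scal a U K l m P Q].
Proof.
move=> a0 U0 K0 l0 m0 UK; set q := bestQ a U K l m.
have [t01 tm] := tmin_spec (@continuous_redu a U K l m (width a m) l0).
have w0 : 0 <= width a m by rewrite divr_ge0// sqrtr_ge0.
have Kq : K <= q by rewrite lerDl mulr_ge0//; case/andP: t01.
have qm Q : 0 <= Q -> redu a U K l m q <= redu a U K l m Q.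
  move=> Q0; have [t t01' ht] := redu_restrict a0 U0 K0 l0 m0 UK Q0.
  exact: le_trans (tm t t01') ht.
split=> //; first by apply: (redu_bound a0 U0 K0 l0 m0 UK (le_trans K0 Kq) Kq qm).
move=> P Q Q0; rewrite scal_bestP//; apply: le_trans (qm Q Q0) _; exact: redu_le_scal.
Qed.

(** After clearing the denominator, both inequalities are U Q <= a, multiplied by Q and by l
    respectively. *)
Lemma bestP_spec a U l Q : 0 <= a -> 0 <= U -> 0 < l -> 0 <= Q -> U * Q <= a ->
  U <= bestP a U l Q /\ bestP a U l Q * Q <= a.
Proof.
move=> a0 U0 l0 Q0 UQ; have den : 0 < Q ^+ 2 + l by rewrite ltr_wpDl// sqr_ge0.
rewrite /bestP ler_pdivlMr// mulrAC ler_pdivrMr//; split.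
  by rewrite mulrDr mulrC [l * U]mulrC lerD2r; nra.
nra.
Qed.

End scalar_minimization.

(** * The energies as integrals over frequencies *)

Section fourier_energy.
Context (R : realType).
Notation mu2 := (@lebesgue2 R).
Notation normc := (@Normc.normc R).
Implicit Types (f U K u k : R * R -> R) (hf hU hK p q g : R * R -> R[i]) (x : R * R) (z w : R[i]).

Lemma Delta_ge1 x : 1 <= Delta x.
Proof. by rewrite /Delta lerDl addr_ge0// sqr_ge0. Qed.

Lemma Delta_gt0 x : 0 < Delta x.
Proof. exact: lt_le_trans (Delta_ge1 x). Qed.

Lemma DeltaN x : Delta (- x) = Delta x.
Proof. by rewrite /Delta /= !sqrrN. Qed.

Lemma powDelta_gt0 x t : 0 < Delta x `^ t.
Proof. by rewrite powR_gt0 ?Delta_gt0. Qed.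

Lemma powDelta_ge1 x t : 0 <= t -> 1 <= Delta x `^ t.
Proof.
move=> t0; have -> : 1 = (1 : R) `^ t by rewrite powR1.
by rewrite ge0_ler_powR ?nnegrE ?Delta_ge1 ?(ltW (Delta_gt0 x)).
Qed.

Lemma measurable_powDelta t : measurable_fun setT (fun x => Delta x `^ t).
Proof.
apply: (@measurableT_comp _ _ _ _ _ _ (fun y : R => y `^ t)); first exact: measurable_powR.
by apply: measurable_funD => //; apply: measurable_funD; apply: measurable_funX.
Qed.

Lemma measurable_normc g : measurable_cplx g -> measurable_fun setT (fun x => normc (g x)).
Proof.
move=> [m1 m2].
rewrite (_ : (fun x => _) = (fun x => Num.sqrt (complex.Re (g x) ^+ 2 + complex.Im (g x) ^+ 2))).
  apply: (@measurableT_comp _ _ _ _ _ _ (fun t : R => Num.sqrt t)).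
    exact: continuous_measurable_fun (@sqrt_continuous R).
  by apply: measurable_funD; exact: measurable_funX.
by apply/funext => x; case: (g x).
Qed.

Definition Jx (r s l m : R) hf hU hK p q x : R :=
  normc (hf x - (p x + hU x) * (q x + hK x)) ^+ 2 + l * Delta x `^ r * normc (p x) ^+ 2
  + m * Delta x `^ s * normc (q x) ^+ 2.

Lemma normc_real (t : R) : normc t%:C = `|t|.
Proof. by rewrite /= expr0n addr0 sqrtr_sqr. Qed.

Lemma L2normC_weighted t g : measurable_cplx g ->
  (L2normC (fun x => (Delta x `^ (t / 2))%:C * g x)%R ^+ 2 =
   \int[mu2]_x (Delta x `^ t * normc (g x) ^+ 2)%:E)%E.
Proof.
move=> mg; rewrite /L2normC sqr_L2norm; apply: eq_integral => x _; congr EFin.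
rewrite Normc.normcM normc_real exprMn real_normK ?num_real//.
by rewrite -[(Delta x `^ _) ^+ 2]powR_mulrn ?powR_ge0// -powRrM divfK.
Qed.

Lemma measurable_weighted t g : measurable_cplx g ->
  measurable_fun setT (fun x => Delta x `^ t * normc (g x) ^+ 2).
Proof.
move=> mg; apply: measurable_funM; first exact: measurable_powDelta.
by apply: measurable_funX; exact: measurable_normc.
Qed.

Section integral_form.
Variables (r s l m : R) (hf : R * R -> R[i]).
Hypotheses (l0 : 0 < l) (m0 : 0 < m) (mf : measurable_cplx hf).

Lemma Jx_ge0 hU hK p q x : 0 <= Jx r s l m hf hU hK p q x.
Proof.
by rewrite /Jx !addr_ge0 ?sqr_ge0// mulr_ge0 ?sqr_ge0// mulr_ge0 ?powR_ge0// ltW.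
Qed.

Lemma measurable_residual hU hK p q : measurable_cplx hU -> measurable_cplx hK ->
  measurable_cplx p -> measurable_cplx q ->
  measurable_fun setT (fun x => normc (hf x - (p x + hU x) * (q x + hK x)) ^+ 2).
Proof.
move=> mU mK mp mq; apply: measurable_funX.
apply: (@measurable_normc (hf \- (p \+ hU) \* (q \+ hK))).
by apply: measurable_cplxB => //; apply: measurable_cplxM; exact: measurable_cplxD.
Qed.

Lemma measurable_Jx hU hK p q : measurable_cplx hU -> measurable_cplx hK ->
  measurable_cplx p -> measurable_cplx q ->
  measurable_fun setT (Jx r s l m hf hU hK p q).
Proof.
move=> mU mK mp mq; apply: measurable_funD; first apply: measurable_funD.
- exact: measurable_residual.
- apply: (@eq_measurable_fun _ _ _ _ _ (fun x => l * (Delta x `^ r * normc (p x) ^+ 2))).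
    by move=> x _; rewrite mulrA.
  by apply: measurable_funM => //; exact: measurable_weighted.
- apply: (@eq_measurable_fun _ _ _ _ _ (fun x => m * (Delta x `^ s * normc (q x) ^+ 2))).
    by move=> x _; rewrite mulrA.
  by apply: measurable_funM => //; exact: measurable_weighted.
Qed.

Lemma fourier_energyE hU hK p q : measurable_cplx hU -> measurable_cplx hK ->
  measurable_cplx p -> measurable_cplx q ->
  fourier_energy r s l m hf hU hK (p, q) = (\int[mu2]_x (Jx r s l m hf hU hK p q x)%:E)%E.
Proof.
move=> mU mK mp mq.
have -> : fourier_energy r s l m hf hU hK (p, q) =
  (L2normC (fun x => hf x - (p x + hU x) * (q x + hK x))%R ^+ 2
   + l%:E * L2normC (fun x => (Delta x `^ (r / 2))%:C * p x)%R ^+ 2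
   + m%:E * L2normC (fun x => (Delta x `^ (s / 2))%:C * q x)%R ^+ 2)%E by [].
rewrite (L2normC_weighted r mp) (L2normC_weighted s mq) /L2normC sqr_L2norm.
have w0 t g x : (0 <= (Delta x `^ t * normc (g x) ^+ 2)%:E)%E.
  by rewrite lee_fin mulr_ge0 ?powR_ge0// sqr_ge0.
have mw t g : measurable_cplx g ->
    measurable_fun setT (fun x => (Delta x `^ t * normc (g x) ^+ 2)%:E).
  by move=> mg; apply/measurable_EFinP; exact: measurable_weighted.
have mr := measurable_residual mU mK mp mq.
have mr' : measurable_fun setT (fun x => (normc (hf x - (p x + hU x) * (q x + hK x)) ^+ 2)%:E).
  exact/measurable_EFinP.
rewrite -(@ge0_integralZl _ _ _ mu2 _ measurableT _ (mw r p mp) l%:E)//; last by rewrite lee_fin ltW.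
rewrite -(@ge0_integralZl _ _ _ mu2 _ measurableT _ (mw s q mq) m%:E)//; last by rewrite lee_fin ltW.
have mlw t g c : measurable_cplx g ->
    measurable_fun setT (fun x => (c%:E * (Delta x `^ t * normc (g x) ^+ 2)%:E)%E).
  move=> mg; under eq_fun do rewrite -EFinM.
  by apply/measurable_EFinP; apply: measurable_funM => //; exact: measurable_weighted.
have lw0 t g c x : 0 < c -> (0 <= c%:E * (Delta x `^ t * normc (g x) ^+ 2)%:E)%E.
  by move=> c0; rewrite mule_ge0// lee_fin ltW.
rewrite -(@ge0_integralD _ _ _ mu2 _ measurableT)//; [|by move=> x _; rewrite lee_fin sqr_ge0|by move=> x _; exact: lw0|exact: mlw].
rewrite -(@ge0_integralD _ _ _ mu2 _ measurableT)//; last 4 first.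
- by move=> x _; rewrite adde_ge0 ?lw0// lee_fin sqr_ge0.
- by apply: emeasurable_funD => //; exact: mlw.
- by move=> x _; exact: lw0.
- exact: mlw.
by apply: eq_integral => x _; rewrite /Jx !EFinD !EFinM !muleA.
Qed.

Lemma fourier_energy_le hU hK p q hU' hK' p' q' :
  measurable_cplx hU -> measurable_cplx hK -> measurable_cplx p -> measurable_cplx q ->
  measurable_cplx hU' -> measurable_cplx hK' -> measurable_cplx p' -> measurable_cplx q' ->
  (\forall x \ae mu2, Jx r s l m hf hU hK p q x <= Jx r s l m hf hU' hK' p' q' x) ->
  (fourier_energy r s l m hf hU hK (p, q) <= fourier_energy r s l m hf hU' hK' (p', q'))%E.
Proof.
move=> mU mK mp mq mU' mK' mp' mq' le; rewrite !fourier_energyE//.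
apply: (@ae_ge0_le_integral _ _ _ mu2) => //.
- by move=> x _; rewrite lee_fin Jx_ge0.
- by apply/measurable_EFinP; exact: measurable_Jx.
- by move=> x _; rewrite lee_fin Jx_ge0.
- by apply/measurable_EFinP; exact: measurable_Jx.
by have := le; apply: filterS => x h _; rewrite lee_fin.
Qed.

Lemma fourier_energy_ae hU hK p q hU' hK' p' q' :
  measurable_cplx hU -> measurable_cplx hK -> measurable_cplx p -> measurable_cplx q ->
  measurable_cplx hU' -> measurable_cplx hK' -> measurable_cplx p' -> measurable_cplx q' ->
  hU = hU' %[ae mu2] -> hK = hK' %[ae mu2] -> p = p' %[ae mu2] -> q = q' %[ae mu2] ->
  fourier_energy r s l m hf hU hK (p, q) = fourier_energy r s l m hf hU' hK' (p', q').
Proof.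
move=> mU mK mp mq mU' mK' mp' mq' eU eK ep eq.
have E : \forall x \ae mu2, Jx r s l m hf hU hK p q x = Jx r s l m hf hU' hK' p' q' x.
  have e1 : \forall x \ae mu2, hU x = hU' x /\ hK x = hK' x.
    by apply: filterS2 eU eK => x a b; split; [exact: a|exact: b].
  have e2 : \forall x \ae mu2, p x = p' x /\ q x = q' x.
    by apply: filterS2 ep eq => x a b; split; [exact: a|exact: b].
  by apply: filterS2 e1 e2 => x [a b] [c d]; rewrite /Jx a b c d.
apply/eqP; rewrite eq_le; apply/andP; split; apply: fourier_energy_le => //;
  by have := E; apply: filterS => x ->.
Qed.

End integral_form.

(** The bridge from convolutions to products of transforms. It holds also when the energies are
    infinite, so minimality may be tested against arbitrary pairs in L2. *)
Lemma energyE (r s l m : R) f U K u k : inL2 f -> inL2 U -> inL2 K -> inL2 u -> inL2 k ->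
  energy r s l m f U K (u, k) = fourier_energy r s l m (hat f) (hat U) (hat K) (hat u, hat k).
Proof.
move=> hf hU hK hu hk.
have -> : energy r s l m f U K (u, k) =
  (L2norm (f \- convolution (k \+ K) (u \+ U))%R ^+ 2
   + l%:E * sobolev_sqnorm r u + m%:E * sobolev_sqnorm s k)%E by [].
have -> : fourier_energy r s l m (hat f) (hat U) (hat K) (hat u, hat k) =
  (L2normC (hat f \- (hat u \+ hat U) \* (hat k \+ hat K))%R ^+ 2
   + l%:E * L2normC (fun x => (Delta x `^ (r / 2))%:C * hat u x)%R ^+ 2
   + m%:E * L2normC (fun x => (Delta x `^ (s / 2))%:C * hat k x)%R ^+ 2)%E by [].
have mh (w : R * R -> R) : inL2 w -> measurable_cplx (hat w) by move=> /hat_inL2C; exact: measurable_cplx_inL2C.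
congr (_ + _ + _)%E; last 2 first.
- by rewrite L2normC_weighted//; exact: mh.
- by rewrite L2normC_weighted//; exact: mh.
have /inL2P f2 := hf; have /inL2P k2 := inL2D hk hK; have /inL2P u2 := inL2D hu hU.
pose A x := HT f x - hprod (HT (k \+ K)) (HT (u \+ U)) x.
have mA : measurable_fun setT A.
  apply: measurable_funB; first exact: L2f_meas (HT_L2 f2).
  by apply: (@intg_meas _ _ _ mu2); apply: intg_hprod; exact: HT_L2.
have mh' (w : R * R -> R) : L2f mu2 w -> measurable_cplx (hatc w).
  by move=> /inL2C_hatc; exact: measurable_cplx_inL2C.
have mhatA : measurable_cplx (hatc (HT f) \- hatc (HT (u \+ U)) \* hatc (HT (k \+ K))).
  by apply: measurable_cplxB; [|apply: measurable_cplxM]; apply: mh'; exact: HT_L2.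
rewrite sqr_L2norm convolution_plancherel//.
transitivity (L2normC (hatc (HT f) \- hatc (HT (u \+ U)) \* hatc (HT (k \+ K)))%R ^+ 2)%E; last first.
  apply: ae_L2normC => //.
    by apply: measurable_cplxB; [exact: mh|apply: measurable_cplxM; apply: measurable_cplxD; exact: mh].
  have [_ e1] := hat_spec hf; have [_ e2] := hat_spec (inL2D hu hU).
  have [_ e3] := hat_spec (inL2D hk hK).
  have e4 := hatD hu hU; have e5 := hatD hk hK.
  have e24 : hatc (HT (u \+ U)) = hat u \+ hat U %[ae mu2].
    by apply: filterS2 e2 e4 => x a b xT; rewrite -a// b.
  have e35 : hatc (HT (k \+ K)) = hat k \+ hat K %[ae mu2].
    by apply: filterS2 e3 e5 => x a b xT; rewrite -a// b.
  by apply: filterS3 e1 e24 e35 => x a b c xT /=; rewrite a// b// c.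
rewrite sqr_L2normC.
(* |hatc A|^2 at x is the mean of A(x)^2 and A(-x)^2, and a reflection equates the two integrals.
   [A] need not be in L2, so integrals of nonnegative functions are used in place of [sq_hatc]. *)
have -> : (\int[mu2]_x (complex.Re ((hatc (HT f) \- hatc (HT (u \+ U)) \* hatc (HT (k \+ K)))%R x) ^+ 2 +
    complex.Im ((hatc (HT f) \- hatc (HT (u \+ U)) \* hatc (HT (k \+ K)))%R x) ^+ 2)%:E =
    \int[mu2]_x ((2^-1 * A x ^+ 2)%:E + (2^-1 * A (- x) ^+ 2)%:E))%E.
  apply: eq_integral => x _; rewrite -EFinD; congr EFin.
  rewrite (_ : (hatc (HT f) \- _) x = hatc A x); last first.
    by rewrite /A hatcB hatcM /= [in RHS]mulrC.
  by rewrite /hatc /=; field.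
have mA2 : measurable_fun setT (fun x => (2^-1 * A x ^+ 2)%:E).
  by apply/measurable_EFinP; apply: measurable_funM => //; exact: measurable_funX.
have A20 x : (0 <= (2^-1 * A x ^+ 2)%:E)%E by rewrite lee_fin mulr_ge0 ?sqr_ge0.
have n1 : (-1 : R) != 0 by rewrite oppr_eq0 oner_eq0.
have eN x : aff (-1) 0 x = - x by rewrite affN1 sub0r.
have mA2' : measurable_fun setT (fun x => (2^-1 * A (- x) ^+ 2)%:E).
  have := measurableT_comp mA2 (@measurable_aff R (-1) 0).
  by apply: eq_measurable_fun => x _ /=; rewrite eN.
rewrite (@ge0_integralD _ _ _ mu2 _ measurableT)//.
have h := ge0_integral_aff 0 n1 mA2 A20; rewrite sqrrN expr1n invr1 mul1e in h.
have -> : (\int[mu2]_x (2^-1 * A (- x) ^+ 2)%:E = \int[mu2]_x (2^-1 * A x ^+ 2)%:E)%E.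
  by rewrite -h; apply: eq_integral => x _; rewrite eN.
have <- := @ge0_integralD _ _ _ mu2 _ measurableT _ _ (fun x _ => A20 x) mA2 (fun x _ => A20 x) mA2.
by apply: eq_integral => x _; rewrite -EFinD; congr EFin; rewrite /A; field.
Qed.

End fourier_energy.

(** * From complex to real minimisation at one frequency *)

Section complex_minimization.
Context (R : realType).
Notation normc := (@Normc.normc R).
Implicit Types (z w p q : R[i]) (a U K l m P Q : R).

Lemma normcN z : normc (- z) = normc z.
Proof. by case: z => x y /=; rewrite !sqrrN. Qed.

Lemma normc_conj z : normc z^* = normc z.
Proof. by case: z => x y /=; rewrite sqrrN. Qed.

Lemma normc_eq0 z : (normc z == 0) = (z == 0).
Proof.
apply/eqP/eqP => [|->]; first exact: Normc.eq0_normc.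
exact: Normc.normc0.
Qed.

Lemma sqr_normcB_ge z w : (normc z - normc w) ^+ 2 <= normc (z - w) ^+ 2.
Proof.
rewrite -(real_normK (num_real (normc z - normc w))) lerXn2r ?nnegrE ?normc_ge0//.
rewrite ler_norml; apply/andP; split.
  have := le_normcD (z : Rcomplex R) (w - z : Rcomplex R).
  rewrite addrC subrK -[normc (w - z)]normcN opprB => h; lra.
have := le_normcD (w : Rcomplex R) (z - w : Rcomplex R).
rewrite addrC subrK => h; lra.
Qed.

Lemma sgnCE z : sgnC z = ((normc z)^-1)%:C * z.
Proof.
rewrite /sgnC; case: eqP => [->|_]; first by rewrite mulr0.
rewrite mulrC; congr (_ * _); case: z => x y.
by rewrite normc_def /= fmorphV.
Qed.

Lemma sgnC_normc z : sgnC z * (normc z)%:C = z.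
Proof.
have [->|z0] := eqVneq z 0; first by rewrite Normc.normc0 mulr0.
rewrite sgnCE mulrAC -rmorphM mulVf ?mul1r//.
by rewrite normc_eq0.
Qed.

Lemma normc_sgnC z : z != 0 -> normc (sgnC z) = 1.
Proof.
move=> z0; have n0 : normc z != 0 by rewrite normc_eq0.
by rewrite sgnCE Normc.normcM normc_real ger0_norm ?invr_ge0 ?normc_ge0// mulVf.
Qed.

Lemma normc_sgnC_le z : normc (sgnC z) <= 1.
Proof.
have [->|z0] := eqVneq z 0; last by rewrite normc_sgnC.
by rewrite sgnCE mulr0 Normc.normc0.
Qed.

Lemma sqr_normc_sgnCM_le z (t : R) : normc (sgnC z * t%:C) ^+ 2 <= t ^+ 2.
Proof.
rewrite Normc.normcM normc_real exprMn real_normK ?num_real// ler_piMl ?sqr_ge0//.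
by rewrite expr_le1 ?normc_sgnC_le ?normc_ge0.
Qed.

Lemma sgnC_conj z : sgnC z^* = (sgnC z)^*.
Proof.
rewrite !sgnCE normc_conj; move: (_^-1) => t; case: z => x y; apply/eqP.
by rewrite eq_complex /= !mul0r !subr0 !addr0 mulrN !eqxx.
Qed.

Lemma sgnC_sgnCM z (t : R) : z != 0 -> 0 < t -> sgnC (sgnC z * t%:C) = sgnC z.
Proof.
move=> z0 t0; rewrite [LHS]sgnCE Normc.normcM normc_sgnC// mul1r normc_real gtr0_norm//.
by rewrite mulrCA -rmorphM mulVf ?gt_eqF// mulr1.
Qed.

Lemma real_complex_ge0 (t : R) : (0 <= t%:C) = (0 <= t).
Proof. by rewrite lecE /= eqxx. Qed.

Lemma ge0_normc z : 0 <= z -> z = (normc z)%:C.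
Proof.
case: z => x y; rewrite lecE /= => /andP[/eqP -> x0].
by rewrite expr0n addr0 sqrtr_sqr ger0_norm.
Qed.

Definition Jz l m z zU zK p q : R :=
  normc (z - (p + zU) * (q + zK)) ^+ 2 + l * normc p ^+ 2 + m * normc q ^+ 2.

(** Equality holds for z nonzero; at z = 0 the sign vanishes and with it every trace of P and U on
    the left. *)
Lemma Jz_le_scal l m z U K P Q : 0 < l -> 0 < m ->
  Jz l m z (sgnC z * U%:C) K%:C (sgnC z * (P - U)%:C) (Q - K)%:C <= scal (normc z) U K l m P Q.
Proof.
move=> l0 m0; rewrite /Jz /scal.
rewrite -mulrDr -!rmorphD !subrK -[X in X - _](sgnC_normc z) -mulrA -rmorphM -mulrBr -rmorphB.
rewrite !lerD//; first exact: sqr_normc_sgnCM_le.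
  by rewrite ler_wpM2l ?(ltW l0)//; exact: sqr_normc_sgnCM_le.
by rewrite normc_real real_normK ?num_real.
Qed.

(** Three reverse triangle inequalities: passing to the moduli of the updated values p + zU and q +
    zK never increases the objective. *)
Lemma scal_le_Jz l m z zU zK p q : 0 < l -> 0 < m ->
  scal (normc z) (normc zU) (normc zK) l m (normc (p + zU)) (normc (q + zK)) <= Jz l m z zU zK p q.
Proof.
move=> l0 m0; rewrite /Jz /scal !lerD//.
- by rewrite -Normc.normcM; exact: sqr_normcB_ge.
- rewrite ler_wpM2l ?(ltW l0)//; apply: le_trans (sqr_normcB_ge _ _) _.
  by rewrite addrK.
- rewrite ler_wpM2l ?(ltW m0)//; apply: le_trans (sqr_normcB_ge _ _) _.
  by rewrite addrK.
Qed.

(* What the iterates satisfy at almost every frequency, for the data value [z]. *)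
Definition aligned z zU zK :=
  [/\ 0 <= zK, zU = sgnC z * (normc zU)%:C & normc zU * normc zK <= normc z].

Definition optQ l m z zU zK : R := bestQ (normc z) (normc zU) (normc zK) l m.
Definition optP l m z zU zK : R := bestP (normc z) (normc zU) l (optQ l m z zU zK).
Definition optu l m z zU zK : R[i] := sgnC z * (optP l m z zU zK - normc zU)%:C.
Definition optk l m z zU zK : R[i] := (optQ l m z zU zK - normc zK)%:C.

(** Alignment makes [Jz_le_scal] applicable to zU and zK, so the complex objective lies between real
    ones: Jz at the optimum <= scal at (P, Q) <= scal at the moduli <= Jz at (p, q). *)
Lemma opt_spec l m z zU zK : 0 < l -> 0 < m -> aligned z zU zK ->
  let P := optP l m z zU zK in let Q := optQ l m z zU zK in
  [/\ normc zK <= Q, normc zU <= P, P * Q <= normc z &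
    forall p q, Jz l m z zU zK (optu l m z zU zK) (optk l m z zU zK) <= Jz l m z zU zK p q].
Proof.
move=> l0 m0 [zK0 eU UK] P Q.
have [KQ UQ Qm] := bestQ_spec (normc_ge0 z) (normc_ge0 zU) (normc_ge0 zK) l0 m0 UK.
have Q0 : 0 <= Q by apply: le_trans KQ; exact: normc_ge0.
have [UP PQ] := bestP_spec (normc_ge0 z) (normc_ge0 zU) l0 Q0 UQ.
split=> // p q; apply: le_trans (scal_le_Jz z zU zK p q l0 m0).
apply: le_trans (Qm _ _ (normc_ge0 _)).
have := Jz_le_scal z (normc zU) (normc zK) P Q l0 m0.
by rewrite -eU -(ge0_normc zK0).
Qed.

(** Comparison with p = q = 0, where the objective is at most |z|^2 by alignment. This domination by
    the data is what puts the increments in L2. *)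
Lemma Jz_opt_le l m z zU zK : 0 < l -> 0 < m -> aligned z zU zK ->
  l * normc (optu l m z zU zK) ^+ 2 <= normc z ^+ 2 /\
  m * normc (optk l m z zU zK) ^+ 2 <= normc z ^+ 2.
Proof.
move=> l0 m0 al; have [_ _ _ /(_ 0 0)] := opt_spec l0 m0 al.
case: al => zK0 eU UK; set pu := optu _ _ _ _ _; set qk := optk _ _ _ _ _.
have J0 : Jz l m z zU zK 0 0 <= normc z ^+ 2.
  rewrite /Jz !add0r Normc.normc0 expr0n !mulr0 !addr0.
  rewrite eU (ge0_normc zK0) -[X in X - _](sgnC_normc z) -mulrA -rmorphM -mulrBr -rmorphB.
  apply: le_trans (sqr_normc_sgnCM_le _ _) _.
  have h := mulr_ge0 (normc_ge0 zU) (normc_ge0 zK); have h' := normc_ge0 z.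
  by rewrite lerXn2r ?nnegrE ?subr_ge0// lerBlDr lerDl.
rewrite {1}/Jz => h1.
have h2 := sqr_ge0 (normc (z - (pu + zU) * (qk + zK))).
have h3 : 0 <= l * normc pu ^+ 2 by rewrite mulr_ge0 ?sqr_ge0// ltW.
have h4 : 0 <= m * normc qk ^+ 2 by rewrite mulr_ge0 ?sqr_ge0// ltW.
by split; lra.
Qed.

Lemma aligned_opt l m z zU zK : 0 < l -> 0 < m -> aligned z zU zK ->
  aligned z (zU + optu l m z zU zK) (zK + optk l m z zU zK).
Proof.
move=> l0 m0 al; have [KQ UP PQ _] := opt_spec l0 m0 al.
case: al => zK0 eU UK; set P := optP l m z zU zK in UP PQ; set Q := optQ l m z zU zK in KQ PQ.
have Q0 : 0 <= Q by apply: le_trans KQ; exact: normc_ge0.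
have P0 : 0 <= P by apply: le_trans UP; exact: normc_ge0.
have -> : zU + optu l m z zU zK = sgnC z * P%:C.
  by rewrite {1}eU /optu -mulrDr -rmorphD addrC subrK.
have -> : zK + optk l m z zU zK = Q%:C.
  by rewrite {1}(ge0_normc zK0) /optk -rmorphD addrC subrK.
(* At z = 0 the modulus of [sgnC z * P%:C] is 0 instead of [P], so this case is separate. *)
have [z0|z0] := eqVneq z 0.
  have s0 : sgnC z = 0 by rewrite z0 sgnCE mulr0.
  by split; rewrite ?real_complex_ge0// s0 !mul0r// Normc.normc0 ?mul0r ?normc_ge0.
split; first by rewrite real_complex_ge0.
- by rewrite Normc.normcM normc_sgnC// mul1r normc_real ger0_norm.
- by rewrite Normc.normcM normc_sgnC// mul1r !normc_real !ger0_norm.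
Qed.

Definition initP a l m : R := Num.sqrt (Num.max (Num.sqrt (m / l) * a - m) 0).

Lemma initPE a l m : 0 < l -> 0 < m ->
  initP a l m ^+ 2 = Num.sqrt m / Num.sqrt l * Num.max (a - Num.sqrt l * Num.sqrt m) 0.
Proof.
move=> l0 m0; rewrite /initP sqr_sqrtr ?le_max ?lexx ?orbT//.
have sl : 0 < Num.sqrt l by rewrite sqrtr_gt0.
have sm : 0 < Num.sqrt m by rewrite sqrtr_gt0.
rewrite maxr_pMr ?divr_ge0 ?ltW// mulr0; congr Num.max.
rewrite sqrtrM ?(ltW m0)// sqrtrV ?(ltW l0)// mulrBr; congr (_ - _).
rewrite -{1}(sqr_sqrtr (ltW m0)); move: (Num.sqrt l) (Num.sqrt m) sl => x y x0.
by field; rewrite lt0r_neq0.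
Qed.

Lemma initP_ge0 a l m : 0 <= initP a l m. Proof. exact: sqrtr_ge0. Qed.

Lemma initPM a l m : 0 < l -> 0 < m ->
  initP a l m * initP a m l = Num.max (a - Num.sqrt l * Num.sqrt m) 0.
Proof.
move=> l0 m0.
have sl : 0 < Num.sqrt l by rewrite sqrtr_gt0.
have sm : 0 < Num.sqrt m by rewrite sqrtr_gt0.
apply/eqP; rewrite -(@eqrXn2 _ 2)// ?mulr_ge0 ?initP_ge0 ?le_max ?lexx ?orbT//.
rewrite exprMn !initPE// [Num.sqrt m * Num.sqrt l]mulrC; apply/eqP.
move: (Num.max _ _) => t; field.
by rewrite !lt0r_neq0.
Qed.

(** With u = P Q and k = sqrt (l m), the inequality l P^2 + m Q^2 >= 2 k u leaves (a - u)^2 + 2 k u,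
    minimal over u >= 0 at the positive part of a - k. The initial pair has this product by [initPM]
    and balances the penalties, so equality holds for it. *)
Lemma init_min a l m P Q : 0 <= a -> 0 < l -> 0 < m -> 0 <= P -> 0 <= Q ->
  scal a 0 0 l m (initP a l m) (initP a m l) <= scal a 0 0 l m P Q.
Proof.
move=> a0 l0 m0 P0 Q0; rewrite /scal !subr0 initPM// !initPE// [Num.sqrt m * Num.sqrt l]mulrC.
have sl : 0 < Num.sqrt l by rewrite sqrtr_gt0.
have sm : 0 < Num.sqrt m by rewrite sqrtr_gt0.
have el : l = Num.sqrt l ^+ 2 by rewrite sqr_sqrtr// ltW.
have em : m = Num.sqrt m ^+ 2 by rewrite sqr_sqrtr// ltW.
rewrite [X in _ + X * _ + _ <= _]el [X in _ + X * _ <= _]em.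
rewrite [X in _ <= _ + X * _ + _]el [X in _ <= _ + X * _]em.
move: (Num.sqrt l) (Num.sqrt m) sl sm => x y x0 y0.
set t := Num.max _ _.
have -> : x ^+ 2 * (y / x * t) = x * y * t by field; rewrite lt0r_neq0.
have -> : y ^+ 2 * (x / y * t) = x * y * t by field; rewrite lt0r_neq0.
have h1 : 2 * (x * y) * (P * Q) <= x ^+ 2 * P ^+ 2 + y ^+ 2 * Q ^+ 2.
  by have := sqr_ge0 (x * P - y * Q); nra.
have PQ0 : 0 <= P * Q by rewrite mulr_ge0.
have xy0 : 0 < x * y by rewrite mulr_gt0.
move: (P * Q) (x * y) h1 PQ0 xy0 @t => u k h1 u0 k0 t.
have [h|h] := leP (a - k) 0; rewrite /t ?(max_r h) ?(max_l (ltW h)).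
  by have := sqr_ge0 u; nra.
by have := sqr_ge0 (u - (a - k)); nra.
Qed.

Lemma init_spec l m z : 0 < l -> 0 < m ->
  let zU := sgnC z * (initP (normc z) l m)%:C in let zK := (initP (normc z) m l)%:C in
  aligned z zU zK /\ (forall p q, Jz l m z 0 0 zU zK <= Jz l m z 0 0 p q).
Proof.
move=> l0 m0; set P := initP _ l m; set Q := initP _ m l => zU zK.
have P0 : 0 <= P by exact: initP_ge0.
have Q0 : 0 <= Q by exact: initP_ge0.
have PQ : P * Q <= normc z.
  rewrite initPM// ge_max normc_ge0 andbT lerBlDr lerDl mulr_ge0//; exact: sqrtr_ge0.
split.
  rewrite /zU /zK; have [z0|z0] := eqVneq z 0.
    have s0 : sgnC z = 0 by rewrite z0 sgnCE mulr0.
    by split; rewrite ?real_complex_ge0// s0 !mul0r// Normc.normc0 ?mul0r ?normc_ge0.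
  split; first by rewrite real_complex_ge0.
  - by rewrite Normc.normcM normc_sgnC// mul1r normc_real ger0_norm.
  - by rewrite Normc.normcM normc_sgnC// mul1r !normc_real !ger0_norm.
move=> p q; apply: le_trans (scal_le_Jz z 0 0 p q l0 m0); rewrite Normc.normc0.
apply: le_trans (init_min (normc_ge0 z) l0 m0 (normc_ge0 _) (normc_ge0 _)).
have := Jz_le_scal z 0 0 P Q l0 m0.
by rewrite !subr0 rmorph0 mulr0.
Qed.

End complex_minimization.

(** * Measurability of the scalar solutions in their data *)

Section measurable_minimizer.
Context d (T : measurableType d) (R : realType).
Implicit Types (a U K l m q : T -> R).
Local Notation mf := (measurable_fun [set: T]).

Lemma measurable_inv_ge0 q : (forall x, 0 <= q x) -> mf q -> mf (fun x => (q x)^-1).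
Proof.
move=> q0 mq; apply: (@eq_measurable_fun _ _ _ _ _ (fun x => q x `^ (-1))).
  by move=> x _; rewrite powR_inv1.
by apply: (@measurableT_comp _ _ _ _ _ _ (fun y : R => y `^ (-1))) => //; exact: measurable_powR.
Qed.

Lemma measurable_sqrt q : mf q -> mf (fun x => Num.sqrt (q x)).
Proof.
apply: (@measurableT_comp _ _ _ _ _ _ (fun t : R => Num.sqrt t)).
exact: continuous_measurable_fun (@sqrt_continuous R).
Qed.

Lemma measurable_inv_den l q : (forall x, 0 < l x) -> mf l -> mf q ->
  mf (fun x => (q x ^+ 2 + l x)^-1).
Proof.
move=> l0 ml mq; apply: measurable_inv_ge0 => [x|]; first by rewrite addr_ge0 ?sqr_ge0 ?ltW.
by apply: measurable_funD => //; exact: measurable_funX.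
Qed.

Lemma measurable_bestP a U l q : (forall x, 0 < l x) -> mf a -> mf U -> mf l -> mf q ->
  mf (fun x => bestP (a x) (U x) (l x) (q x)).
Proof.
move=> l0 ma mU ml mq; apply: measurable_funM; last exact: measurable_inv_den.
by apply: measurable_funD; exact: measurable_funM.
Qed.

Lemma measurable_redu a U K l m q : (forall x, 0 < l x) -> mf a -> mf U -> mf K -> mf l ->
  mf m -> mf q -> mf (fun x => redu (a x) (U x) (K x) (l x) (m x) (q x)).
Proof.
move=> l0 ma mU mK ml mm mq; apply: measurable_funD; last first.
  by apply: measurable_funM => //; apply: measurable_funX; exact: measurable_funB.
apply: measurable_funM; last exact: measurable_inv_den.
apply: measurable_funM => //; apply: measurable_funX; apply: measurable_funB => //.
exact: measurable_funM.
Qed.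

Lemma measurable_bestQ a U K l m : (forall x, 0 < l x) -> (forall x, 0 < m x) -> mf a ->
  mf U -> mf K -> mf l -> mf m -> mf (fun x => bestQ (a x) (U x) (K x) (l x) (m x)).
Proof.
move=> l0 m0 ma mU mK ml mm.
have mw : mf (fun x => width (a x) (m x)).
  apply: measurable_funM => //; apply: measurable_inv_ge0 => [x|]; first exact: sqrtr_ge0.
  exact: measurable_sqrt.
apply: measurable_funD => //; apply: measurable_funM => //.
apply: (@measurable_tmin R _ T (fun x t =>
  redu (a x) (U x) (K x) (l x) (m x) (K x + t * width (a x) (m x)))) => [t|x].
  apply: measurable_redu => //; apply: measurable_funD => //.
  exact: measurable_funM.
exact: continuous_redu.
Qed.

Lemma measurable_initP a l m : (forall x, 0 < l x) -> mf a -> mf l -> mf m ->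
  mf (fun x => initP (a x) (l x) (m x)).
Proof.
move=> l0 ma ml mm; apply: measurable_sqrt.
apply: (@measurable_maxr _ _ _ _ (fun x => Num.sqrt (m x / l x) * a x - m x) (fun=> 0)) => //.
apply: measurable_funB => //; apply: measurable_funM => //; apply: measurable_sqrt.
by apply: measurable_funM => //; apply: measurable_inv_ge0 => // x; rewrite ltW.
Qed.

End measurable_minimizer.

(** * Measurability and square-integrability of complex increments *)

Section measurable_increments.
Context (R : realType).
Notation mu2 := (@lebesgue2 R).
Notation normc := (@Normc.normc R).
Implicit Types (g h hf hU hK : R * R -> R[i]) (l m t : R * R -> R).

Lemma measurable_cplx_real t : measurable_fun setT t -> measurable_cplx (fun x => (t x)%:C).
Proof. by []. Qed.

Lemma measurable_cplx_sgnC h : measurable_cplx h -> measurable_cplx (fun x => sgnC (h x)).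
Proof.
move=> mh.
have mi : measurable_fun setT (fun x => (normc (h x))^-1).
  by apply: measurable_inv_ge0 => [x|]; [exact: normc_ge0|exact: measurable_normc].
have := measurable_cplxM (measurable_cplx_real mi) mh.
by rewrite (_ : _ \* _ = (fun x => sgnC (h x)))//; apply/funext => x; rewrite sgnCE.
Qed.

Section optimal.
Variables (hf hU hK : R * R -> R[i]) (l m : R * R -> R).
Hypotheses (mf : measurable_cplx hf) (mU : measurable_cplx hU) (mK : measurable_cplx hK).
Hypotheses (ml : measurable_fun setT l) (mm : measurable_fun setT m).
Hypotheses (l0 : forall x, 0 < l x) (m0 : forall x, 0 < m x).

Lemma measurable_optQ : measurable_fun setT (fun x => optQ (l x) (m x) (hf x) (hU x) (hK x)).
Proof. by apply: measurable_bestQ => //; exact: measurable_normc. Qed.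

Lemma measurable_optk : measurable_cplx (fun x => optk (l x) (m x) (hf x) (hU x) (hK x)).
Proof.
apply: measurable_cplx_real; apply: measurable_funB; first exact: measurable_optQ.
exact: measurable_normc.
Qed.

Lemma measurable_optu : measurable_cplx (fun x => optu (l x) (m x) (hf x) (hU x) (hK x)).
Proof.
have mP : measurable_fun setT (fun x => optP (l x) (m x) (hf x) (hU x) (hK x)).
  apply: measurable_bestP => //; [exact: measurable_normc|exact: measurable_normc|].
  exact: measurable_optQ.
apply: (@measurable_cplxM _ (fun x => sgnC (hf x))); first exact: measurable_cplx_sgnC.
apply: measurable_cplx_real; apply: measurable_funB => //; exact: measurable_normc.
Qed.

End optimal.

Lemma ae_le_inL2C (c : R) g h : 0 < c -> measurable_cplx g -> inL2C h ->
  (\forall x \ae mu2, c * normc (g x) ^+ 2 <= normc (h x) ^+ 2) -> inL2C g.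
Proof.
move=> c0 mg hh le.
suff ng : L2f mu2 (fun x => normc (g x)).
  apply/inL2CP; case: mg => mr mi; split; apply: L2f_le ng => // x;
    rewrite (ger0_norm (normc_ge0 _)) -(ger0_norm (normc_ge0 (g x)));
    rewrite -ler_sqr ?nnegrE// !real_normK ?num_real// normc_sqr ?lerDl ?lerDr sqr_ge0//.
have [nh _] := L2f_normc hh.
split; first exact: measurable_normc.
have [mh h2] := L2fZ (Num.sqrt c^-1) nh.
apply/ge0_intgP; first by apply: measurable_funX; exact: measurable_normc.
  by move=> x; exact: sqr_ge0.
have := (@ge0_intgP _ _ _ mu2 _ (measurable_funX 2 mh) (fun x => sqr_ge0 _)).1 h2.
apply: le_lt_trans.
apply: (@ae_ge0_le_integral _ _ _ mu2) => //.
- by move=> x _; rewrite lee_fin sqr_ge0.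
- by apply/measurable_EFinP; apply: measurable_funX; exact: measurable_normc.
- by move=> x _; rewrite lee_fin sqr_ge0.
- by apply/measurable_EFinP; exact: measurable_funX.
apply: filterS le => x le _; rewrite lee_fin exprMn sqr_sqrtr ?invr_ge0 ?(ltW c0)//.
by rewrite ler_pdivlMl.
Qed.

End measurable_increments.

(** * Initial pair, iteration step and transfer to real functions *)

Section scheme.
Context (R : realType).
Notation mu2 := (@lebesgue2 R).
Notation normc := (@Normc.normc R).
Implicit Types (z zU zK p q : R[i]) (u k : R * R -> R).

Lemma conjc_realM z (t : R) : (z * t%:C)^* = z^* * t%:C.
Proof.
by case: z => x y; apply/eqP; rewrite eq_complex /= !mulr0 !subr0 !add0r mulNr !eqxx.
Qed.

Lemma optu_conj (l m : R) z zU zK : optu l m z^* zU^* zK^* = (optu l m z zU zK)^*.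
Proof.
by rewrite /optu /optP /optQ !normc_conj sgnC_conj conjc_realM.
Qed.

Lemma optk_conj (l m : R) z zU zK : optk l m z^* zU^* zK^* = optk l m z zU zK.
Proof. by rewrite /optk /optQ !normc_conj. Qed.

Lemma opt_hermitian (l m : R) z z' zU zU' zK zK' : z = z'^* -> zU = zU'^* -> zK = zK'^* ->
  optu l m z zU zK = (optu l m z' zU' zK')^* /\ optk l m z zU zK = optk l m z' zU' zK'.
Proof. by move=> -> -> ->; rewrite optu_conj optk_conj. Qed.

Lemma init_le (l m : R) z : 0 < l -> 0 < m ->
  l * normc (sgnC z * (initP (normc z) l m)%:C) ^+ 2 <= normc z ^+ 2 /\
  m * normc (initP (normc z) m l)%:C ^+ 2 <= normc z ^+ 2.
Proof.
move=> l0 m0; have [_ /(_ 0 0)] := init_spec z l0 m0.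
set p := _ * _; set q := _%:C; rewrite /Jz !addr0 !mul0r subr0 Normc.normc0 expr0n !mulr0 !addr0.
have := sqr_ge0 (normc (z - p * q)).
have : 0 <= l * normc p ^+ 2 by rewrite mulr_ge0 ?sqr_ge0// ltW.
have : 0 <= m * normc q ^+ 2 by rewrite mulr_ge0 ?sqr_ge0// ltW.
by move=> h1 h2 h3 h4; split; lra.
Qed.

Section parameters.
Variables (r s l m : R) (f : R * R -> R).
Hypotheses (r0 : 0 <= r) (s0 : 0 <= s) (l0 : 0 < l) (m0 : 0 < m) (hf : inL2 f).

Let lx x : R := l * Delta x `^ r.
Let mx x : R := m * Delta x `^ s.

Let lx0 x : 0 < lx x. Proof. by rewrite mulr_gt0// powDelta_gt0. Qed.
Let mx0 x : 0 < mx x. Proof. by rewrite mulr_gt0// powDelta_gt0. Qed.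
Let mlx : measurable_fun setT lx.
Proof. by apply: measurable_funM => //; exact: measurable_powDelta. Qed.
Let mmx : measurable_fun setT mx.
Proof. by apply: measurable_funM => //; exact: measurable_powDelta. Qed.
(** Since r is nonnegative the weight is at least 1, so pointwise bounds with the
    frequency-dependent [lx] yield bounds with the constant l, as [ae_le_inL2C] needs. *)
Let lxE x (t : R) : 0 <= t -> l * t <= lx x * t.
Proof. by move=> t0; rewrite ler_wpM2r// ler_peMr ?(ltW l0)// powDelta_ge1. Qed.
Let mxE x (t : R) : 0 <= t -> m * t <= mx x * t.
Proof. by move=> t0; rewrite ler_wpM2r// ler_peMr ?(ltW m0)// powDelta_ge1. Qed.
Let mhat u : inL2 u -> measurable_cplx (hat u).
Proof. by move=> hu; exact: measurable_cplx_inL2C (hat_inL2C hu). Qed.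

Lemma hatU0E x : hatU0 r s l m f x = sgnC (hat f x) * (initP (normc (hat f x)) (lx x) (mx x))%:C.
Proof.
rewrite /hatU0 /initP powRB ?(lt0r_neq0 (Delta_gt0 x)) ?implybT//.
rewrite (_ : m / l * (Delta x `^ s / Delta x `^ r) = mx x / lx x)//.
by rewrite /mx /lx invfM mulrACA.
Qed.

Lemma hatK0E x : hatK0 r s l m f x = (initP (normc (hat f x)) (mx x) (lx x))%:C.
Proof.
rewrite /hatK0 /initP powRB ?(lt0r_neq0 (Delta_gt0 x)) ?implybT//.
rewrite (_ : l / m * (Delta x `^ r / Delta x `^ s) = lx x / mx x)//.
by rewrite /mx /lx invfM mulrACA.
Qed.

Lemma init_exists : exists p : (R * R -> R) * (R * R -> R),
  [/\ inL2 p.1 /\ inL2 p.2, \forall x \ae mu2, aligned (hat f x) (hat p.1 x) (hat p.2 x),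
     hat p.1 = hatU0 r s l m f %[ae mu2] & hat p.2 = hatK0 r s l m f %[ae mu2]].
Proof.
have mn : measurable_fun setT (fun x => normc (hat f x)) by apply: measurable_normc; exact: mhat.
have sym := hat_hermitian hf.
have iU : inL2C (hatU0 r s l m f).
  apply: (ae_le_inL2C l0 _ (hat_inL2C hf)).
    rewrite (_ : hatU0 r s l m f = (fun x => sgnC (hat f x)) \*
        (fun x => (initP (normc (hat f x)) (lx x) (mx x))%:C)); last first.
      by apply/funext => x; exact: hatU0E.
    apply: measurable_cplxM; first by apply: measurable_cplx_sgnC; exact: mhat.
    by apply: measurable_cplx_real; exact: measurable_initP.
  apply: nearW => x; rewrite hatU0E; have [h _] := init_le (hat f x) (lx0 x) (mx0 x).
  by apply: le_trans h; exact/lxE/sqr_ge0.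
have iK : inL2C (hatK0 r s l m f).
  apply: (ae_le_inL2C m0 _ (hat_inL2C hf)).
    rewrite (_ : hatK0 r s l m f =
        (fun x => (initP (normc (hat f x)) (mx x) (lx x))%:C)); last first.
      by apply/funext => x; exact: hatK0E.
    by apply: measurable_cplx_real; exact: measurable_initP.
  apply: nearW => x; rewrite hatK0E; have [_ h] := init_le (hat f x) (lx0 x) (mx0 x).
  by apply: le_trans h; exact/mxE/sqr_ge0.
have [|u hu eu] := hat_surjective iU.
  apply: filterS sym => x e; rewrite !hatU0E /lx /mx DeltaN.
  by rewrite conjc_realM e sgnC_conj normc_conj.
have [|k hk ek] := hat_surjective iK.
  apply: filterS sym => x e; rewrite !hatK0E /lx /mx DeltaN.
  by rewrite conjc_real e normc_conj.
exists (u, k); split=> //; move: eu ek => /(ae_eqE mu2) eu /(ae_eqE mu2) ek.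
apply: filterS2 eu ek => x /= -> ->; rewrite hatU0E hatK0E.
by have [] := init_spec (hat f x) (lx0 x) (mx0 x).
Qed.

(** At almost every frequency the initial values are optimal among all complex pairs, in particular
    against the transforms of real competitors. *)
Lemma init_argmin (U K : R * R -> R) : inL2 U -> inL2 K ->
  hat U = hatU0 r s l m f %[ae mu2] -> hat K = hatK0 r s l m f %[ae mu2] ->
  argmin (@L2pairs R) (energy r s l m f (fun=> 0) (fun=> 0)) (U, K).
Proof.
move=> hU hK /(ae_eqE mu2) eU /(ae_eqE mu2) eK; split; first by split.
move=> [u k] [hu hk]; rewrite [(u, k).1]/= in hu; rewrite [(u, k).2]/= in hk.
have h0 := @inL20 R.
rewrite (energyE r s l m hf h0 h0 hU hK) (energyE r s l m hf h0 h0 hu hk).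
have [mz mU mK mu mk] := And5 (mhat h0) (mhat hU) (mhat hK) (mhat hu) (mhat hk).
apply: (fourier_energy_le l0 m0 (mhat hf) mz mz mU mK mz mz mu mk).
have /(ae_eqE mu2) e0 := @hat0 R.
apply: filterS3 eU eK e0 => x eU eK e0.
rewrite /Jx eU eK e0 hatU0E hatK0E.
by have [_ /(_ (hat u x) (hat k x))] := init_spec (hat f x) (lx0 x) (mx0 x).
Qed.

Section step.
Variables (U K : R * R -> R).
Hypotheses (hU : inL2 U) (hK : inL2 K).
Hypothesis al : \forall x \ae mu2, aligned (hat f x) (hat U x) (hat K x).

Let hu x := optu (lx x) (mx x) (hat f x) (hat U x) (hat K x).
Let hk x := optk (lx x) (mx x) (hat f x) (hat U x) (hat K x).

Let mhu : measurable_cplx hu.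
Proof. by apply: measurable_optu => //; exact: mhat. Qed.

Let mhk : measurable_cplx hk.
Proof. by apply: measurable_optk => //; exact: mhat. Qed.

Let ihu : inL2C hu.
Proof.
apply: (ae_le_inL2C l0 mhu (hat_inL2C hf)).
apply: filterS al => x ax; have [h _] := Jz_opt_le (lx0 x) (mx0 x) ax.
by apply: le_trans h; exact/lxE/sqr_ge0.
Qed.

Let ihk : inL2C hk.
Proof.
apply: (ae_le_inL2C m0 mhk (hat_inL2C hf)).
apply: filterS al => x ax; have [_ h] := Jz_opt_le (lx0 x) (mx0 x) ax.
by apply: le_trans h; exact/mxE/sqr_ge0.
Qed.

Let step_argmin :
  argmin (@L2pairsC R) (fourier_energy r s l m (hat f) (hat U) (hat K)) (hu, hk).
Proof.
split; first by split.
move=> [p q] [hp hq]; rewrite [(p, q).1]/= in hp; rewrite [(p, q).2]/= in hq.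
have [mU mK] := conj (mhat hU) (mhat hK).
have [mp mq] := conj (measurable_cplx_inL2C hp) (measurable_cplx_inL2C hq).
apply: (fourier_energy_le l0 m0 (mhat hf) mU mK mhu mhk mU mK mp mq).
apply: filterS al => x ax.
by have [_ _ _ /(_ (p x) (q x))] := opt_spec (lx0 x) (mx0 x) ax.
Qed.

(** The weights are even, and [optu] and [optk] depend only on moduli and on the sign of the data,
    which conjugation respects. *)
Let step_hermitian : \forall x \ae mu2, hu x = (hu (- x))^* /\ hk x = hk (- x).
Proof.
apply: filterS3 (hat_hermitian hf) (hat_hermitian hU) (hat_hermitian hK) => x ef eU eK.
have lN : lx (- x) = lx x by rewrite /lx DeltaN.
have mN : mx (- x) = mx x by rewrite /mx DeltaN.
by rewrite /hu /hk lN mN; exact: opt_hermitian.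
Qed.

Let step_nonneg : \forall x \ae mu2, 0 <= hk x /\ (hu x != 0 -> sgnC (hu x) = sgnC (hat f x)).
Proof.
apply: filterS al => x ax; have [KQ UP _ _] := opt_spec (lx0 x) (mx0 x) ax.
split; first by rewrite /hk real_complex_ge0 subr_ge0.
rewrite /hu /optu mulf_eq0 negb_or => /andP[z0 P0].
have z0' : hat f x != 0 by apply: contra_neq z0 => ->; rewrite sgnCE mulr0.
apply: sgnC_sgnCM => //; rewrite lt0r subr_ge0 UP andbT.
by apply: contra_neq P0 => ->.
Qed.

Lemma step_exists : exists p : (R * R -> R) * (R * R -> R),
  [/\ inL2 p.1 /\ inL2 p.2, \forall x \ae mu2, aligned (hat f x) (hat p.1 x) (hat p.2 x) &
    exists hu hk : R * R -> R[i],
      [/\ argmin (@L2pairsC R) (fourier_energy r s l m (hat f) (hat U) (hat K)) (hu, hk),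
          admissible_increment (hat f) hu hk,
          hat p.1 = hat U \+ hu %[ae mu2] & hat p.2 = hat K \+ hk %[ae mu2]]].
Proof.
have [|u iu eu] := hat_surjective ihu; first by apply: filterS step_hermitian => x [].
have [|k ik ek] := hat_surjective ihk.
  (* [hk] is even and, being nonnegative, real; hence it is Hermitian. *)
  apply: filterS2 step_hermitian (ae_opp step_nonneg) => x [_ e] [+ _].
  by rewrite -e => /ge0_normc ->; rewrite conjc_real.
move: eu ek => /(ae_eqE mu2) eu /(ae_eqE mu2) ek.
have /(ae_eqE mu2) dU := hatD hU iu; have /(ae_eqE mu2) dK := hatD hK ik.
have eU : \forall x \ae mu2, hat (U \+ u) x = hat U x + hu x.
  by apply: filterS2 dU eu => x -> /= ->.
have eK : \forall x \ae mu2, hat (K \+ k) x = hat K x + hk x.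
  by apply: filterS2 dK ek => x -> /= ->.
exists (U \+ u, K \+ k); split; first by split; exact: inL2D.
  by apply: filterS3 al eU eK => x ax -> ->; exact: aligned_opt.
exists hu, hk; split=> //; [|exact/(ae_eqE mu2)|exact/(ae_eqE mu2)].
by apply: filterS2 step_hermitian step_nonneg => x [? ?] [? ?]; split.
Qed.

End step.

(** The complex minimiser agrees almost everywhere with the transforms of the real pair (U' - U, K'
    - K), so it remains minimal in the smaller class of transforms of real pairs. *)
Lemma step_argmin_energy (U K U' K' : R * R -> R) (hu hk : R * R -> R[i]) :
  inL2 U -> inL2 K -> inL2 U' -> inL2 K' ->
  argmin (@L2pairsC R) (fourier_energy r s l m (hat f) (hat U) (hat K)) (hu, hk) ->
  hat U' = hat U \+ hu %[ae mu2] -> hat K' = hat K \+ hk %[ae mu2] ->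
  argmin (@L2pairs R) (energy r s l m f U K) (U' \- U, K' \- K).
Proof.
move=> iU iK iU' iK' [[ihu ihk] min] /(ae_eqE mu2) eU /(ae_eqE mu2) eK.
rewrite [(hu, hk).1]/= in ihu; rewrite [(hu, hk).2]/= in ihk.
have iu := inL2B iU' iU; have ik := inL2B iK' iK.
split; first by split.
move=> [u k] [hu' hk']; rewrite [(u, k).1]/= in hu'; rewrite [(u, k).2]/= in hk'.
rewrite (energyE r s l m hf iU iK iu ik) (energyE r s l m hf iU iK hu' hk').
apply: le_trans (min (hat u, hat k) _); last by split; exact: hat_inL2C.
rewrite le_eqVlt; apply/orP; left; apply/eqP.
have /(ae_eqE mu2) dU := hatB iU' iU; have /(ae_eqE mu2) dK := hatB iK' iK.
have du : \forall x \ae mu2, hat (U' \- U) x = hu x.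
  by apply: filterS2 dU eU => x -> /= ->; rewrite addrC addKr.
have dk : \forall x \ae mu2, hat (K' \- K) x = hk x.
  by apply: filterS2 dK eK => x -> /= ->; rewrite addrC addKr.
have [mU mK] := conj (mhat iU) (mhat iK).
apply: (fourier_energy_ae r s l0 m0 (mhat hf) mU mK (mhat iu) (mhat ik) mU mK
  (measurable_cplx_inL2C ihu) (measurable_cplx_inL2C ihk)).
- exact: nearW.
- exact: nearW.
- exact/(ae_eqE mu2).
- exact/(ae_eqE mu2).
Qed.

End parameters.

End scheme.

Theorem lemma3p7 (R : realType) (r s : R) (lam mu : nat -> R) (f : R * R -> R)
  (r_ge0 : 0 <= r) (s_ge0 : 0 <= s)
  (lam_gt0 : forall n, 0 < lam n) (mu_gt0 : forall n, 0 < mu n)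
  (lam_decr : nonincreasing_seq lam) (mu_decr : nonincreasing_seq mu)
  (f_L2 : inL2 f) (hatf_compact : compact_fourier_support f) :
  (exists U K : nat -> R * R -> R,
     [/\ multiscale_minimizers r s lam mu f U K,
         nonneg_transforms K &
         computed_iteratively r s lam mu f U K]) /\
  (forall U K : nat -> R * R -> R,
     computed_iteratively r s lam mu f U K ->
     multiscale_minimizers r s lam mu f U K /\ nonneg_transforms K).
Proof.
(* Every computed sequence is minimising, so existence reduces to constructing one computed
   sequence. *)
have spec (U K : nat -> R * R -> R) : computed_iteratively r s lam mu f U K ->
    multiscale_minimizers r s lam mu f U K /\ nonneg_transforms K.
  move=> [iUK [eU0 eK0] st]; split.
    split; first by have [] := iUK 0%N; move=> *; exact: init_argmin.
    move=> n; have [iU iK] := iUK n; have [iU' iK'] := iUK n.+1.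
    by have [hu [hk [am _ eU eK]]] := st n; exact: step_argmin_energy am eU eK.
  elim=> [|n IHn].
    move/(ae_eqE (@lebesgue2 R)): eK0; apply: filterS => x ->.
    by rewrite /hatK0 real_complex_ge0 sqrtr_ge0.
  have [hu [hk [_ adm _ /(ae_eqE (@lebesgue2 R)) eK]]] := st n.
  by apply: filterS3 IHn adm eK => x h [h' _ _ _] -> /=; rewrite addr_ge0.
split; last exact: spec.
(* The invariant includes alignment, under which [step_exists] provides the next increment. *)
pose good (p : (R * R -> R) * (R * R -> R)) := [/\ inL2 p.1, inL2 p.2 &
  \forall x \ae @lebesgue2 R, aligned (hat f x) (hat p.1 x) (hat p.2 x)].
pose next n (p p' : (R * R -> R) * (R * R -> R)) := exists hu hk : R * R -> R[i],
  [/\ argmin (@L2pairsC R)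
        (fourier_energy r s (lam n.+1) (mu n.+1) (hat f) (hat p.1) (hat p.2)) (hu, hk),
      admissible_increment (hat f) hu hk,
      hat p'.1 = hat p.1 \+ hu %[ae @lebesgue2 R] &
      hat p'.2 = hat p.2 \+ hk %[ae @lebesgue2 R]].
have [p0 [[i1 i2] al0 e1 e2]] := init_exists r_ge0 s_ge0 (lam_gt0 0%N) (mu_gt0 0%N) f_L2.
(* With [good p] as a premise under the existential, the successor is a total function; the sequence
   is then defined by plain recursion and its goodness proved afterwards. *)
have ex n p : exists p', good p -> good p' /\ next n p p'.
  have [[iU iK al]|ng] := pselect (good p); last by exists p => /ng.
  have [p' [[iU' iK'] al' st]] :=
    step_exists r_ge0 s_ge0 (lam_gt0 n.+1) (mu_gt0 n.+1) f_L2 iU iK al.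
  by exists p' => _; split; [split; [exact: iU'|exact: iK'|exact: al']|exact: st].
pose F n p := sval (cid (ex n p)).
pose S := fix S n := if n is n'.+1 then F n' (S n') else p0.
have Sg n : good (S n).
  elim: n => [|n IHn]; first by split; [exact: i1|exact: i2|exact: al0].
  exact: (svalP (cid (ex n (S n))) IHn).1.
have Sn n : next n (S n) (S n.+1).
  exact: (svalP (cid (ex n (S n))) (Sg n)).2.
have ci : computed_iteratively r s lam mu f (fun n => (S n).1) (fun n => (S n).2).
  split; [by move=> n; have [iU iK _] := Sg n; split|by split; [exact: e1|exact: e2]|].
  exact: Sn.
have [mm nn] := spec _ _ ci; exists (fun n => (S n).1), (fun n => (S n).2).
by split; [exact: mm|exact: nn|exact: ci].
Qed.
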